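(* The following are equivalent over $\mathsf{RCA}_0+\mathsf{IPP}$: (i) The cohesive principle $\mathsf{COH}$ holds. (ii) Every continuous function $f\colon[0,1]\to\mathbb R$ is Riemann integrable.
   Context: $\mathsf{RCA}_0$ is the usual base system of second-order arithmetic (basic arithmetic axioms, $\Sigma^0_1$-induction, $\Delta^0_1$-comprehension). ''Equivalent over $T$'' means that the equivalence, formalized in second-order arithmetic, is provable in $T$. Reals. A real is a Cauchy sequence $x=(x_n)_{n\in\mathbb N}$ of rationals with no rate of convergence given: for each rational $\varepsilon>0$ there is an $N\in\mathbb N$ with $|x_m-x_n|<\varepsilon$ for all $m,n\geq N$. For reals $x,y$: $x\leq y$ means that for each rational $\varepsilon>0$ there is an $N$ with $x_n\leq y_n+\varepsilon$ for all $n\geq N$; $x=y$ means $x\leq y$ and $y\leq x$; $x<y$ means $x\leq y$ but not $x=y$. Addition, multiplication and absolute value are defined pointwise; rationals are identified with constant sequences. Put $B_\delta(y)=\{z\in\mathbb R:|y-z|<\delta\}$ and $[0,1]=\{x\in\mathbb R:0\leq x\leq 1\}$. Sums and maxima of finite families of reals (of arbitrary finite length) are defined pointwise on the representing sequences; that they are reals uses $\mathsf{IPP}$. Continuous functions. A partial continuous function on $\mathbb R$ is (represented by) an arbitrary function $f\colon\mathbb Q\to\mathbb Q^{\mathbb N}$, $f(q)=(f(q)_i)_{i\in\mathbb N}$. A real $x$ lies in $\operatorname{dom}(f)$ if each $\varepsilon>0$ admits a (positive) $N\in\mathbb N$ such that $|f(q)_i-f(r)_j|<\varepsilon$ for all rationals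 $q,r\in B_{1/N}(x)$ and all $i,j\geq N$. For $x=(x_i)\in\operatorname{dom}(f)$ the value is the real $f(x)=(f(x_i)_i)_{i\in\mathbb N}$. A continuous function $f\colon D\to\mathbb R$ is such an $f$ with $D\subseteq\operatorname{dom}(f)$. Riemann integral. A partition $P$ of $[0,1]$ is a finite collection of pairwise disjoint intervals with union $[0,1]$; $\Delta I$ is the length of the interval $I$ and $\Delta P=\max\{\Delta I:I\in P\}$. A continuous $f\colon[0,1]\to\mathbb R$ is Riemann integrable if there is a real number $\int_{[0,1]}f(x)\,dx$ such that any $\varepsilon>0$ admits a $\delta>0$ such that $\left|\int_{[0,1]}f(x)\,dx-\sum_{I\in P}f(t_I)\cdot\Delta I\right|<\varepsilon$ holds for any partition $P$ of $[0,1]$ with $\Delta P<\delta$ and any choice of $t_I\in I$ for $I\in P$. Principles. $\mathsf{IPP}$ (infinite pigeonhole principle): for any $N\in\mathbb N$ and any $c\colon\mathbb N\to\{0,\ldots,N\}$ there is an $n\leq N$ such that $\{i\in\mathbb N:c(i)=n\}$ is infinite. $\mathsf{COH}$ (cohesive principle): for any family of sets $(R_i)_{i\in\mathbb N}$, $R_i\subseteq\mathbb N$, there is an infinite set $C\subseteq\mathbb N$ such that for each $i$, $C\setminus R_i$ is finite or $C\setminus(\mathbb N\setminus R_i)$ is finite. *)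

(* Defs.v *)
(* The formal system: the two-sorted language of second-order arithmetic, a
   natural deduction calculus for classical logic, and RCA_0 + IPP as an axiom
   system.  The two principles are sentences of that language, and
   "equivalent over T" is provability of the biconditional in T. *)

From Stdlib Require Import List.
Import ListNotations.

(* de Bruijn indices, with separate index spaces for the number variables and
   for the set variables; sets are not denoted by any term but variables. *)
Inductive term : Type :=
| TVar (i : nat)
| TZero
| TOne
| TAdd (s t : term)
| TMul (s t : term).

Inductive form : Type :=
| FBot
| FEq (s t : term)
| FLt (s t : term)
| FMem (t : term) (X : nat)
| FImp (p q : form)
| FAllN (p : form)
| FAllS (p : form).

(* The logic is classical, so the other connectives are abbreviations. *)
Definition FNeg p := FImp p FBot.
Definition FAnd p q := FNeg (FImp p (FNeg q)).
Definition FOr p q := FImp (FNeg p) q.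
Definition FIff p q := FAnd (FImp p q) (FImp q p).
Definition FExN p := FNeg (FAllN (FNeg p)).
Definition FExS p := FNeg (FAllS (FNeg p)).

Fixpoint tsubst (sg : nat -> term) (t : term) : term :=
  match t with
  | TVar i => sg i
  | TZero => TZero
  | TOne => TOne
  | TAdd s t => TAdd (tsubst sg s) (tsubst sg t)
  | TMul s t => TMul (tsubst sg s) (tsubst sg t)
  end.

Definition tshift : term -> term := tsubst (fun i => TVar (S i)).

Definition upN (sg : nat -> term) (i : nat) : term :=
  match i with 0 => TVar 0 | S i => tshift (sg i) end.

Definition upS (ta : nat -> nat) (i : nat) : nat :=
  match i with 0 => 0 | S i => S (ta i) end.

(* [sg] substitutes the number variables, [ta] renames the set variables. *)
Fixpoint fsubst (sg : nat -> term) (ta : nat -> nat) (p : form) : form :=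
  match p with
  | FBot => FBot
  | FEq s t => FEq (tsubst sg s) (tsubst sg t)
  | FLt s t => FLt (tsubst sg s) (tsubst sg t)
  | FMem t X => FMem (tsubst sg t) (ta X)
  | FImp p q => FImp (fsubst sg ta p) (fsubst sg ta q)
  | FAllN p => FAllN (fsubst (upN sg) ta p)
  | FAllS p => FAllS (fsubst sg (upS ta) p)
  end.

Definition shiftN : form -> form := fsubst (fun i => TVar (S i)) (fun X => X).
Definition shiftS : form -> form := fsubst TVar S.

Definition instN (p : form) (t : term) : form :=
  fsubst (fun i => match i with 0 => t | S i => TVar i end) (fun X => X) p.
Definition instS (p : form) (Y : nat) : form :=
  fsubst TVar (fun X => match X with 0 => Y | S X => X end) p.

(* Because the axioms in [T] are not shifted by the introduction rules for the
   quantifiers, an open formula in [T] has the force of its universal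
   closure. *)
Inductive prv (T : form -> Prop) : list form -> form -> Prop :=
| prv_ax G p : T p -> prv T G p
| prv_hyp G p : In p G -> prv T G p
| prv_impI G p q : prv T (p :: G) q -> prv T G (FImp p q)
| prv_impE G p q : prv T G (FImp p q) -> prv T G p -> prv T G q
| prv_raa G p : prv T (FNeg p :: G) FBot -> prv T G p
| prv_allNI G p : prv T (map shiftN G) p -> prv T G (FAllN p)
| prv_allNE G p t : prv T G (FAllN p) -> prv T G (instN p t)
| prv_allSI G p : prv T (map shiftS G) p -> prv T G (FAllS p)
| prv_allSE G p Y : prv T G (FAllS p) -> prv T G (instS p Y)
| prv_eq_refl G t : prv T G (FEq t t)
| prv_eq_subst G p s t :
    prv T G (FEq s t) -> prv T G (instN p s) -> prv T G (instN p t).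

Definition equivalent_over (T : form -> Prop) (p q : form) : Prop :=
  prv T [] (FIff p q).

(* An [nexp] (resp. [sexp]) is a number term (resp. set variable), given as a
   function of the number of binders of its sort above the place where it is
   used; an [fexp] is a formula given as a function of the number of number
   binders and of set binders above it.  A variable bound below [n] binders
   has index [n' - S n] when used below [n'] binders; hence weakening is
   automatic and formulas can be written with the binders of the metalanguage.
   The sentence denoted by a closed [fexp] is its value at [0 0]. *)
Definition nexp := nat -> term.
Definition sexp := nat -> nat.
Definition fexp := nat -> nat -> form.

Definition allN (f : nexp -> fexp) : fexp :=
  fun n m => FAllN (f (fun n' => TVar (n' - S n)) (S n) m).
Definition exN (f : nexp -> fexp) : fexp :=
  fun n m => FExN (f (fun n' => TVar (n' - S n)) (S n) m).
Definition allS (f : sexp -> fexp) : fexp :=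
  fun n m => FAllS (f (fun m' => m' - S m) n (S m)).
Definition exS (f : sexp -> fexp) : fexp :=
  fun n m => FExS (f (fun m' => m' - S m) n (S m)).

Definition n_zero : nexp := fun _ => TZero.
Definition n_one : nexp := fun _ => TOne.
Definition nadd (s t : nexp) : nexp := fun n => TAdd (s n) (t n).
Definition nmul (s t : nexp) : nexp := fun n => TMul (s n) (t n).

Definition feq (s t : nexp) : fexp := fun n m => FEq (s n) (t n).
Definition flt (s t : nexp) : fexp := fun n m => FLt (s n) (t n).
Definition fmem (s : nexp) (X : sexp) : fexp := fun n m => FMem (s n) (X m).
Definition fneg (p : fexp) : fexp := fun n m => FNeg (p n m).
Definition fimp (p q : fexp) : fexp := fun n m => FImp (p n m) (q n m).
Definition fand (p q : fexp) : fexp := fun n m => FAnd (p n m) (q n m).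
Definition f_or (p q : fexp) : fexp := fun n m => FOr (p n m) (q n m).
Definition fiff (p q : fexp) : fexp := fun n m => FIff (p n m) (q n m).

Declare Scope l2_scope.
Delimit Scope l2_scope with l2.

Notation "'𝟎'" := n_zero : l2_scope.
Notation "'𝟏'" := n_one : l2_scope.
Notation "s ⊕ t" := (nadd s t) (at level 50, left associativity) : l2_scope.
Notation "s ⊗ t" := (nmul s t) (at level 40, left associativity) : l2_scope.
Notation "s ≐ t" := (feq s t) (at level 70, no associativity) : l2_scope.
Notation "s ≺ t" := (flt s t) (at level 70, no associativity) : l2_scope.
Notation "s ∈ X" := (fmem s X) (at level 70, no associativity) : l2_scope.
Notation "s ∉ X" := (fneg (fmem s X)) (at level 70, no associativity)
  : l2_scope.
Notation "¬ p" := (fneg p) (at level 75, right associativity) : l2_scope.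
Notation "p ∧ q" := (fand p q) (at level 80, right associativity) : l2_scope.
Notation "p ∨ q" := (f_or p q) (at level 85, right associativity) : l2_scope.
Notation "p ⇒ q" := (fimp p q) (at level 90, right associativity) : l2_scope.
Notation "p ⇔ q" := (fiff p q) (at level 95, no associativity) : l2_scope.
Notation "∀ x .. y , p" := (allN (fun x => .. (allN (fun y => p)) ..))
  (at level 200, x binder, y binder, right associativity) : l2_scope.
Notation "∃ x .. y , p" := (exN (fun x => .. (exN (fun y => p)) ..))
  (at level 200, x binder, y binder, right associativity) : l2_scope.
Notation "∀² X .. Y , p" := (allS (fun X => .. (allS (fun Y => p)) ..))
  (at level 200, X binder, Y binder, right associativity) : l2_scope.
Notation "∃² X .. Y , p" := (exS (fun X => .. (exS (fun Y => p)) ..))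
  (at level 200, X binder, Y binder, right associativity) : l2_scope.

Local Open Scope l2_scope.

Definition fle (s t : nexp) : fexp := s ≺ t ∨ s ≐ t.
Notation "s ≼ t" := (fle s t) (at level 70, no associativity) : l2_scope.

Definition sentence (p : fexp) : form := p 0 0.

(* The shift says that the bound t does not contain the bound variable.  As
   the logic is classical, bounded existential quantifiers are covered. *)
Inductive bounded : form -> Prop :=
| bounded_bot : bounded FBot
| bounded_eq s t : bounded (FEq s t)
| bounded_lt s t : bounded (FLt s t)
| bounded_mem t X : bounded (FMem t X)
| bounded_imp p q : bounded p -> bounded q -> bounded (FImp p q)
| bounded_all t p :
    bounded p -> bounded (FAllN (FImp (FLt (TVar 0) (tshift t)) p)).

Definition sigma01 (p : form) : Prop := exists q, bounded q /\ p = FExN q.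
Definition pi01 (p : form) : Prop := exists q, bounded q /\ p = FAllN q.

(* In the next two definitions number variable 0 of the given formulas is the
   induction/comprehension variable; all other free variables are parameters.
   The shift keeps the new set from occurring in p. *)
Definition induction (p : form) : form :=
  let step :=
    fsubst (fun i => match i with 0 => TAdd (TVar 0) TOne | S i => TVar (S i) end)
      (fun X => X) p in
  FImp (FAnd (instN p TZero) (FAllN (FImp p step))) (FAllN p).

Definition comprehension (p q : form) : form :=
  FImp (FAllN (FIff p q)) (FExS (FAllN (FIff (FMem (TVar 0) 0) (shiftS p)))).

Inductive RCA0 : form -> Prop :=
| rca_succ_neq0 : RCA0 (sentence (∀ m, ¬ m ⊕ 𝟏 ≐ 𝟎))
| rca_succ_inj : RCA0 (sentence (∀ m n, m ⊕ 𝟏 ≐ n ⊕ 𝟏 ⇒ m ≐ n))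
| rca_add0 : RCA0 (sentence (∀ m, m ⊕ 𝟎 ≐ m))
| rca_addS : RCA0 (sentence (∀ m n, m ⊕ (n ⊕ 𝟏) ≐ (m ⊕ n) ⊕ 𝟏))
| rca_mul0 : RCA0 (sentence (∀ m, m ⊗ 𝟎 ≐ 𝟎))
| rca_mulS : RCA0 (sentence (∀ m n, m ⊗ (n ⊕ 𝟏) ≐ (m ⊗ n) ⊕ m))
| rca_lt0 : RCA0 (sentence (∀ m, ¬ m ≺ 𝟎))
| rca_ltS : RCA0 (sentence (∀ m n, m ≺ n ⊕ 𝟏 ⇔ (m ≺ n ∨ m ≐ n)))
| rca_induction p : sigma01 p -> RCA0 (induction p)
| rca_comprehension p q :
    sigma01 p -> pi01 q -> RCA0 (comprehension p q).

Definition npair (s t : nexp) : nexp := (s ⊕ t) ⊗ (s ⊕ t) ⊕ s.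
Notation "⟨ s , t ⟩" := (npair s t) (at level 0) : l2_scope.

Definition class := nexp -> fexp.

Definition is_nat : class := fun n => n ≐ n.

Definition is_fun (D E : class) (F : sexp) : fexp :=
  (∀ z, z ∈ F ⇒ ∃ x y, z ≐ ⟨x, y⟩ ∧ D x ∧ E y) ∧
  (∀ x, D x ⇒ ∃ y, ⟨x, y⟩ ∈ F ∧ ∀ y', ⟨x, y'⟩ ∈ F ⇒ y' ≐ y).

(* "K (F x)": a formula about the value of a function, with the value passed
   to the continuation K.  The same device is used below for all partially
   defined or non-term-denoted values. *)
Definition value (F : sexp) (x : nexp) (K : nexp -> fexp) : fexp :=
  ∃ y, ⟨x, y⟩ ∈ F ∧ K y.

Definition infinite (P : class) : fexp := ∀ m, ∃ n, m ≼ n ∧ P n.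
Definition finite (P : class) : fexp := ∃ m, ∀ n, P n ⇒ n ≺ m.

Definition IPP : fexp :=
  ∀ N, ∀² c, is_fun is_nat (fun n => n ≼ N) c ⇒
  ∃ n, n ≼ N ∧ infinite (fun i => ⟨i, n⟩ ∈ c).

Definition COH : fexp :=
  ∀² R, ∃² C, infinite (fun n => n ∈ C) ∧
  ∀ i, finite (fun n => n ∈ C ∧ ¬ ⟨i, n⟩ ∈ R) ∨
       finite (fun n => n ∈ C ∧ ¬ (¬ ⟨i, n⟩ ∈ R)).

Definition RCA0_IPP (p : form) : Prop := RCA0 p \/ p = sentence IPP.

(* The fraction (qpos - qneg) / qden; qden is always a positive number. *)
Record frac := Frac { qpos : nexp; qneg : nexp; qden : nexp }.

Definition q0 : frac := Frac 𝟎 𝟎 𝟏.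
Definition q1 : frac := Frac 𝟏 𝟎 𝟏.
Definition qinv (N : nexp) : frac := Frac 𝟏 𝟎 N.

Definition qadd (u v : frac) : frac :=
  Frac (qpos u ⊗ qden v ⊕ qpos v ⊗ qden u)
       (qneg u ⊗ qden v ⊕ qneg v ⊗ qden u) (qden u ⊗ qden v).
Definition qopp (u : frac) : frac := Frac (qneg u) (qpos u) (qden u).
Definition qsub (u v : frac) : frac := qadd u (qopp v).
Definition qmul (u v : frac) : frac :=
  Frac (qpos u ⊗ qpos v ⊕ qneg u ⊗ qneg v)
       (qpos u ⊗ qneg v ⊕ qneg u ⊗ qpos v) (qden u ⊗ qden v).

Definition qlt (u v : frac) : fexp :=
  qpos u ⊗ qden v ⊕ qneg v ⊗ qden u ≺ qpos v ⊗ qden u ⊕ qneg u ⊗ qden v.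
Definition qeq (u v : frac) : fexp :=
  qpos u ⊗ qden v ⊕ qneg v ⊗ qden u ≐ qpos v ⊗ qden u ⊕ qneg u ⊗ qden v.
Definition qle (u v : frac) : fexp := qlt u v ∨ qeq u v.

Definition qabs (u : frac) (K : frac -> fexp) : fexp :=
  ∃ c, (qpos u ≐ qneg u ⊕ c ∨ qneg u ≐ qpos u ⊕ c) ∧ K (Frac c 𝟎 (qden u)).

(* The code of the fraction (a - b) / (c + 1). *)
Definition qcode (a b c : nexp) : nexp := ⟨⟨a, b⟩, c⟩.
Definition decode (q : nexp) (K : frac -> fexp) : fexp :=
  ∃ a b c, q ≐ qcode a b c ∧ K (Frac a b (c ⊕ 𝟏)).

(* A rational number is the least code among the codes of equal fractions. *)
Definition is_rat : class := fun q =>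
  decode q (fun u =>
    ∀ a b c, qeq (Frac a b (c ⊕ 𝟏)) u ⇒ q ≼ qcode a b c).

Definition all_pos_rat (K : frac -> fexp) : fexp :=
  ∀ q, is_rat q ⇒ decode q (fun u => qlt q0 u ⇒ K u).
Definition ex_pos_rat (K : frac -> fexp) : fexp :=
  ∃ q, is_rat q ∧ decode q (fun u => qlt q0 u ∧ K u).

Notation "∀⁺ e , p" := (all_pos_rat (fun e => p))
  (at level 200, e binder, right associativity) : l2_scope.
Notation "∃⁺ e , p" := (ex_pos_rat (fun e => p))
  (at level 200, e binder, right associativity) : l2_scope.

(* Definable sequences of rational numbers, given by codes resp. by fractions:
   [x n K] says that K holds of the n-th entry. *)
Definition cseq := nexp -> (nexp -> fexp) -> fexp.
Definition rseq := nexp -> (frac -> fexp) -> fexp.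

Definition fracs (x : cseq) : rseq := fun n K => x n (fun q => decode q K).

Definition seq_of (X : sexp) : cseq := fun n K => value X n K.
Definition row (L : sexp) (j : nexp) : cseq := fun n K => value L ⟨j, n⟩ K.

Definition rconst (u : frac) : rseq := fun n K => K u.
Definition lift2 (op : frac -> frac -> frac) (x y : rseq) : rseq :=
  fun n K => x n (fun u => y n (fun v => K (op u v))).
Definition rsub : rseq -> rseq -> rseq := lift2 qsub.
Definition rmul : rseq -> rseq -> rseq := lift2 qmul.
Definition rabs (x : rseq) : rseq := fun n K => x n (fun u => qabs u K).

Definition cauchy (x : rseq) : fexp :=
  ∀⁺ e, ∃ N, ∀ m n, N ≼ m ⇒ N ≼ n ⇒
  x m (fun u => x n (fun v => qabs (qsub u v) (fun d => qlt d e))).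

Definition rle (x y : rseq) : fexp :=
  ∀⁺ e, ∃ N, ∀ n, N ≼ n ⇒ x n (fun u => y n (fun v => qle u (qadd v e))).
Definition req (x y : rseq) : fexp := rle x y ∧ rle y x.
Definition rlt (x y : rseq) : fexp := rle x y ∧ ¬ req x y.

Definition is_real (X : sexp) : fexp :=
  is_fun is_nat is_rat X ∧ cauchy (fracs (seq_of X)).

Definition in_unit (x : rseq) : fexp := rle (rconst q0) x ∧ rle x (rconst q1).

(* A family of reals of length k is a single set that codes a function of the
   pairs ⟨j, n⟩ with j < k; entry j is [row L j]. *)
Definition is_family (k : nexp) (L : sexp) : fexp :=
  is_fun (fun z => ∃ j n, z ≐ ⟨j, n⟩ ∧ j ≺ k) is_rat L ∧
  (∀ j, j ≺ k ⇒ cauchy (fracs (row L j))).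

(* Pointwise maximum and sum of x 0, ..., x (k - 1).  W is the sequence of
   partial sums of the n-th entries; its values beyond k are irrelevant. *)
Definition rmax (k : nexp) (x : nexp -> rseq) : rseq := fun n K =>
  ∃ i, i ≺ k ∧ x i n (fun u =>
    (∀ j, j ≺ k ⇒ x j n (fun v => qle v u)) ∧ K u).
Definition rsum (k : nexp) (x : nexp -> rseq) : rseq := fun n K =>
  ∃² W, is_fun is_nat is_rat W ∧
    fracs (seq_of W) 𝟎 (fun w => qeq w q0) ∧
    (∀ j, j ≺ k ⇒
       fracs (seq_of W) j (fun w => fracs (seq_of W) (j ⊕ 𝟏) (fun w' =>
         x j n (fun u => qeq w' (qadd w u))))) ∧
    fracs (seq_of W) k K.

(* A function from Q to Q^N is given in uncurried form. *)
Definition is_partial_continuous (F : sexp) : fexp :=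
  is_fun (fun z => ∃ q i, z ≐ ⟨q, i⟩ ∧ is_rat q) is_rat F.

Definition in_ball (e : frac) (x : rseq) (q : nexp) : fexp :=
  decode q (fun u => rlt (rabs (rsub x (rconst u))) (rconst e)).

Definition in_dom (F : sexp) (x : rseq) : fexp :=
  ∀⁺ e, ∃ N, 𝟎 ≺ N ∧
  ∀ q r, is_rat q ∧ in_ball (qinv N) x q ⇒ is_rat r ∧ in_ball (qinv N) x r ⇒
  ∀ i j, N ≼ i ⇒ N ≼ j ⇒
  fracs (row F q) i (fun u => fracs (row F r) j (fun v =>
    qabs (qsub u v) (fun d => qlt d e))).

Definition fval (F : sexp) (x : cseq) : cseq :=
  fun n K => x n (fun q => row F q n K).

Definition continuous_on_unit (F : sexp) : fexp :=
  is_partial_continuous F ∧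
  (∀² X, is_real X ∧ in_unit (fracs (seq_of X)) ⇒
    in_dom F (fracs (seq_of X))).

(* A finite collection of k intervals is given by the families L and R of their
   left and right endpoints and by the sets A and B of the (indices of)
   intervals that contain their left resp. right endpoint.  Empty intervals do
   not matter, as tags cannot be chosen in them. *)
Definition in_interval (L R A B : sexp) (j : nexp) (z : rseq) : fexp :=
  (j ∈ A ⇒ rle (fracs (row L j)) z) ∧ (j ∉ A ⇒ rlt (fracs (row L j)) z) ∧
  (j ∈ B ⇒ rle z (fracs (row R j))) ∧ (j ∉ B ⇒ rlt z (fracs (row R j))).

Definition interval_length (L R : sexp) (j : nexp) : rseq :=
  rsub (fracs (row R j)) (fracs (row L j)).

Definition is_partition (k : nexp) (L R A B : sexp) : fexp :=
  is_family k L ∧ is_family k R ∧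
  (∀ j, j ≺ k ⇒ rle (fracs (row L j)) (fracs (row R j))) ∧
  (∀ i j, i ≺ k ⇒ j ≺ k ⇒ ¬ i ≐ j ⇒
    ¬ ∃² Z, is_real Z ∧ in_interval L R A B i (fracs (seq_of Z)) ∧
                        in_interval L R A B j (fracs (seq_of Z))) ∧
  (∀² Z, is_real Z ⇒
    (in_unit (fracs (seq_of Z)) ⇔
     ∃ j, j ≺ k ∧ in_interval L R A B j (fracs (seq_of Z)))).

Definition mesh (k : nexp) (L R : sexp) : rseq := rmax k (interval_length L R).

Definition riemann_sum (F : sexp) (k : nexp) (L R T : sexp) : rseq :=
  rsum k (fun j => rmul (fracs (fval F (row T j))) (interval_length L R j)).

Definition riemann_integrable (F : sexp) : fexp :=
  ∃² J, is_real J ∧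
  ∀⁺ e, ∃⁺ d, ∀ k, ∀² L R A B,
    is_partition k L R A B ⇒ rlt (mesh k L R) (rconst d) ⇒
  ∀² T, is_family k T ⇒
    (∀ j, j ≺ k ⇒ in_interval L R A B j (fracs (row T j))) ⇒
    rlt (rabs (rsub (fracs (seq_of J)) (riemann_sum F k L R T))) (rconst e).

Definition continuous_riemann_integrable : fexp :=
  ∀² F, continuous_on_unit F ⇒ riemann_integrable F.

(* Main.v *)
(** By the completeness theorem it suffices to show that COH and the
    integrability of all continuous functions are equivalent in every model
    (M, S) of RCA_0 + IPP.  There a formula evaluates to a statement about M,
    the ordered field of fractions of M, and the functions that are computable
    relative to elements of S.

    COH implies integrability: if a continuous function were not uniformly
    continuous, there would be counterexamples q_N, r_N at every scale 1 / N.
    A set that is cohesive for the cuts {N : q_N < a} yields a subsequence of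
    (q_N) that is Cauchy, as IPP shows that for each K it stays in a single
    interval of length 1 / K.  Its limit is a point outside the domain of the
    function.  Given uniform continuity, the Riemann sums over the grids i / n
    converge, and a double counting of grid points shows that all Riemann sums
    approach their limit; IPP makes the finitely many endpoints and tags of a
    partition settle simultaneously.

    Conversely, let sets R_i without a cohesive set be given.  The numbers x_n
    in the Cantor set with digits 2 [n in R_i] for i < n have no cluster point,
    so that a sum of bumps of height n around x_n is a continuous function.  By
    IPP some cell of a uniform partition contains infinitely many x_n, and
    moving the tag of this cell through them makes the Riemann sums unbounded. *)

From HB Require Import structures.
From Stdlib Require List.
From mathcomp Require Import all_boot all_order all_algebra boolp ring lra.
Require Import Defs.

Set Implicit Arguments.
Unset Strict Implicit.
Unset Printing Implicit Defensive.
Import Order.TTheory GRing.Theory Num.Theory.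

(** Inside a model comprehension is available for Delta1 predicates and induction for Sigma1 ones,
    and the lengths of families and sums may be nonstandard. So every function that is to become a
    sequence, a family or a partial continuous function has to be computable in parameters, down to
    sums of length [k]; the tactic [definable] derives this from closure properties. The order of
    reals is not decidable and is treated by classical reasoning outside the model.

    The main obstacle is that reals come without a rate of convergence, so no fixed entry of a real
    is informative. Finitely many reals are inspected at an entry after which all have settled up to
    [eta], and the estimates are made for partitions that are correct only up to [eta]. In the other
    direction the partitions have rational endpoints, so that their lengths are exact.

    The Cantor set serves because the ternary digits 0 and 2 leave no room for carries: close points
    have equal leading digits. Bumps of height [n] defeat the integral because the length of the
    chosen cell is fixed before [n] grows. *)

(** * Substitution in the object language *)

Lemma tsubst_comp sg sg' t :
  tsubst sg (tsubst sg' t) = tsubst (fun i => tsubst sg (sg' i)) t.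
Proof. by elim: t => //= [s -> t ->|s -> t ->]. Qed.

Lemma tsubst_id t : tsubst TVar t = t.
Proof. by elim: t => //= [s -> t ->|s -> t ->]. Qed.

Lemma upN_comp sg sg' :
  (fun i => tsubst (upN sg) (upN sg' i)) = upN (fun i => tsubst sg (sg' i)).
Proof. by apply: funext => -[|i] //=; rewrite /tshift !tsubst_comp. Qed.

Lemma upS_comp ta ta' : upS ta \o upS ta' = upS (ta \o ta').
Proof. by apply: funext => -[|i]. Qed.

Lemma fsubst_comp p sg ta sg' ta' :
  fsubst sg ta (fsubst sg' ta' p) =
  fsubst (fun i => tsubst sg (sg' i)) (ta \o ta') p.
Proof.
elim: p sg ta sg' ta' => [|s t|s t|t X|p IHp q IHq|p IH|p IH] sg ta sg' ta' /=.
- by [].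
- by rewrite !tsubst_comp.
- by rewrite !tsubst_comp.
- by rewrite tsubst_comp.
- by rewrite IHp IHq.
- by rewrite IH upN_comp.
- by rewrite IH upS_comp.
Qed.

Lemma upN_id : upN TVar = TVar.
Proof. by apply: funext => -[]. Qed.

Lemma upS_id : upS id = id.
Proof. by apply: funext => -[]. Qed.

Lemma fsubst_id p : fsubst TVar id p = p.
Proof.
elim: p => [|s t|s t|t X|p IHp q IHq|p IH|p IH] /=.
- by [].
- by rewrite !tsubst_id.
- by rewrite !tsubst_id.
- by rewrite tsubst_id.
- by rewrite IHp IHq.
- by rewrite upN_id IH.
- by rewrite upS_id IH.
Qed.

Definition scons (A : Type) (a : A) (e : nat -> A) : nat -> A :=
  fun i => if i is i'.+1 then e i' else a.

Lemma fsubst_instN sg ta p t :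
  fsubst sg ta (instN p t) = instN (fsubst (upN sg) ta p) (tsubst sg t).
Proof.
rewrite /instN !fsubst_comp; congr fsubst.
by apply: funext => -[|i] //=; rewrite /tshift tsubst_comp /= tsubst_id.
Qed.

Lemma fsubst_instS sg ta p Y :
  fsubst sg ta (instS p Y) = instS (fsubst sg (upS ta) p) (ta Y).
Proof.
rewrite /instS !fsubst_comp; congr fsubst.
- by apply: funext => i /=; rewrite tsubst_id.
- by apply: funext => -[|i].
Qed.

Lemma instN_fsubst sg ta p t :
  instN (fsubst (upN sg) ta p) t = fsubst (scons t sg) ta p.
Proof.
rewrite /instN fsubst_comp; congr fsubst.
by apply: funext => -[|i] //=; rewrite /tshift tsubst_comp /= tsubst_id.
Qed.

Lemma instS_fsubst sg ta p Y :
  instS (fsubst sg (upS ta) p) Y = fsubst sg (scons Y ta) p.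
Proof.
rewrite /instS fsubst_comp; congr fsubst.
- by apply: funext => i /=; rewrite tsubst_id.
- by apply: funext => -[|i].
Qed.

Lemma fsubst_shiftN sg ta p :
  fsubst (upN sg) ta (shiftN p) = shiftN (fsubst sg ta p).
Proof. by rewrite /shiftN !fsubst_comp. Qed.

Lemma fsubst_shiftS sg ta p :
  fsubst sg (upS ta) (shiftS p) = shiftS (fsubst sg ta p).
Proof.
rewrite /shiftS !fsubst_comp; congr fsubst.
by apply: funext => i /=; rewrite tsubst_id.
Qed.

Lemma tsubst_support t : exists k, forall sg sg',
  (forall i, i < k -> sg i = sg' i) -> tsubst sg t = tsubst sg' t.
Proof.
elim: t => [i| | |s [k Hs] t [l Ht]|s [k Hs] t [l Ht]].
- by exists i.+1 => sg sg' /(_ i (ltnSn i)).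
- by exists 0.
- by exists 0.
- exists (maxn k l) => sg sg' H /=.
  by rewrite (Hs sg sg') ?(Ht sg sg') // => i Hi; apply: H; rewrite leq_max Hi ?orbT.
- exists (maxn k l) => sg sg' H /=.
  by rewrite (Hs sg sg') ?(Ht sg sg') // => i Hi; apply: H; rewrite leq_max Hi ?orbT.
Qed.

Definition agree (A : Type) (k : nat) (e e' : nat -> A) :=
  forall i, i < k -> e i = e' i.

Lemma agree_le (A : Type) k l (e e' : nat -> A) :
  k <= l -> agree l e e' -> agree k e e'.
Proof. by move=> kl H i ik; apply: H; apply: leq_trans kl. Qed.

(** Formulas carry no list of free variables; the finite support of substitution takes its place.
    One bound serves both sorts, so that a single number is fresh for either. *)
Lemma fsubst_support p : exists k, forall sg sg' ta ta',
  agree k sg sg' -> agree k ta ta' -> fsubst sg ta p = fsubst sg' ta' p.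
Proof.
elim: p => [|s t|s t|t X|p [k Hp] q [l Hq]|p [k Hp]|p [k Hp]].
- by exists 0.
- have [[k Hs] [l Ht]] := (tsubst_support s, tsubst_support t).
  exists (maxn k l) => sg sg' ta ta' H _ /=.
  by rewrite (Hs sg sg') ?(Ht sg sg') // => i Hi; apply: H; rewrite leq_max Hi ?orbT.
- have [[k Hs] [l Ht]] := (tsubst_support s, tsubst_support t).
  exists (maxn k l) => sg sg' ta ta' H _ /=.
  by rewrite (Hs sg sg') ?(Ht sg sg') // => i Hi; apply: H; rewrite leq_max Hi ?orbT.
- have [k Ht] := tsubst_support t.
  exists (maxn k X.+1) => sg sg' ta ta' H H' /=.
  rewrite (Ht sg sg') ?H' ?leq_max ?ltnSn ?orbT // => i Hi.
  by apply: H; rewrite leq_max Hi.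
- exists (maxn k l) => sg sg' ta ta' H H' /=.
  congr FImp; [apply: Hp|apply: Hq];
    by [apply: agree_le H; rewrite leq_max leqnn ?orbT|
        apply: agree_le H'; rewrite leq_max leqnn ?orbT].
- exists k => sg sg' ta ta' H H' /=; congr FAllN; apply: Hp => // -[|i] Hi //=.
  by rewrite H // ltnW.
- exists k => sg sg' ta ta' H H' /=; congr FAllS; apply: Hp => // -[|i] Hi //=.
  by rewrite H' // ltnW.
Qed.

(** The quantifier rules do not shift axioms, which may be open formulas; variables of a derivation
    can therefore be renamed only if instances of axioms are axioms. *)
Definition subst_closed (T : form -> Prop) :=
  forall sg ta p, T p -> T (fsubst sg ta p).

(** * Structural properties of derivations *)

Section Derivations.
Variable T : form -> Prop.

Lemma prv_weak G G' p : prv T G p -> List.incl G G' -> prv T G' p.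
Proof.
have incl_map (f : form -> form) A B :
    List.incl A B -> List.incl (List.map f A) (List.map f B).
  by move=> H y /List.in_map_iff [x [<- Hx]]; apply/List.in_map/H.
have incl_cons (A B : list form) q : List.incl A B -> List.incl (q :: A) (q :: B).
  by move=> H y [->|Hy]; [left|right; apply: H].
move=> H; elim: H G' => {G p}.
- by move=> G p Tp G' _; apply: prv_ax.
- by move=> G p Hp G' HG; apply/prv_hyp/HG.
- by move=> G p q _ IH G' HG; apply/prv_impI/IH/incl_cons.
- by move=> G p q _ IH1 _ IH2 G' HG; apply: prv_impE (IH1 _ HG) (IH2 _ HG).
- by move=> G p _ IH G' HG; apply/prv_raa/IH/incl_cons.
- by move=> G p _ IH G' HG; apply/prv_allNI/IH/incl_map.
- by move=> G p t _ IH G' HG; apply/prv_allNE/IH.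
- by move=> G p _ IH G' HG; apply/prv_allSI/IH/incl_map.
- by move=> G p t _ IH G' HG; apply/prv_allSE/IH.
- by move=> G t G' _; apply: prv_eq_refl.
- by move=> G p s t _ IH1 _ IH2 G' HG; apply: prv_eq_subst (IH1 _ HG) (IH2 _ HG).
Qed.

Lemma prv_cut G p q : prv T (p :: G) q -> prv T G p -> prv T G q.
Proof. by move=> H; apply/prv_impE/prv_impI. Qed.

Lemma prv_botE G p : prv T G FBot -> prv T G p.
Proof. by move=> H; apply/prv_raa/(prv_weak H) => x; right. Qed.

Lemma prv_negI G p : prv T (p :: G) FBot -> prv T G (FNeg p).
Proof. exact: prv_impI. Qed.

Hypothesis HT : subst_closed T.

Lemma prv_subst G p sg ta :
  prv T G p -> prv T (List.map (fsubst sg ta) G) (fsubst sg ta p).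
Proof.
move=> H; elim: H sg ta => {G p} //=.
- by move=> G p Tp sg ta; apply/prv_ax/HT.
- by move=> G p Hp sg ta; apply/prv_hyp/List.in_map.
- by move=> G p q _ IH sg ta; apply/prv_impI/IH.
- by move=> G p q _ IH1 _ IH2 sg ta; apply: prv_impE (IH1 _ _) (IH2 _ _).
- by move=> G p _ IH sg ta; apply/prv_raa/IH.
- move=> G p _ IH sg ta; apply/prv_allNI; move: (IH (upN sg) ta).
  rewrite !List.map_map; congr (prv T _ _); apply: List.map_ext => q.
  exact: fsubst_shiftN.
- by move=> G p t _ IH sg ta; rewrite fsubst_instN; apply/prv_allNE/IH.
- move=> G p _ IH sg ta; apply/prv_allSI; move: (IH sg (upS ta)).
  rewrite !List.map_map; congr (prv T _ _); apply: List.map_ext => q.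
  exact: fsubst_shiftS.
- by move=> G p t _ IH sg ta; rewrite fsubst_instS; apply/prv_allSE/IH.
- by move=> G t sg ta; apply: prv_eq_refl.
- move=> G p s t _ IH1 _ IH2 sg ta; rewrite fsubst_instN.
  by apply: prv_eq_subst (IH1 _ _) _; rewrite -fsubst_instN.
Qed.

Definition fresh (k : nat) (p : form) := forall sg sg' ta ta',
  agree k sg sg' -> agree k ta ta' -> fsubst sg ta p = fsubst sg' ta' p.

Lemma fresh_exists (G : list form) :
  exists k, forall p, List.In p G -> fresh k p.
Proof.
elim: G => [|p G [k IH]]; first by exists 0.
have [l Hl] := fsubst_support p; exists (maxn k l) => q [<-|/IH Hq] sg sg' ta ta' H H'.
- by apply: Hl; [apply: agree_le H|apply: agree_le H']; rewrite leq_max leqnn orbT.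
- by apply: Hq; [apply: agree_le H|apply: agree_le H']; rewrite leq_max leqnn.
Qed.

(** The rule [prv_allNI] shifts the context and frees variable 0, whereas here a fresh variable [k]
    is generalized. Sending [k] to 0 and shifting the rest turns the given derivation into the
    premise of the rule, since on formulas for which [k] is fresh this renaming is the plain
    shift. *)
Lemma prv_allN_fresh G p k : (forall q, List.In q (FAllN p :: G) -> fresh k q) ->
  prv T G (instN p (TVar k)) -> prv T G (FAllN p).
Proof.
move=> Hk H; apply: prv_allNI.
pose sg i := if i == k then TVar 0 else TVar i.+1.
have ag : agree k sg (fun i => TVar i.+1) by move=> i; rewrite /sg; case: ltngtP.
have := prv_subst sg id H.
have sgk : sg k = TVar 0 by rewrite /sg eqxx.
rewrite fsubst_instN /= sgk.
have -> : List.map (fsubst sg id) G = List.map shiftN G.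
  apply: List.map_ext_in => q Hq; apply: Hk => //; first by right.
have /(_ (or_introl erefl)) Hp := Hk (FAllN p).
have [->] : FAllN (fsubst (upN sg) id p) = FAllN (fsubst (upN (fun i => TVar i.+1)) id p).
  exact: (Hp sg (fun i => TVar i.+1) id id ag).
rewrite instN_fsubst; congr (prv T _ _).
rewrite -[RHS]fsubst_id; congr fsubst.
by apply: funext => -[].
Qed.

Lemma prv_allS_fresh G p k : (forall q, List.In q (FAllS p :: G) -> fresh k q) ->
  prv T G (instS p k) -> prv T G (FAllS p).
Proof.
move=> Hk H; apply: prv_allSI.
pose ta i := if i == k then 0 else i.+1.
have ag : agree k ta S by move=> i; rewrite /ta; case: ltngtP.
have := prv_subst TVar ta H.
have tak : ta k = 0 by rewrite /ta eqxx.
rewrite fsubst_instS tak.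
have -> : List.map (fsubst TVar ta) G = List.map shiftS G.
  apply: List.map_ext_in => q Hq; apply: Hk => //; first by right.
have /(_ (or_introl erefl)) Hp := Hk (FAllS p).
have [->] : FAllS (fsubst TVar (upS ta) p) = FAllS (fsubst TVar (upS S) p).
  exact: (Hp TVar TVar ta S _ ag).
rewrite instS_fsubst; congr (prv T _ _).
rewrite -[RHS]fsubst_id; congr fsubst.
by apply: funext => -[].
Qed.

End Derivations.

(** * Completeness *)

(** Henkin semantics: the second sort is an arbitrary type. Different sets may have the same
    members, as the language has equality for numbers only. *)
Record model := Model {
  dom : Type; sets : Type;
  mzero : dom; mone : dom;
  madd : dom -> dom -> dom; mmul : dom -> dom -> dom;
  mlt : dom -> dom -> Prop; mmem : dom -> sets -> Prop }.

Fixpoint eval (M : model) (e : nat -> dom M) (t : term) : dom M :=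
  match t with
  | TVar i => e i
  | TZero => mzero M
  | TOne => mone M
  | TAdd s t => madd (eval e s) (eval e t)
  | TMul s t => mmul (eval e s) (eval e t)
  end.

Fixpoint sat (M : model) (e : nat -> dom M) (d : nat -> sets M) (p : form) : Prop :=
  match p with
  | FBot => False
  | FEq s t => eval e s = eval e t
  | FLt s t => mlt (eval e s) (eval e t)
  | FMem t X => mmem (eval e t) (d X)
  | FImp p q => sat e d p -> sat e d q
  | FAllN p => forall x, sat (scons x e) d p
  | FAllS p => forall X, sat e (scons X d) p
  end.

Definition models (M : model) (T : form -> Prop) :=
  forall p, T p -> forall e d, @sat M e d p.

(** Coding by generic trees makes formulas countable; [pickle] then provides the enumeration along
    which the Henkin set grows. *)
Fixpoint term_tree (t : term) : GenTree.tree nat :=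
  match t with
  | TVar i => GenTree.Leaf i
  | TZero => GenTree.Node 0 [::]
  | TOne => GenTree.Node 1 [::]
  | TAdd s t => GenTree.Node 2 [:: term_tree s; term_tree t]
  | TMul s t => GenTree.Node 3 [:: term_tree s; term_tree t]
  end.

Fixpoint tree_term (t : GenTree.tree nat) : term :=
  match t with
  | GenTree.Leaf i => TVar i
  | GenTree.Node 1 _ => TOne
  | GenTree.Node 2 [:: s; t] => TAdd (tree_term s) (tree_term t)
  | GenTree.Node 3 [:: s; t] => TMul (tree_term s) (tree_term t)
  | _ => TZero
  end.

Lemma term_treeK : cancel term_tree tree_term.
Proof. by elim=> //= s -> t ->. Qed.

Fixpoint form_tree (p : form) : GenTree.tree nat :=
  match p with
  | FBot => GenTree.Node 0 [::]
  | FEq s t => GenTree.Node 1 [:: term_tree s; term_tree t]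
  | FLt s t => GenTree.Node 2 [:: term_tree s; term_tree t]
  | FMem t X => GenTree.Node 3 [:: term_tree t; GenTree.Leaf X]
  | FImp p q => GenTree.Node 4 [:: form_tree p; form_tree q]
  | FAllN p => GenTree.Node 5 [:: form_tree p]
  | FAllS p => GenTree.Node 6 [:: form_tree p]
  end.

Fixpoint tree_form (t : GenTree.tree nat) : form :=
  match t with
  | GenTree.Node 1 [:: s; t] => FEq (tree_term s) (tree_term t)
  | GenTree.Node 2 [:: s; t] => FLt (tree_term s) (tree_term t)
  | GenTree.Node 3 [:: t; GenTree.Leaf X] => FMem (tree_term t) X
  | GenTree.Node 4 [:: p; q] => FImp (tree_form p) (tree_form q)
  | GenTree.Node 5 [:: p] => FAllN (tree_form p)
  | GenTree.Node 6 [:: p] => FAllS (tree_form p)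
  | _ => FBot
  end.

Lemma form_treeK : cancel form_tree tree_form.
Proof. by elim=> //= [s t|s t|t X|p -> q ->|p ->|p ->] //; rewrite !term_treeK. Qed.

Definition form_enum (n : nat) : form :=
  tree_form (odflt (GenTree.Node 0 [::]) (unpickle n)).

Lemma form_enum_surj p : exists n, form_enum n = p.
Proof. by exists (pickle (form_tree p)); rewrite /form_enum pickleK /= form_treeK. Qed.

(** * The Henkin construction *)

Section Henkin.
Variables (T : form -> Prop) (HT : subst_closed T).
Variables (G0 : list form) (G0con : ~ prv T G0 FBot).

(* When a universal formula is rejected, a fresh variable is added as a
   counterexample. *)
Definition henkin_step (p : form) (G : list form) : list form :=
  if pselect (prv T (p :: G) FBot) is right _ then p :: G else
  let k := sval (cid (fresh_exists (FNeg p :: p :: G))) in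
  match p with
  | FAllN q => FNeg (instN q (TVar k)) :: FNeg p :: G
  | FAllS q => FNeg (instS q k) :: FNeg p :: G
  | _ => FNeg p :: G
  end.

Fixpoint stage (n : nat) : list form :=
  if n is n'.+1 then henkin_step (form_enum n') (stage n') else G0.

Definition hk (p : form) : Prop := exists n, List.In p (stage n).

(** If the added counterexample were inconsistent, the instance at the fresh variable would be
    provable, hence by generalization the universal formula whose negation is in the context. *)
Lemma henkin_step_con p G : ~ prv T G FBot -> ~ prv T (henkin_step p G) FBot.
Proof.
move=> con; rewrite /henkin_step; case: pselect => [inc|//].
have conN : ~ prv T (FNeg p :: G) FBot.
  by move=> H; apply/con/(prv_cut H)/prv_negI.
move: (sval _) (svalP (cid (fresh_exists (FNeg p :: p :: G)))) => k /= Hk.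
case: p inc conN Hk => // q inc conN Hk H; apply: conN.
- have Hq : prv T (FNeg (FAllN q) :: G) (FAllN q).
    apply: (prv_allN_fresh HT (k := k)); last exact: prv_raa.
    by move=> r [<-|[<-|Hr]]; apply: Hk; [right; left|left|right; right].
  by apply: prv_impE Hq; apply: prv_hyp; left.
- have Hq : prv T (FNeg (FAllS q) :: G) (FAllS q).
    apply: (prv_allS_fresh HT (k := k)); last exact: prv_raa.
    by move=> r [<-|[<-|Hr]]; apply: Hk; [right; left|left|right; right].
  by apply: prv_impE Hq; apply: prv_hyp; left.
Qed.

Lemma henkin_step_incl p G : List.incl G (henkin_step p G).
Proof.
move=> q Hq; rewrite /henkin_step; case: pselect => H; last by right.
by case: p H => *; do ?right.
Qed.

Lemma stage_con n : ~ prv T (stage n) FBot.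
Proof. by elim: n => //= n IH; apply: henkin_step_con. Qed.

Lemma stage_incl m n : m <= n -> List.incl (stage m) (stage n).
Proof.
elim: n => [|n IH]; first by rewrite leqn0 => /eqP -> x.
rewrite leq_eqVlt => /orP [/eqP -> x //|/IH H x /H]; exact: henkin_step_incl.
Qed.

Lemma hk_complete p : hk p \/ hk (FNeg p).
Proof.
have [n <-] := form_enum_surj p.
suff: List.In (form_enum n) (stage n.+1) \/ List.In (FNeg (form_enum n)) (stage n.+1).
  by case; [left|right]; exists n.+1.
rewrite /= /henkin_step; case: pselect => _; last by left; left.
by right; case: (form_enum n) => *; do ?[left; done|right].
Qed.

Lemma hk_prv n p : prv T (stage n) p -> hk p.
Proof.
move=> H; have [//|[m Hm]] := hk_complete p.
case: (@stage_con (maxn m n)).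
have Hn := stage_incl (leq_maxr m n); have Hm' := stage_incl (leq_maxl m n).
by apply: prv_impE (prv_weak H Hn); apply/prv_hyp/Hm'.
Qed.

Lemma hk_nil p : prv T nil p -> hk p.
Proof. by move=> H; apply: (@hk_prv 0); apply: prv_weak H _ => x []. Qed.

Lemma hk_bigstage p q : hk p -> hk q ->
  exists n, prv T (stage n) p /\ prv T (stage n) q.
Proof.
move=> [m Hm] [n Hn]; exists (maxn m n).
by split; apply/prv_hyp; [apply: stage_incl Hm|apply: stage_incl Hn];
  rewrite leq_max leqnn ?orbT.
Qed.

Lemma hk_impE p q : hk (FImp p q) -> hk p -> hk q.
Proof. by move=> H1 /(hk_bigstage H1) [n [H H']]; apply/hk_prv/prv_impE/H'. Qed.

Lemma hk_bot : ~ hk FBot.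
Proof. by move=> [n Hn]; apply/(@stage_con n)/prv_hyp. Qed.

Lemma hk_imp p q : hk (FImp p q) <-> (hk p -> hk q).
Proof.
split=> [H|H]; first exact: hk_impE.
have [/H [n Hq]|[n Hp]] := hk_complete p; apply: (@hk_prv n); apply/prv_impI.
- by apply/prv_hyp; right.
- apply/prv_botE/(@prv_impE _ _ p); last by apply: prv_hyp; left.
  by apply: prv_hyp; right.
Qed.

Lemma hk_allN p : hk (FAllN p) <-> forall t, hk (instN p t).
Proof.
split=> [[n Hn] t|H]; first by apply/(@hk_prv n)/prv_allNE/prv_hyp.
apply: contrapT => nH; have [n En] := form_enum_surj (FAllN p).
have : List.In (FAllN p) (stage n.+1) \/ exists t, List.In (FNeg (instN p t)) (stage n.+1).
  rewrite /= /henkin_step En; case: pselect => _; last by left; left.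
  by right; eexists; left.
case=> [H'|[t Ht]]; first by apply: nH; exists n.+1.
by apply/hk_bot/hk_impE/(H t); exists n.+1.
Qed.

Lemma hk_allS p : hk (FAllS p) <-> forall Y, hk (instS p Y).
Proof.
split=> [[n Hn] t|H]; first by apply/(@hk_prv n)/prv_allSE/prv_hyp.
apply: contrapT => nH; have [n En] := form_enum_surj (FAllS p).
have : List.In (FAllS p) (stage n.+1) \/ exists t, List.In (FNeg (instS p t)) (stage n.+1).
  rewrite /= /henkin_step En; case: pselect => _; last by left; left.
  by right; eexists; left.
case=> [H'|[t Ht]]; first by apply: nH; exists n.+1.
by apply/hk_bot/hk_impE/(H t); exists n.+1.
Qed.

Lemma hk_subst p s t : hk (FEq s t) -> hk (instN p s) -> hk (instN p t).
Proof.
by move=> H1 /(hk_bigstage H1) [n [H H']]; apply: (@hk_prv n); apply: prv_eq_subst H H'.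
Qed.

Lemma hk_refl t : hk (FEq t t).
Proof. exact/hk_nil/prv_eq_refl. Qed.

Lemma inst_shift u t :
  tsubst (fun i => if i is i'.+1 then TVar i' else u) (tshift t) = t.
Proof. by rewrite /tshift tsubst_comp /= tsubst_id. Qed.

Lemma hk_sym s t : hk (FEq s t) -> hk (FEq t s).
Proof.
move=> H; have := @hk_subst (FEq (TVar 0) (tshift s)) s t H.
rewrite /instN /= !inst_shift; apply; exact: hk_refl.
Qed.

Lemma hk_trans s t u : hk (FEq s t) -> hk (FEq t u) -> hk (FEq s u).
Proof.
move=> H1 H; have := @hk_subst (FEq (tshift s) (TVar 0)) t u H.
by rewrite /instN /= !inst_shift; apply.
Qed.

Lemma hk_cong (f : term -> term -> term) s s' t t' :
  f = TAdd \/ f = TMul -> hk (FEq s s') -> hk (FEq t t') ->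
  hk (FEq (f s t) (f s' t')).
Proof.
move=> Hf H1 H2.
have H := @hk_subst (FEq (f (tshift s) (tshift t)) (f (TVar 0) (tshift t))) s s' H1.
have H' := @hk_subst (FEq (f (tshift s) (tshift t)) (f (tshift s') (TVar 0))) t t' H2.
by case: Hf H H' => ->; rewrite /instN /= !inst_shift => H H';
  apply/H'/H/hk_refl.
Qed.

Lemma hk_lt s s' t t' : hk (FEq s s') -> hk (FEq t t') -> hk (FLt s t) -> hk (FLt s' t').
Proof.
move=> H1 H2 H3.
have := @hk_subst (FLt (TVar 0) (tshift t)) s s' H1.
have := @hk_subst (FLt (tshift s') (TVar 0)) t t' H2.
by rewrite /instN /= !inst_shift => H H'; apply/H/H'.
Qed.

Lemma hk_mem s s' X : hk (FEq s s') -> hk (FMem s X) -> hk (FMem s' X).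
Proof. by move=> H1; have := @hk_subst (FMem (TVar 0) X) s s' H1. Qed.

(** Satisfaction reads [FEq] as identity of elements, so terms are divided by provable equality. A
    class is represented by its predicate, which extensionality makes canonical. *)
Definition tclass (t : term) : term -> Prop := fun s => hk (FEq t s).
Definition hdom := {P : term -> Prop | exists t, P = tclass t}.
Definition hcl (t : term) : hdom := exist _ (tclass t) (ex_intro _ t erefl).
Definition hrep (x : hdom) : term := sval (cid (svalP x)).

Lemma hdom_inj (x y : hdom) : sval x = sval y -> x = y.
Proof.
case: x y => P HP [Q HQ] /= E; subst Q.
by congr exist; apply: Prop_irrelevance.
Qed.

Lemma hcl_eq s t : hcl s = hcl t <-> hk (FEq s t).
Proof.
split=> [/(congr1 sval) /= E|H].
  by have : tclass t t by [exact: hk_refl]; rewrite -E.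
apply: hdom_inj => /=; apply: funext => u; apply: propext; split=> [H'|H'].
- exact/hk_trans/H'/hk_sym.
- exact/hk_trans/H'.
Qed.

Lemma hrepK x : hcl (hrep x) = x.
Proof.
rewrite /hrep; case: (cid _) => t /= Ht.
by apply: hdom_inj; rewrite /= Ht.
Qed.

(** Variables are the only expressions for sets, so the set variables themselves form the second
    sort. *)
Definition henkin_model : model :=
  @Model hdom nat (hcl TZero) (hcl TOne)
    (fun x y => hcl (TAdd (hrep x) (hrep y)))
    (fun x y => hcl (TMul (hrep x) (hrep y)))
    (fun x y => hk (FLt (hrep x) (hrep y))) (fun x X => hk (FMem (hrep x) X)).

Lemma hk_hrep t : hk (FEq (hrep (hcl t)) t).
Proof. by apply/hcl_eq; rewrite hrepK. Qed.

Lemma henkin_eval sg t :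
  @eval henkin_model (hcl \o sg) t = hcl (tsubst sg t).
Proof.
elim: t => //= s -> t ->; apply/hcl_eq;
  by apply: hk_cong; [auto| |]; apply: hk_hrep.
Qed.

Lemma henkin_sat p sg ta :
  @sat henkin_model (hcl \o sg) ta p <-> hk (fsubst sg ta p).
Proof.
elim: p sg ta => [|s t|s t|t X|p IHp q IHq|p IH|p IH] sg ta /=.
- by split=> // /hk_bot.
- by rewrite !henkin_eval; apply: hcl_eq.
- rewrite !henkin_eval; split; apply: hk_lt; (try exact: hk_hrep);
    exact/hk_sym/hk_hrep.
- rewrite !henkin_eval; split; apply: hk_mem; (try exact: hk_hrep);
    exact/hk_sym/hk_hrep.
- by rewrite hk_imp IHp IHq.
- have E t : scons (hcl t) (hcl \o sg) = hcl \o scons t sg by apply: funext => -[].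
  rewrite hk_allN; split=> [H t|H x].
  + by rewrite instN_fsubst -IH -E; apply: H.
  + by rewrite -[x]hrepK E; apply/IH; rewrite -instN_fsubst.
- rewrite hk_allS; split=> [H t|H x].
  + by rewrite instS_fsubst -IH; apply: H.
  + by apply/IH; rewrite -instS_fsubst.
Qed.

Lemma henkin_models : models henkin_model T.
Proof.
move=> p Tp e d; have -> : e = hcl \o (hrep \o e).
  by apply: funext => i /=; rewrite hrepK.
exact/henkin_sat/hk_nil/prv_ax/HT.
Qed.

End Henkin.

(** With every variable standing for itself, the term model satisfies exactly the formulas of the
    Henkin set grown from [FNeg p]. *)
Theorem completeness (T : form -> Prop) (p : form) : subst_closed T ->
  (forall M, models M T -> forall e d, @sat M e d p) -> prv T nil p.
Proof.
move=> HT H; apply: prv_raa; apply: contrapT => con.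
have := H _ (henkin_models HT con) (@hcl _ _ \o TVar) id.
rewrite henkin_sat // fsubst_id => Hp.
apply: (hk_bot HT con); apply: (hk_impE HT con) Hp.
by exists 0; left.
Qed.

Lemma bounded_subst sg ta p : bounded p -> bounded (fsubst sg ta p).
Proof.
move=> H; elim: H sg ta => {p} /=; try by constructor.
move=> t p _ IH sg ta.
have -> : tsubst (upN sg) (tshift t) = tshift (tsubst sg t).
  by rewrite /tshift !tsubst_comp.
by constructor; apply: IH.
Qed.

Lemma fsubst_induction sg ta p :
  fsubst sg ta (induction p) = induction (fsubst (upN sg) ta p).
Proof.
rewrite /induction /= fsubst_instN /= !fsubst_comp.
congr (FImp (FAnd _ (FAllN (FImp _ (fsubst _ _ p)))) _).
by apply: funext => -[|i] //=; rewrite /tshift !tsubst_comp.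
Qed.

Lemma fsubst_comprehension sg ta p q :
  fsubst sg ta (comprehension p q) =
  comprehension (fsubst (upN sg) ta p) (fsubst (upN sg) ta q).
Proof. by rewrite /comprehension /= fsubst_shiftS. Qed.

(** The two schemata are closed because bounded formulas are; the other axioms are sentences, on
    which substitution computes to the identity. *)
Lemma RCA0_IPP_subst : subst_closed RCA0_IPP.
Proof.
move=> sg ta p [H|->]; last by right.
left; case: H => {p}; try by constructor.
- move=> p [q [Hq ->]]; rewrite fsubst_induction; apply: rca_induction.
  by exists (fsubst (upN (upN sg)) ta q); split; first exact: bounded_subst.
- move=> p q [p' [Hp ->]] [q' [Hq ->]]; rewrite fsubst_comprehension.
  apply: rca_comprehension.
  + by exists (fsubst (upN (upN sg)) ta p'); split; first exact: bounded_subst.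
  + by exists (fsubst (upN (upN sg)) ta q'); split; first exact: bounded_subst.
Qed.

(** * Definability in models *)

Declare Scope m_scope.
Delimit Scope m_scope with m.
Notation "0" := (mzero _) : m_scope.
Notation "1" := (mone _) : m_scope.
Notation "x + y" := (madd x y) : m_scope.
Notation "x * y" := (mmul x y) : m_scope.
Notation "x < y" := (mlt x y) : m_scope.

Lemma eval_subst (M : model) e sg t :
  @eval M e (tsubst sg t) = eval (fun i => eval e (sg i)) t.
Proof. by elim: t => //= [s -> t ->|s -> t ->]. Qed.

Lemma sat_subst (M : model) p e d sg ta :
  @sat M e d (fsubst sg ta p) <-> sat (fun i => eval e (sg i)) (d \o ta) p.
Proof.
elim: p e d sg ta => [|s t|s t|t X|p IHp q IHq|p IH|p IH] e d sg ta /=.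
- by [].
- by rewrite !eval_subst.
- by rewrite !eval_subst.
- by rewrite !eval_subst.
- by rewrite IHp IHq.
- split=> H x; move: (H x); rewrite IH; congr sat; apply: funext => -[|i] //=;
  by rewrite /tshift eval_subst.
- split=> H x; move: (H x); rewrite IH; congr sat; apply: funext => -[|i] //=.
Qed.

(* Even variables are the arguments of a predicate, odd ones its parameters. *)
Definition mix (A : Type) (e r : nat -> A) : nat -> A :=
  fun i => if odd i then r i./2 else e i./2.

Lemma mixl A (e r : nat -> A) i : mix e r i.*2 = e i.
Proof. by rewrite /mix odd_double doubleK. Qed.

Lemma mixr A (e r : nat -> A) i : mix e r i.*2.+1 = r i.
Proof. by rewrite /mix /= odd_double /= uphalf_double. Qed.

Lemma parity i : (exists j, i = j.*2) \/ (exists j, i = j.*2.+1).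
Proof.
rewrite -(odd_double_half i).
by case: (odd i); [right|left]; exists i./2; rewrite ?add1n ?add0n.
Qed.

(** [some_set] is the default entry of set environments. *)
Structure arith := Arith {
  amodel :> model;
  models_RCA0_IPP : models amodel RCA0_IPP;
  some_set : sets amodel }.

Section Definability.
Variable A : arith.
Local Notation M := (dom A).
Local Notation env := (nat -> M).

(** Definability is boldface: the odd number variables and all set variables hold parameters, so
    that any fixed element or set of the model may enter a definition. *)
Definition TermFun (f : env -> M) := exists t r, forall e, eval (mix e r) t = f e.

Definition Delta0 (P : env -> Prop) :=
  exists p r d, bounded p /\ forall e, sat (mix e r) d p <-> P e.

Definition Sigma1 (P : env -> Prop) :=
  exists2 Q, Delta0 Q & forall e, P e <-> exists x, Q (scons x e).

(** Two formulas receive the common parameters [mix r1 r2]; each is renamed so that its odd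
    variables point to its own half of them. *)
Definition rmergel i := if odd i then TVar i./2.*2.*2.+1 else TVar i.
Definition rmerger i := if odd i then TVar i./2.*2.+1.*2.+1 else TVar i.

Lemma mix_mergel (e r1 r2 : env) :
  (fun i => eval (mix e (mix r1 r2)) (rmergel i)) = mix e r1.
Proof.
apply: funext => i; rewrite /rmergel; have [[j ->]|[j ->]] := parity i.
- by rewrite odd_double /= !mixl.
- by rewrite /= odd_double /= uphalf_double mixr mixl mixr.
Qed.

Lemma mix_merger (e r1 r2 : env) :
  (fun i => eval (mix e (mix r1 r2)) (rmerger i)) = mix e r2.
Proof.
apply: funext => i; rewrite /rmerger; have [[j ->]|[j ->]] := parity i.
- by rewrite odd_double /= !mixl.
- by rewrite [odd _]/= odd_double [eval _ _]/= /= uphalf_double mixr mixr mixr.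
Qed.

Lemma TermFun_merge f g : TermFun f -> TermFun g -> exists s t r,
  (forall e, eval (mix e r) s = f e) /\ (forall e, eval (mix e r) t = g e).
Proof.
move=> [s [r1 Hs]] [t [r2 Ht]].
exists (tsubst rmergel s), (tsubst rmerger t), (mix r1 r2).
by split=> e; rewrite eval_subst ?mix_mergel ?mix_merger.
Qed.

Lemma Delta0_merge P Q : Delta0 P -> Delta0 Q -> exists p q r d, bounded p /\ bounded q /\
  (forall e, sat (mix e r) d p <-> P e) /\ (forall e, sat (mix e r) d q <-> Q e).
Proof.
move=> [p [r1 [d1 [bp Hp]]]] [q [r2 [d2 [bq Hq]]]].
exists (fsubst rmergel (fun X => X.*2) p), (fsubst rmerger (fun X => X.*2.+1) q).
exists (mix r1 r2), (mix d1 d2); do ![split; first exact: bounded_subst].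
split=> e; rewrite sat_subst ?mix_mergel ?mix_merger.
- by rewrite -Hp (_ : _ \o _ = d1) //; apply: funext => i /=; rewrite mixl.
- by rewrite -Hq (_ : _ \o _ = d2) //; apply: funext => i /=; rewrite mixr.
Qed.

Lemma Delta0_ext P Q : (forall e, P e <-> Q e) -> Delta0 P -> Delta0 Q.
Proof. by move=> H [p [r [d [bp Hp]]]]; exists p, r, d; split=> // e; rewrite -H. Qed.

Lemma TermFun_var i : TermFun (fun e => e i).
Proof. by exists (TVar i.*2), (fun _ => 0%m) => e /=; rewrite mixl. Qed.

Lemma TermFun_cst c : TermFun (fun e => c).
Proof. by exists (TVar 1), (fun _ => c). Qed.

Lemma TermFun_add f g : TermFun f -> TermFun g -> TermFun (fun e => f e + g e)%m.
Proof.
move=> Hf Hg; have [s [t [r [Hs Ht]]]] := TermFun_merge Hf Hg.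
by exists (TAdd s t), r => e /=; rewrite Hs Ht.
Qed.

Lemma TermFun_mul f g : TermFun f -> TermFun g -> TermFun (fun e => f e * g e)%m.
Proof.
move=> Hf Hg; have [s [t [r [Hs Ht]]]] := TermFun_merge Hf Hg.
by exists (TMul s t), r => e /=; rewrite Hs Ht.
Qed.

Lemma Delta0_false : Delta0 (fun e => False).
Proof. by exists FBot, (fun _ => 0%m), (fun _ => some_set A); split; first constructor. Qed.

Lemma Delta0_eq f g : TermFun f -> TermFun g -> Delta0 (fun e => f e = g e).
Proof.
move=> Hf Hg; have [s [t [r [Hs Ht]]]] := TermFun_merge Hf Hg.
exists (FEq s t), r, (fun _ => some_set A); split; first by constructor.
by move=> e /=; rewrite Hs Ht.
Qed.

Lemma Delta0_lt f g : TermFun f -> TermFun g -> Delta0 (fun e => f e < g e)%m.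
Proof.
move=> Hf Hg; have [s [t [r [Hs Ht]]]] := TermFun_merge Hf Hg.
exists (FLt s t), r, (fun _ => some_set A); split; first by constructor.
by move=> e /=; rewrite Hs Ht.
Qed.

Lemma Delta0_mem f X : TermFun f -> Delta0 (fun e => mmem (f e) X).
Proof.
move=> [s [r Hs]]; exists (FMem s 0), r, (fun _ => X); split; first by constructor.
by move=> e /=; rewrite Hs.
Qed.

Lemma Delta0_imp P Q : Delta0 P -> Delta0 Q -> Delta0 (fun e => P e -> Q e).
Proof.
move=> HP HQ; have [p [q [r [d [bp [bq [Hp Hq]]]]]]] := Delta0_merge HP HQ.
exists (FImp p q), r, d; split; first by constructor.
by move=> e /=; rewrite Hp Hq.
Qed.

Lemma Delta0_not P : Delta0 P -> Delta0 (fun e => ~ P e).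
Proof. by move=> HP; apply: Delta0_imp => //; apply: Delta0_false. Qed.

Lemma Delta0_or P Q : Delta0 P -> Delta0 Q -> Delta0 (fun e => P e \/ Q e).
Proof.
move=> HP HQ; apply: (@Delta0_ext (fun e => ~ P e -> Q e)); last first.
  by apply: Delta0_imp => //; apply: Delta0_not.
move=> e; split; last by case.
by move=> H; have [|/H] := EM (P e); [left|right].
Qed.

Lemma Delta0_and P Q : Delta0 P -> Delta0 Q -> Delta0 (fun e => P e /\ Q e).
Proof.
move=> HP HQ; apply: (@Delta0_ext (fun e => ~ (P e -> ~ Q e))); last first.
  by apply: Delta0_not; apply: Delta0_imp => //; apply: Delta0_not.
move=> e; split; last by case=> p q /(_ p).
by move=> H; split; apply: contrapT => n; apply: H => // ? /n.
Qed.

Lemma Delta0_iff P Q : Delta0 P -> Delta0 Q -> Delta0 (fun e => P e <-> Q e).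
Proof. by move=> HP HQ; apply: Delta0_and; apply: Delta0_imp. Qed.

Lemma Delta0_all f (Q : M -> env -> Prop) :
  TermFun f -> Delta0 (fun e => Q (e 0) (fun i => e i.+1)) ->
  Delta0 (fun e => forall x, (x < f e)%m -> Q x e).
Proof.
move=> [t [r1 Ht]] [q [r2 [d [bq Hq]]]].
pose t' := tsubst rmergel t.
(* Under the new binder the quantified variable has index 0. Variable [2j + 2] of [q] is argument
   [j] of the quantified statement and becomes variable [2j + 1] there; odd variables are moved to
   the merged parameters and shifted. *)
pose sg i := if i is 0 then TVar 0 else
  if odd i then tshift (rmerger i) else TVar i.-1.
exists (FAllN (FImp (FLt (TVar 0) (tshift t')) (fsubst sg id q))), (mix r1 r2), d.
split; first by constructor; apply: bounded_subst.
have E e x : (fun i => eval (scons x (mix e (mix r1 r2))) (sg i)) =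
    mix (scons x e) r2.
  apply: funext => i; have [[[|j] ->]|[j ->]] := parity i.
  - by rewrite mixl.
  - by rewrite /sg doubleS /= odd_double /= mixl -doubleS mixl.
  - rewrite /sg /= odd_double /= /tshift eval_subst /= mixr.
    by rewrite -[RHS](mixr e) -(mix_merger e r1 r2).
move=> e /=; split=> H x; move: (H x);
  by rewrite /tshift sat_subst E Hq eval_subst /= eval_subst mix_mergel Ht.
Qed.

Lemma Delta0_ex f (Q : M -> env -> Prop) :
  TermFun f -> Delta0 (fun e => Q (e 0) (fun i => e i.+1)) ->
  Delta0 (fun e => exists x, (x < f e)%m /\ Q x e).
Proof.
move=> Hf HQ; apply: (@Delta0_ext (fun e => ~ forall x, (x < f e)%m -> ~ Q x e)).
  move=> e; split=> [H|[x [Hx Qx]] H]; last exact: H Hx Qx.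
  by apply: contrapT => H'; apply: H => x Hx Qx; apply: H'; exists x.
by apply: Delta0_not; apply: Delta0_all => //; apply: Delta0_not.
Qed.

End Definability.

(** * Induction and comprehension in a model *)

Section Arithmetic.
Variable A : arith.
Local Notation M := (dom A).
Local Notation env := (nat -> M).
Local Open Scope m_scope.

(** The schemata expect the induction or comprehension variable at index 0, hence at index 1 below
    the leading quantifier. The first two arguments are therefore moved from the even positions to
    the front, and the remaining ones become parameters. *)
Lemma Delta0_open (P Q : env -> Prop) (e : env) : Delta0 P -> Delta0 Q ->
  exists p q e' d, bounded p /\ bounded q /\ forall y x,
    (sat (scons y (scons x e')) d p <-> P (scons y (scons x e))) /\
    (sat (scons y (scons x e')) d q <-> Q (scons y (scons x e))).
Proof.
move=> HP HQ; have [p [q [r [d [bp [bq [Hp Hq]]]]]]] := Delta0_merge HP HQ.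
pose sg i := match i with 0%N => TVar 0 | 2 => TVar 1 | _ => TVar i.+2 end.
exists (fsubst sg id p). exists (fsubst sg id q). exists (mix (scons 0 (scons 0 e)) r).
  exists d. do 2![split; first by apply: bounded_subst].

move=> y x; rewrite !sat_subst.
have -> : (fun i => eval (scons y (scons x (mix (scons 0 (scons 0 e)) r))) (sg i)) =
          mix (scons y (scons x e)) r.
  apply: funext => -[|[|[|i]]] //=; rewrite /mix /=.
  by have [[j ->]|[j ->]] := parity i; rewrite /= odd_double //= doubleK.
by split; [apply: Hp|apply: Hq].
Qed.

Lemma sigma1_induction (P : M -> Prop) : Sigma1 (fun e : env => P (e 0%N)) ->
  P 0 -> (forall x, P x -> P (x + 1)) -> forall x, P x.
Proof.
move=> [Q DQ HQ] P0 PS.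
have [q [? [e' [d [bq [_ H]]]]]] := Delta0_open (fun=> 0) DQ DQ.
have Hs : sigma01 (FExN q) by exists q.
have E x : sat (scons x e') d (FExN q) <-> P x.
  rewrite (HQ (scons x (fun=> 0))) /=; split=> [H'|[y Hy] H'].
  - by apply: contrapT => nH; apply: H' => y /(proj1 (H y x)) Hy; apply: nH; exists y.
  - by apply: (H' y); apply/(proj1 (H y x)).
have := models_RCA0_IPP (or_introl (rca_induction _ Hs)) e' d.
move: (FExN q) E => p E; rewrite /induction /FAnd /FNeg /= !sat_subst => IH x.
have E0 : (fun i => eval e' (match i with 0%N => TZero | i'.+1 => TVar i' end)) =
    scons 0 e' by apply: funext => -[].
have ES y : (fun i => eval (scons y e')
      (match i with 0%N => TAdd (TVar 0) TOne | i'.+1 => TVar i'.+1 end)) =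
    scons (y + 1) e' by apply: funext => -[].
apply/E; apply: IH; apply; first by rewrite E0; apply/E.
by move=> y; rewrite sat_subst ES => /E Hy; apply/E/PS.
Qed.

Lemma delta1_comprehension (P : M -> Prop) :
  Sigma1 (fun e : env => P (e 0%N)) -> Sigma1 (fun e : env => ~ P (e 0%N)) ->
  exists X : sets A, forall x, mmem x X <-> P x.
Proof.
move=> [Q DQ HQ] [R DR HR].
have [q [r [e' [d [bq [br H]]]]]] := Delta0_open (fun=> 0) DQ DR.
have Hq : sigma01 (FExN q) by exists q.
have Hr : pi01 (FAllN (FNeg r)) by exists (FNeg r); split=> //; do ?constructor.
have Eq x : sat (scons x e') d (FExN q) <-> P x.
  rewrite (HQ (scons x (fun=> 0))) /=; split=> [H'|[y Hy] H'].
  - by apply: contrapT => nH; apply: H' => y /(proj1 (H y x)) Hy; apply: nH; exists y.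
  - by apply: (H' y); apply/(proj1 (H y x)).
have Er x : sat (scons x e') d (FAllN (FNeg r)) <-> P x.
  split=> [H'|Px y /= /(proj2 (H y x)) Hy].
  - apply: contrapT => /(HR (scons x (fun=> 0))) [y /(proj2 (H y x))]; exact: H'.
  - by case: (proj2 (HR (scons x (fun=> 0)))); first by exists y.
have := models_RCA0_IPP (or_introl (rca_comprehension _ _ Hq Hr)) e' d.
move: (FExN q) Eq (FAllN _) Er => p Ep p' Ep'.
rewrite /comprehension /FIff /FAnd /FNeg /FExS => /= IH.
apply: contrapT => nX; apply: IH => [x H'|X HX].
- by apply: H' => [/Ep/Ep'|/Ep'/Ep].
- apply: nX; exists X => x; have {HX} := HX x.
  have -> : sat (scons x e') (scons X d) (shiftS p) <-> P x.
    by rewrite /shiftS sat_subst /= -Ep.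
  by move=> H'; apply: contrapT => nH; apply: H' => H1 H2; apply: nH.
Qed.

Lemma Sigma1_D0 (P : env -> Prop) : Delta0 P -> Sigma1 P.
Proof.
move=> [p [r [d [bp Hp]]]].
exists (fun e => P (fun i => e i.+1)); last first.
  by move=> e; split=> [H|[]//]; exists 0.
pose sg i := if odd i then TVar i else TVar i.+2.
exists (fsubst sg id p), r, d; split; first exact: bounded_subst.
move=> e; rewrite sat_subst -Hp.
rewrite (_ : (fun i => _) = mix (fun i => e i.+1) r) //.
apply: funext => i; rewrite /sg; have [[j ->]|[j ->]] := parity i.
- by rewrite odd_double /= -doubleS !mixl.
- by rewrite /= odd_double /= !mixr.
Qed.

Lemma addm0 (x : M) : x + 0 = x.
Proof. exact: (models_RCA0_IPP (or_introl rca_add0) (fun=> 0) (fun=> some_set A)). Qed.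

Lemma addmS (x y : M) : x + (y + 1) = (x + y) + 1.
Proof. exact: (models_RCA0_IPP (or_introl rca_addS) (fun=> 0) (fun=> some_set A)). Qed.

Lemma mulm0 (x : M) : x * 0 = 0.
Proof. exact: (models_RCA0_IPP (or_introl rca_mul0) (fun=> 0) (fun=> some_set A)). Qed.

Lemma mulmS (x y : M) : x * (y + 1) = x * y + x.
Proof. exact: (models_RCA0_IPP (or_introl rca_mulS) (fun=> 0) (fun=> some_set A)). Qed.

Lemma succm_neq0 (x : M) : x + 1 <> 0.
Proof. exact: (models_RCA0_IPP (or_introl rca_succ_neq0) (fun=> 0) (fun=> some_set A)). Qed.

Lemma succm_inj (x y : M) : x + 1 = y + 1 -> x = y.
Proof. exact: (models_RCA0_IPP (or_introl rca_succ_inj) (fun=> 0) (fun=> some_set A)). Qed.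

Lemma ltm0 (x : M) : ~ x < 0.
Proof. exact: (models_RCA0_IPP (or_introl rca_lt0) (fun=> 0) (fun=> some_set A)). Qed.

Lemma ltmS (x y : M) : x < y + 1 <-> x < y \/ x = y.
Proof.
have H := models_RCA0_IPP (or_introl rca_ltS) (fun=> 0) (fun=> some_set A) x y.
apply: contrapT => n; apply: H => /= H1 H2; apply: n; split.
- by move=> /H1 H; have [|/H] := EM (x < y); [left|right].
- by move=> H; apply: H2 => n; case: H.
Qed.

Lemma delta0_induction (P : M -> Prop) : Delta0 (fun e : env => P (e 0%N)) ->
  P 0 -> (forall x, P x -> P (x + 1)) -> forall x, P x.
Proof. by move=> /Sigma1_D0; apply: sigma1_induction. Qed.

End Arithmetic.

Ltac term_fun := repeat first
  [exact: TermFun_cst | exact: TermFun_var | apply: TermFun_add | apply: TermFun_mul].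
Ltac delta0 := repeat first
  [ apply: Delta0_and | apply: Delta0_or | apply: Delta0_not | apply: Delta0_iff
  | apply: Delta0_eq; term_fun | apply: Delta0_lt; term_fun | apply: Delta0_mem;
    term_fun | apply: Delta0_false
  | apply: Delta0_imp | apply: Delta0_all; [term_fun|] | apply: Delta0_ex; [term_fun|] ].

(** * The ordered semiring of a model *)

Section Semiring.
Variable A : arith.
Local Notation M := (dom A).
Implicit Types x y z : M.
Local Open Scope m_scope.

Lemma add0m x : 0 + x = x.
Proof.
move: x; apply: delta0_induction; [by delta0|exact: addm0|].
by move=> x IH; rewrite addmS IH.
Qed.

Lemma addSm x y : (x + 1) + y = (x + y) + 1.
Proof.
move: y; apply: delta0_induction; [by delta0|by rewrite !addm0|].
by move=> y IH; rewrite !addmS IH.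
Qed.

Lemma addmC x y : x + y = y + x.
Proof.
move: y; apply: delta0_induction; [by delta0|by rewrite add0m addm0|].
by move=> y IH; rewrite addmS addSm IH.
Qed.

Lemma addmA x y z : x + (y + z) = (x + y) + z.
Proof.
move: z; apply: delta0_induction; [by delta0|by rewrite !addm0|].
by move=> z IH; rewrite !addmS IH.
Qed.

Lemma addmACA x y z (t : M) : (x + y) + (z + t) = (x + z) + (y + t).
Proof. by rewrite addmA -(addmA x) (addmC y) addmA -addmA. Qed.

Lemma mul0m x : 0 * x = 0.
Proof.
move: x; apply: delta0_induction; [by delta0|exact: mulm0|].
by move=> x IH; rewrite mulmS IH addm0.
Qed.

Lemma mulmDl x y z : (x + y) * z = x * z + y * z.
Proof.
move: z; apply: delta0_induction; [by delta0|by rewrite !mulm0 addm0|].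
by move=> z IH; rewrite !mulmS IH addmACA.
Qed.

Lemma mul1m x : 1 * x = x.
Proof.
move: x; apply: delta0_induction; [by delta0|exact: mulm0|].
by move=> x IH; rewrite mulmS IH.
Qed.

Lemma mulmC x y : x * y = y * x.
Proof.
move: y; apply: delta0_induction; [by delta0|by rewrite mulm0 mul0m|].
by move=> y IH; rewrite mulmS IH mulmDl mul1m.
Qed.

Lemma mulmDr x y z : x * (y + z) = x * y + x * z.
Proof. by rewrite mulmC mulmDl !(mulmC x). Qed.

Lemma mulmA x y z : x * (y * z) = (x * y) * z.
Proof.
move: z; apply: delta0_induction; [by delta0|by rewrite !mulm0|].
by move=> z IH; rewrite !mulmS mulmDr IH.
Qed.

Lemma onem_neq0 : (1 : M) <> 0.
Proof. by rewrite -(add0m 1); apply: succm_neq0. Qed.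

Lemma addIm z x y : x + z = y + z -> x = y.
Proof.
move: z; apply: delta0_induction; [by delta0|by rewrite !addm0|].
by move=> z IH; rewrite !addmS => /succm_inj.
Qed.

Lemma caseM x : x = 0 \/ exists y, x = y + 1.
Proof.
(* Bounding the predecessor by [x] makes the induction formula bounded. *)
have: forall x, x = 0 \/ exists y, (y < x /\ x = y + 1); last first.
  by case/(_ x)=> [|[y [_ Hy]]]; [left|right; exists y].
apply: delta0_induction; [by delta0|by left|].
by move=> {}x _; right; exists x; split=> //; apply/ltmS; right.
Qed.

Lemma ltm_addS x y : x < x + (y + 1).
Proof.
move: y; apply: delta0_induction; [by delta0|by rewrite add0m; apply/ltmS; right|].
by move=> y IH; rewrite addmS; apply/ltmS; left.
Qed.

Lemma ltmP x y : x < y <-> exists z, y = x + (z + 1).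
Proof.
split=> [|[z ->]]; last exact: ltm_addS.
suff: forall y, x < y -> exists z, z < y + 1 /\ y = x + (z + 1).
  by move=> H /H [z [_ ?]]; exists z.
apply: delta0_induction; [by delta0|by move/ltm0|].
move=> {}y IH /ltmS [/IH [z [_ ->]]|->].
- exists (z + 1); split; last by rewrite !addmS.
  have -> : x + (z + 1) + 1 + 1 = (z + 1) + ((x + 1) + 1).
    by rewrite (addmC x) -!addmA.
  exact: ltm_addS.
- by exists 0; split; [rewrite -[_ + 1 + 1]add0m; apply: ltm_addS|rewrite add0m].
Qed.

Lemma ltm_total x y : x < y \/ x = y \/ y < x.
Proof.
move: y; apply: delta0_induction; first by delta0.
  by have [->|[z ->]] := caseM x; right; [left|right; rewrite -(add0m (z + 1)); apply:
    ltm_addS].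
move=> y [H|[->|/ltmP [z ->]]].
- by left; apply/ltmS; left.
- by left; apply/ltmS; right.
- have [->|[t ->]] := caseM z; first by right; left; rewrite add0m.
  by right; right; apply/ltmP; exists t; rewrite -(addmC 1) -!addmA (addmA 1) (addmC 1).
Qed.

End Semiring.

(** * The rational numbers of a model *)

HB.instance Definition _ (A : arith) := gen_eqMixin (dom A).
HB.instance Definition _ (A : arith) := gen_choiceMixin (dom A).
HB.instance Definition _ (A : arith) :=
  GRing.isNmodule.Build (dom A) (@addmA A) (@addmC A) (@add0m A).
HB.instance Definition _ (A : arith) :=
  GRing.Nmodule_isComPzSemiRing.Build (dom A) (@mulmA A) (@mulmC A) (@mul1m A)
    (@mulmDl A) (@mul0m A).

Section Fractions.
Variable A : arith.
Local Notation M := (dom A).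
Local Open Scope ring_scope.
Local Open Scope quotient_scope.

Lemma maddE (x y : M) : madd x y = x + y. Proof. by []. Qed.
Lemma mmulE (x y : M) : mmul x y = x * y. Proof. by []. Qed.
Lemma mzeroE : mzero A = 0. Proof. by []. Qed.
Lemma moneE : mone A = 1. Proof. by []. Qed.
Definition mE := (maddE, mmulE, mzeroE, moneE).

Lemma casesM (x y : M) : x = y \/ (exists z, x = y + (z + 1)) \/ exists z, y = x + (z + 1).
Proof.
have [/ltmP H|[H|/ltmP H]] := ltm_total x y; [right; right|left|right; left] => //.
Qed.

Lemma addMI (z x y : M) : z + x = z + y -> x = y.
Proof. by rewrite -!(addrC _ z); apply: addIm. Qed.

Lemma mulMI (c x y : M) : x * (c + 1) = y * (c + 1) -> x = y.
Proof.
have nz a b : (a + 1) * (c + 1) + b <> 0 :> M.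
  have -> : (a + 1) * (c + 1) + b = (a * (c + 1) + c + b) + 1 :> M by ring.
  exact: succm_neq0.
have [//|[[z ->]|[z ->]]] := casesM x y => H.
- case: (@nz z 0); apply: (@addMI (y * (c + 1))); rewrite !addr0 -[RHS]H; ring.
- case: (@nz z 0); apply: (@addMI (x * (c + 1))); rewrite !addr0 [RHS]H; ring.
Qed.

(* The triple (a, b, c) stands for the fraction (a - b) / (c + 1). *)
Definition triple := (M * M * M)%type.

Definition treqv (t u : triple) : bool :=
  let: (a, b, c) := t in let: (a', b', c') := u in
  a * (c' + 1) + b' * (c + 1) == a' * (c + 1) + b * (c' + 1).

Lemma treqv_refl : reflexive treqv.
Proof. by move=> [[a b] c] /=. Qed.

Lemma treqv_sym : symmetric treqv.
Proof. by move=> [[a b] c] [[a' b'] c'] /=; rewrite eq_sym. Qed.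

Lemma treqv_trans : transitive treqv.
Proof.
move=> [[a' b'] c'] [[a b] c] [[a2 b2] c2] /= /eqP H1 /eqP H2; apply/eqP.
apply: (@mulMI c'); apply: (@addMI (b' * (c + 1) * (c2 + 1))).
transitivity ((a * (c' + 1) + b' * (c + 1)) * (c2 + 1) + b2 * (c + 1) * (c' + 1));
  first ring.
rewrite H1.
transitivity ((a' * (c2 + 1) + b2 * (c' + 1)) * (c + 1) + b * (c' + 1) * (c2 + 1));
  first ring.
rewrite H2; ring.
Qed.

Canonical treqv_equiv := EquivRel treqv treqv_refl treqv_sym treqv_trans.

Definition QM := {eq_quot treqv}.
HB.instance Definition _ : EqQuotient _ treqv QM := EqQuotient.on QM.
HB.instance Definition _ := Choice.on QM.

Definition qcls (t : triple) : QM := \pi_QM t.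

Lemma qcls_eq t u : qcls t = qcls u <-> treqv t u.
Proof. by split=> [/eqmodP|H]; [|apply/eqmodP]. Qed.

Lemma qclsP (q : QM) : exists t, q = qcls t.
Proof. by exists (repr q); rewrite /qcls reprK. Qed.

Lemma qrepr t : treqv (repr (qcls t)) t.
Proof. by apply/qcls_eq; rewrite /qcls reprK. Qed.

Definition tradd (t u : triple) : triple :=
  let: (a, b, c) := t in let: (a', b', c') := u in
  (a * (c' + 1) + a' * (c + 1), b * (c' + 1) + b' * (c + 1), c * c' + c + c').
Definition tropp (t : triple) : triple := let: (a, b, c) := t in (b, a, c).
Definition trmul (t u : triple) : triple :=
  let: (a, b, c) := t in let: (a', b', c') := u in
  (a * a' + b * b', a * b' + b * a', c * c' + c + c').
Definition trge0 (t : triple) : bool := let: (a, b, c) := t in `[< exists z, a = b + z >].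

Definition qaddM (p q : QM) : QM := qcls (tradd (repr p) (repr q)).
Definition qoppM (p : QM) : QM := qcls (tropp (repr p)).
Definition qmulM (p q : QM) : QM := qcls (trmul (repr p) (repr q)).

Lemma qaddE t u : qaddM (qcls t) (qcls u) = qcls (tradd t u).
Proof.
apply/qcls_eq; move: (qrepr t) (qrepr u).
move: (repr _) (repr _) => [[a2 b2] c2] [[a1 b1] c1].
move: t u => [[a b] c] [[a' b'] c'] /= /eqP H1 /eqP H2; apply/eqP.
transitivity ((a1 * (c + 1) + b * (c1 + 1)) * (c2 + 1) * (c' + 1) +
              (a2 * (c' + 1) + b' * (c2 + 1)) * (c1 + 1) * (c + 1)); first ring.
by rewrite H1 H2; ring.
Qed.

Lemma qoppE t : qoppM (qcls t) = qcls (tropp t).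
Proof.
apply/qcls_eq; move: (qrepr t) => {}/[dup]; move: (repr _) => [[a1 b1] c1] _.
move: t => [[a b] c] /= /eqP H1; apply/eqP.
by rewrite addrC -H1 addrC.
Qed.

Lemma qmulE t u : qmulM (qcls t) (qcls u) = qcls (trmul t u).
Proof.
apply/qcls_eq.
have compat t1 t2 u' : treqv t1 t2 -> treqv (trmul t1 u') (trmul t2 u').
  move: t1 t2 u' => [[a1 b1] c1] [[a b] c] [[a' b'] c'] /= /eqP H; apply/eqP.
  transitivity ((a1 * (c + 1) + b * (c1 + 1)) * a' * (c' + 1) +
     (a * (c1 + 1) + b1 * (c + 1)) * b' * (c' + 1)); first ring.
  by rewrite H -{2}H; ring.
have trmulC t1 u1 : trmul t1 u1 = trmul u1 t1.
  by move: t1 u1 => [[a1 b1] c1] [[a b] c] /=; congr (_, _, _); ring.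
apply: treqv_trans (compat _ _ _ (qrepr t)) _.
by rewrite !(trmulC t); apply: compat; apply: qrepr.
Qed.

Lemma qcls_ext (t u : triple) : t = u -> qcls t = qcls u.
Proof. by move->. Qed.

Fact QM_addA : associative qaddM.
Proof.
move=> p q r; have [[[[a b] c] ->] [[[a' b'] c'] ->] [[[a2 b2] c2] ->]] :=
  And3 (qclsP p) (qclsP q) (qclsP r).
by rewrite !qaddE; apply: qcls_ext; congr (_, _, _); rewrite /=; ring.
Qed.

Fact QM_addC : commutative qaddM.
Proof.
move=> p q; have [[[[a b] c] ->] [[[a' b'] c'] ->]] := conj (qclsP p) (qclsP q).
by rewrite !qaddE; apply: qcls_ext; congr (_, _, _); rewrite /=; ring.
Qed.

Fact QM_add0 : left_id (qcls (0, 0, 0)) qaddM.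
Proof.
move=> p; have [[[a b] c] ->] := qclsP p.
by rewrite !qaddE; apply: qcls_ext; congr (_, _, _); rewrite /=; ring.
Qed.

Fact QM_addN : left_inverse (qcls (0, 0, 0)) qoppM qaddM.
Proof.
move=> p; have [[[a b] c] ->] := qclsP p.
by rewrite qoppE qaddE; apply/qcls_eq => /=; apply/eqP; ring.
Qed.

HB.instance Definition _ := GRing.isZmodule.Build QM QM_addA QM_addC QM_add0 QM_addN.

Fact QM_mulA : associative qmulM.
Proof.
move=> p q r; have [[[[a b] c] ->] [[[a' b'] c'] ->] [[[a2 b2] c2] ->]] :=
  And3 (qclsP p) (qclsP q) (qclsP r).
by rewrite !qmulE; apply: qcls_ext; congr (_, _, _); rewrite /=; ring.
Qed.

Fact QM_mulC : commutative qmulM.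
Proof.
move=> p q; have [[[[a b] c] ->] [[[a' b'] c'] ->]] := conj (qclsP p) (qclsP q).
by rewrite !qmulE; apply: qcls_ext; congr (_, _, _); rewrite /=; ring.
Qed.

Fact QM_mul1 : left_id (qcls (1, 0, 0)) qmulM.
Proof.
move=> p; have [[[a b] c] ->] := qclsP p.
by rewrite !qmulE; apply: qcls_ext; congr (_, _, _); rewrite /=; ring.
Qed.

Fact QM_mulDl : left_distributive qmulM qaddM.
Proof.
move=> p q r; have [[[[a b] c] ->] [[[a' b'] c'] ->] [[[a2 b2] c2] ->]] :=
  And3 (qclsP p) (qclsP q) (qclsP r).
by rewrite !(qmulE, qaddE); apply/qcls_eq => /=; apply/eqP; ring.
Qed.

Fact QM_1neq0 : qcls (1, 0, 0) != 0.
Proof.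
apply/eqP => /qcls_eq /= /eqP.
by rewrite !(mul0r, add0r, addr0, mulr1, mul1r) => /(@onem_neq0 A).
Qed.

HB.instance Definition _ := GRing.Zmodule_isComNzRing.Build QM QM_mulA QM_mulC
  QM_mul1 QM_mulDl QM_1neq0.

Lemma qcls0E a b c : qcls (a, b, c) = 0 <-> a = b.
Proof.
split=> [/qcls_eq /= /eqP|->].
- by rewrite !(mul0r, add0r, addr0, mulr1, mul1r).
- by apply/qcls_eq => /=; apply/eqP; rewrite !(mul0r, add0r, addr0, mulr1, mul1r).
Qed.

Lemma QM_inv_ex (q : QM) : exists r, if q == 0 then r = 0 else r * q = 1.
Proof.
case: eqP => [_|]; first by exists 0.
have [[[a b] c] ->] := qclsP q.
have [->|[[z ->]|[z ->]]] := casesM a b => H; first by case: H; apply/qcls0E.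
(* The element is [(z + 1) / (c + 1)]; in its inverse the denominator [z + 1] is coded by [z]. *)
- exists (qcls (c + 1, 0, z)); rewrite [_ * _]qmulE; apply/qcls_eq => /=; apply/eqP; ring.
- exists (qcls (0, c + 1, z)); rewrite [_ * _]qmulE; apply/qcls_eq => /=; apply/eqP; ring.
Qed.

Definition qinvM (q : QM) : QM := sval (cid (QM_inv_ex q)).

Fact QM_mulV (q : QM) : q != 0 -> qinvM q * q = 1.
Proof. by rewrite /qinvM; case: (cid _) => r /=; case: eqP. Qed.

Fact QM_inv0 : qinvM 0 = 0.
Proof. by rewrite /qinvM; case: (cid _) => r /=; rewrite eqxx. Qed.

HB.instance Definition _ := GRing.ComNzRing_isField.Build QM QM_mulV QM_inv0.

Definition qge0 (q : QM) : bool := trge0 (repr q).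

Lemma qge0E t : qge0 (qcls t) = trge0 t.
Proof.
have compat t1 t2 : treqv t1 t2 -> trge0 t1 -> trge0 t2.
  move: t1 t2 => [[a b] c] [[a' b'] c'] /= /eqP H /asboolP [z E]; apply/asboolP.
  move: H; rewrite {}E; have [->|[[w ->]|[w ->]]] := casesM a' b'.
  - by exists 0; rewrite addr0.
  - by exists (w + 1).
  - move=> H; case: (@succm_neq0 A (z * (c' + 1) + w * (c + 1) + c)).
    apply: (@addMI (a' * (c + 1) + b * (c' + 1))); rewrite addr0 -[RHS]H !mE; ring.
rewrite /qge0; apply/idP/idP; apply: compat; first exact: qrepr.
by rewrite treqv_sym; apply: qrepr.
Qed.

Fact QM_le0_add (x y : QM) : qge0 x -> qge0 y -> qge0 (x + y).
Proof.
have [[[[a b] c] ->] [[[a' b'] c'] ->]] := conj (qclsP x) (qclsP y).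
rewrite [_ + _]qaddE !qge0E /= => /asboolP [z ->] /asboolP [w ->]; apply/asboolP.
by exists (z * (c' + 1) + w * (c + 1)); ring.
Qed.

Fact QM_le0_mul (x y : QM) : qge0 x -> qge0 y -> qge0 (x * y).
Proof.
have [[[[a b] c] ->] [[[a' b'] c'] ->]] := conj (qclsP x) (qclsP y).
rewrite [_ * _]qmulE !qge0E /= => /asboolP [z ->] /asboolP [w ->]; apply/asboolP.
by exists (z * w); ring.
Qed.

Fact QM_le0_anti (x : QM) : qge0 x -> qge0 (- x) -> x = 0.
Proof.
have [[[a b] c] ->] := qclsP x.
rewrite [- _]qoppE !qge0E /= => /asboolP [z ->] /asboolP [w]; rewrite -addrA -[LHS]addr0.
move=> /addMI H; apply/qcls0E; have [->|[y Ey]] := caseM z; first by rewrite addr0.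
by case: (@succm_neq0 A (y + w)); rewrite [RHS]H Ey !mE; ring.
Qed.

Fact QM_le0_total (x : QM) : qge0 x || qge0 (- x).
Proof.
have [[[a b] c] ->] := qclsP x; rewrite [- _]qoppE !qge0E /=.
apply/orP; have [->|[[w ->]|[w ->]]] := casesM a b.
- by left; apply/asboolP; exists 0; rewrite addr0.
- by left; apply/asboolP; exists (w + 1).
- by right; apply/asboolP; exists (w + 1).
Qed.

Definition qleM (x y : QM) : bool := qge0 (y - x).
Definition qnormM (x : QM) : QM := if qge0 x then x else - x.

Fact QM_le0_add' (x y : QM) : qleM 0 x -> qleM 0 y -> qleM 0 (x + y).
Proof. by rewrite /qleM !subr0; apply: QM_le0_add. Qed.
Fact QM_le0_mul' (x y : QM) : qleM 0 x -> qleM 0 y -> qleM 0 (x * y).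
Proof. by rewrite /qleM !subr0; apply: QM_le0_mul. Qed.
Fact QM_le0_anti' (x : QM) : qleM 0 x -> qleM x 0 -> x = 0.
Proof. by rewrite /qleM subr0 sub0r; apply: QM_le0_anti. Qed.
Fact QM_sub_ge0 (x y : QM) : qleM 0 (y - x) = qleM x y.
Proof. by rewrite /qleM subr0. Qed.
Fact QM_le0_total' (x : QM) : qleM 0 x || qleM x 0.
Proof. by rewrite /qleM subr0 sub0r; apply: QM_le0_total. Qed.
Fact QM_normN (x : QM) : qnormM (- x) = qnormM x.
Proof.
rewrite /qnormM opprK; have := QM_le0_total x.
case: ifP => [H|_]; case: ifP => [H'|_] // _.
by rewrite (QM_le0_anti H' H) oppr0.
Qed.
Fact QM_ge0_norm (x : QM) : qleM 0 x -> qnormM x = x.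
Proof. by rewrite /qleM subr0 /qnormM => ->. Qed.

HB.instance Definition _ := Num.IntegralDomain_isLeReal.Build QM QM_le0_add'
  QM_le0_mul' QM_le0_anti' QM_sub_ge0 QM_le0_total' QM_normN QM_ge0_norm
  (fun _ _ => erefl).

(** The order of M is treated through this embedding into an ordered field, where [lra] and [nra]
    apply. *)
Definition iota (n : M) : QM := qcls (n, 0, 0).

End Fractions.

Notation "n %:q" := (iota n) (at level 2, left associativity, format "n %:q") : ring_scope.
Local Open Scope ring_scope.

Section Iota.
Variable A : arith.
Local Notation M := (dom A).
Implicit Types m n : M.

Lemma iota0 : (0 : M)%:q = 0. Proof. by []. Qed.
Lemma iota1 : (1 : M)%:q = 1. Proof. by []. Qed.

Lemma iotaD m n : (m + n)%:q = m%:q + n%:q.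
Proof. by rewrite [RHS]qaddE; apply: qcls_ext; congr (_, _, _) => /=; ring. Qed.

Lemma iotaM m n : (m * n)%:q = m%:q * n%:q.
Proof. by rewrite [RHS]qmulE; apply: qcls_ext; congr (_, _, _) => /=; ring. Qed.

Definition iotaE := (iotaD, iotaM, iota0, iota1).

Lemma iota_inj : injective (@iota A).
Proof. by move=> m n /qcls_eq /= /eqP; rewrite !(add0r, addr0, mul0r, mulr1). Qed.

Lemma iota_ge0 n : 0 <= n%:q.
Proof.
rewrite /Order.le /= /qleM subr0 qge0E /=; apply/asboolP.
by exists n; rewrite add0r.
Qed.

Lemma ltmE m n : mlt m n <-> m%:q < n%:q.
Proof.
have lt a b : a%:q < (a + (b + 1) : M)%:q.
  by rewrite !iotaE; have := iota_ge0 b; lra.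
split=> [/ltmP [z ->]|]; first exact: lt.
have [H|[->|/ltmP [z ->]]] := ltm_total m n => //; first by lra.
by have := lt n z; lra.
Qed.

(** Discreteness of M is what linear arithmetic over the field cannot supply; it enters through this
    lemma and the next. *)
Lemma iota_le m n : m%:q < n%:q + 1 <-> m%:q <= n%:q.
Proof.
have := ltmS m n; rewrite !ltmE (iotaD n 1) iota1 => ->; split=> [[/ltW //|->]|];
  first exact: lexx.
by rewrite le_eqVlt => /orP [/eqP/iota_inj ->|]; [right|left].
Qed.

Lemma iota_lt m n : m%:q < n%:q <-> m%:q + 1 <= n%:q.
Proof. by have := iota_le n m; split; lra. Qed.

Lemma iota_sub m n : n%:q <= m%:q -> exists d, m = n + d.
Proof.
move=> H; have [->|[[z ->]|[z E]]] := casesM m n.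
- by exists 0; rewrite addr0.
- by exists (z + 1).
- by move: H; rewrite E !iotaE; have := iota_ge0 z; lra.
Qed.

Lemma iota_pos m : 0 < m%:q -> exists d, m = d + 1.
Proof. by have [->|[d ->] _] := caseM m; [rewrite iota0 ltxx|exists d]. Qed.

Lemma qclsE a b c : qcls (a, b, c) = (a%:q - b%:q) / (c%:q + 1) :> QM A.
Proof.
have c0 : c%:q + 1 != 0 by have := iota_ge0 c; lra.
apply: (mulIf c0); rewrite mulfVK // -iota1 -iotaD.
rewrite [LHS]qmulE [- _]qoppE [RHS]qaddE; apply/qcls_eq => /=; apply/eqP; ring.
Qed.

Lemma QMP (q : QM A) : exists a b c : M, q = (a%:q - b%:q) / (c%:q + 1).
Proof. by have [[[a b] c] ->] := qclsP q; exists a, b, c; apply: qclsE. Qed.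

End Iota.

Section Delta0.
Variable A : arith.
Local Notation M := (dom A).
Local Notation env := (nat -> M).
Implicit Types P Q : env -> Prop.

Lemma TermFun_addR (f g : env -> M) : TermFun f -> TermFun g -> TermFun (fun e =>
  f e + g e).
Proof. exact: TermFun_add. Qed.

Lemma TermFun_mulR (f g : env -> M) : TermFun f -> TermFun g -> TermFun (fun e =>
  f e * g e).
Proof. exact: TermFun_mul. Qed.

Lemma Delta0_ltq (f g : env -> M) : TermFun f -> TermFun g -> Delta0 (fun e =>
  (f e)%:q < (g e)%:q).
Proof.
by move=> Hf Hg; apply: (Delta0_ext (P := fun e => mlt (f e) (g e))) (Delta0_lt Hf Hg) => e;
  apply: ltmE.
Qed.

Lemma Delta0_leq (f g : env -> M) : TermFun f -> TermFun g -> Delta0 (fun e =>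
  (f e)%:q <= (g e)%:q).
Proof.
move=> Hf Hg.
apply: (Delta0_ext (P := fun e => (f e)%:q < (g e + 1)%:q)) => [e|].
  by rewrite iotaD; apply: iota_le.
by apply: Delta0_ltq => //; apply: TermFun_addR => //; apply: TermFun_cst.
Qed.

Lemma Delta0_allq (f : env -> M) (Q : M -> env -> Prop) :
  TermFun f -> Delta0 (fun e => Q (e 0%N) (fun i => e i.+1)) ->
  Delta0 (fun e => forall x : M, x%:q < (f e)%:q -> Q x e).
Proof.
move=> Hf HQ; apply: Delta0_ext (Delta0_all Hf HQ) => e.
by split=> H x Hx; apply: H; apply/ltmE.
Qed.

Lemma Delta0_exq (f : env -> M) (Q : M -> env -> Prop) :
  TermFun f -> Delta0 (fun e => Q (e 0%N) (fun i => e i.+1)) ->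
  Delta0 (fun e => exists x : M, x%:q < (f e)%:q /\ Q x e).
Proof.
move=> Hf HQ; apply: Delta0_ext (Delta0_ex Hf HQ) => e.
by split=> -[x [Hx Qx]]; exists x; split=> //; apply/ltmE.
Qed.

(** The uniform way of renaming arguments ([inl]) and of freezing them to parameters ([inr]). *)
Definition spec (rho : nat -> nat + M) (e : env) : env :=
  fun i => match rho i with inl j => e j | inr c => c end.

Lemma Delta0_spec rho P : Delta0 P -> Delta0 (fun e => P (spec rho e)).
Proof.
move=> [p [r [d [bp Hp]]]].
pose cs i := if rho i is inr c then c else 0.
pose sg i := if odd i then TVar i./2.*2.*2.+1 else
  if rho i./2 is inl j then TVar j.*2 else TVar i./2.*2.+1.*2.+1.
exists (fsubst sg id p), (mix r cs), d; split; first exact: bounded_subst.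
move=> e; rewrite sat_subst -Hp (_ : (fun i => _) = mix (spec rho e) r) //.
apply: funext => i; rewrite /sg; have [[j ->]|[j ->]] := parity i.
- rewrite odd_double doubleK mixl /spec; case E: (rho j) => [k|c] /=.
  + exact: mixl.
  + by rewrite !mixr /cs E.
- by rewrite [odd _]/= odd_double [eval _ _]/= /= uphalf_double mixr mixl mixr.
Qed.

Lemma Delta0_var (Q : M -> env -> Prop) (k : nat) (rho : nat -> nat) :
  Delta0 (fun e => Q (e 0%N) (fun i => e i.+1)) ->
  Delta0 (fun e => Q (e k) (fun i => e (rho i))).
Proof.
move=> /(Delta0_spec (fun i => inl (if i is i'.+1 then rho i' else k))).
by apply: Delta0_ext.
Qed.

End Delta0.
Arguments Delta0_var {A} Q k rho.

Ltac term_fun ::= repeat first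
  [exact: TermFun_cst | exact: TermFun_var | apply: TermFun_addR | apply: TermFun_mulR
  | apply: TermFun_add | apply: TermFun_mul].
Ltac delta0 ::= repeat first
  [ assumption
  | apply: Delta0_and | apply: Delta0_or | apply: Delta0_not | apply: Delta0_iff
  | apply: Delta0_eq; term_fun | apply: Delta0_ltq; term_fun | apply: Delta0_leq; term_fun
  | apply: Delta0_lt; term_fun | apply: Delta0_mem; term_fun | apply: Delta0_false
  | apply: Delta0_allq; [term_fun|] | apply: Delta0_all; [term_fun|] | apply: Delta0_imp
  | apply: Delta0_exq; [term_fun|] | apply: Delta0_ex; [term_fun|] ].

(** * Closure properties of Sigma1 predicates *)

Section Sigma1.
Variable A : arith.
Local Notation M := (dom A).
Local Notation env := (nat -> M).
Local Notation Q := (QM A).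
Implicit Types P R : env -> Prop.
Local Notation tl e := (fun i => e i.+1).

Lemma scons_eta (e : env) : scons (e 0%N) (tl e) = e.
Proof. by apply: funext => -[]. Qed.

Lemma scons_var k (rho : nat -> nat) (e : env) :
  (fun i => e (if i is i'.+1 then rho i' else k)) = scons (e k) (fun i => e (rho i)).
Proof. by apply: funext => -[]. Qed.

Lemma Sigma1P P : Sigma1 P <-> exists2 T : M -> env -> Prop,
  Delta0 (fun e => T (e 0%N) (tl e)) & forall e, P e <-> exists x, T x e.
Proof.
split=> [[T DT HT]|[T DT HT]].
- by exists (fun x e => T (scons x e)) => //; apply: Delta0_ext DT => e; rewrite scons_eta.
- by exists (fun e => T (e 0%N) (tl e)).
Qed.

Lemma Sigma1_ext P R : (forall e, P e <-> R e) -> Sigma1 P -> Sigma1 R.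
Proof. by move=> H [T DT HT]; exists T => // e; rewrite -H. Qed.

Lemma Sigma1_spec rho P : Sigma1 P -> Sigma1 (fun e => P (spec rho e)).
Proof.
move=> /Sigma1P [T DT HT]; apply/Sigma1P; exists (fun x e => T x (spec rho e)) => //.
pose rho' i := if i is i'.+1 then (if rho i' is inl j then inl j.+1 else rho i') else inl 0%N.
apply: Delta0_ext (Delta0_spec rho' DT) => e.
rewrite (_ : tl (spec rho' e) = spec rho (tl e)) //.
by apply: funext => i; rewrite /spec /=; case: (rho i).
Qed.

Lemma bound2 (x y : M) : exists z : M, x%:q < z%:q /\ y%:q < z%:q.
Proof.
by exists (x + y + 1); rewrite !iotaE; have := iota_ge0 x; have := iota_ge0 y; lra.
Qed.

(** One number bounds both witnesses, which avoids a coding of pairs. *)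
Lemma Sigma1_and P R : Sigma1 P -> Sigma1 R -> Sigma1 (fun e => P e /\ R e).
Proof.
move=> /Sigma1P [S DS HS] /Sigma1P [T DT HT]; apply/Sigma1P.
exists (fun z e => (exists x, x%:q < z%:q /\ S x e) /\ (exists x, x%:q < z%:q /\ T x e)).
  by delta0; [apply: (Delta0_var S 0%N (fun i => i.+2))|apply:
    (Delta0_var T 0%N (fun i => i.+2))].
move=> e; rewrite HS HT; split=> [[[x Sx] [y Ty]]|[z [[x [_ Sx]] [y [_ Ty]]]]].
- by have [z [xz yz]] := bound2 x y; exists z; split; [exists x|exists y].
- by split; [exists x|exists y].
Qed.

Lemma Sigma1_ex (T : M -> env -> Prop) :
  Sigma1 (fun e => T (e 0%N) (tl e)) -> Sigma1 (fun e => exists x, T x e).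
Proof.
move=> /Sigma1P [S DS HS]; apply/Sigma1P.
exists (fun z e => exists x, x%:q < z%:q /\ exists y, y%:q < z%:q /\ S y (scons x e)).
  delta0; apply: Delta0_ext (Delta0_var S 0%N (fun i =>
    if i is i'.+1 then i'.+3 else 1%N) DS) => e.
  by rewrite (scons_var 1%N (fun i => i.+3) e).
move=> e; split=> [[x /(HS (scons x e)) [y Sy]]|[z [x [_ [y [_ Sy]]]]]].
- by have [z [xz yz]] := bound2 x y; exists z, x; split=> //; exists y.
- by exists x; apply/(HS (scons x e)); exists y.
Qed.

Lemma Sigma1_or P R : Sigma1 P -> Sigma1 R -> Sigma1 (fun e => P e \/ R e).
Proof.
move=> /Sigma1P [S DS HS] /Sigma1P [T DT HT]; apply/Sigma1P.
exists (fun z e => S z e \/ T z e); first by delta0.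
move=> e; rewrite HS HT; split=> [[[x Sx]|[x Tx]]|[x [Sx|Tx]]].
- by exists x; left.
- by exists x; right.
- by left; exists x.
- by right; exists x.
Qed.

Lemma Sigma1_weaken P : Sigma1 P -> Sigma1 (fun e => P (tl e)).
Proof. exact: (Sigma1_spec (fun i => inl i.+1)). Qed.

(** Collection follows by induction on [z]: the existence of a common bound for the [x < z] is
    Sigma1, and each new [x] only enlarges the bound. *)
Lemma Sigma1_bounding (T : M -> M -> Prop) (a : M) :
  Delta0 (fun e : env => T (e 0%N) (e 1%N)) ->
  (forall x : M, x%:q < a%:q -> exists y, T y x) ->
  exists b : M, forall x : M, x%:q < a%:q -> exists y : M, y%:q < b%:q /\ T y x.
Proof.
move=> DT H.
suff: forall z : M, exists b : M, forall x : M, x%:q < z%:q -> x%:q < a%:q ->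
    exists y : M, y%:q < b%:q /\ T y x.
  by move=> /(_ a) [b Hb]; exists b => x Hx; apply: Hb.
apply: sigma1_induction; first apply/Sigma1P.
- exists (fun b e => forall x : M, x%:q < (e 0%N)%:q -> x%:q < a%:q ->
    exists y : M, y%:q < b%:q /\ T y x) => //.
  by delta0; apply: (Delta0_spec (fun i => inl i) DT).
- by exists 0 => x; have := iota_ge0 x; rewrite iota0; lra.
- move=> z [b Hb]; have [za|az] := ltP z%:q a%:q; last first.
    by exists b => x _ xa; apply: Hb => //; lra.
  have [y Ty] := H z za; have [c [bc yc]] := bound2 b y.
  exists c => x; rewrite iotaD iota1 iota_le le_eqVlt => /orP [/eqP/iota_inj -> _|xz xa].
    by exists y.
  by have [y' [y'b Ty']] := Hb x xz xa; exists y'; split=> //; lra.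
Qed.

Lemma Sigma1_all (f : env -> M) (T : M -> env -> Prop) : TermFun f ->
  Sigma1 (fun e => T (e 0%N) (tl e)) ->
  Sigma1 (fun e => forall x : M, x%:q < (f e)%:q -> T x e).
Proof.
move=> Hf /Sigma1P [S DS HS]; apply/Sigma1P.
exists (fun b e => forall x : M, x%:q < (f e)%:q ->
   exists y : M, y%:q < b%:q /\ S y (scons x e)).
  apply: Delta0_allq.
    have [t [r Ht]] := Hf.
    exists (tsubst (fun i => if odd i then TVar i else TVar i.+2) t), r => e.
    rewrite eval_subst -Ht; congr eval; apply: funext => i.
    by have [[j ->]|[j ->]] := parity i; rewrite /= odd_double /= -?doubleS ?mixl ?mixr.
  delta0; apply: Delta0_ext (Delta0_var S 0%N (fun i =>
    if i is i'.+1 then i'.+3 else 1%N) DS) => e.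
  by rewrite (scons_var 1%N (fun i => i.+3) e).
move=> e; split=> [H|[b Hb] x Hx]; last first.
  by have [y [_ Sy]] := Hb x Hx; apply/(HS (scons x e)); exists y.
(* Collection is stated for relations of numbers, so the surrounding environment is frozen into
   parameters. *)
have D : Delta0 (fun e' : env => S (e' 0%N) (scons (e' 1%N) e)).
  apply: Delta0_ext (Delta0_spec (fun i =>
    if i is i'.+2 then inr (e i') else inl i) DS) => e'.
  by rewrite [spec _ _]/spec /= (_ : (fun i => _) = scons (e' 1%N) e) //;
    apply: funext => -[].
apply: (Sigma1_bounding D) => x Hx.
by apply/(HS (scons x e)); apply: H.
Qed.

End Sigma1.

(* [least P] is 0 if P has no least element.  This and [psum] below are locked
   because unification is slow when it unfolds them. *)
HB.lock Definition least {A : arith} (P : dom A -> Prop) : dom A :=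
  if pselect (exists x, P x /\ forall y : dom A, y%:q < x%:q -> ~ P y) is left H
  then sval (cid H) else 0.

(** * Decidable predicates and computable functions *)

Section Computable.
Variable A : arith.
Local Notation M := (dom A).
Local Notation env := (nat -> M).
Local Notation tl e := (fun i => e i.+1).
Implicit Types (P R : env -> Prop) (f g : env -> M).

(** By comprehension the Delta1 predicates of one number are the sets of the model, so a
    construction of sets reduces to a proof of closure properties. A total function with Sigma1
    graph is computable in the parameters. *)
Definition Delta1 P := Sigma1 P /\ Sigma1 (fun e => ~ P e).
Definition Comp f := Sigma1 (fun e => e 0%N = f (tl e)).

Lemma Delta1_ext P R : (forall e, P e <-> R e) -> Delta1 P -> Delta1 R.
Proof. by move=> H [H1 H2]; split; [apply: Sigma1_ext H1|apply: Sigma1_ext H2 => e;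
  rewrite H]. Qed.

Lemma Delta1_Sg P : Delta1 P -> Sigma1 P. Proof. by case. Qed.

Lemma Delta1_D0 P : Delta0 P -> Delta1 P.
Proof. by move=> H; split; apply: Sigma1_D0 => //; apply: Delta0_not. Qed.

Lemma Delta1_not P : Delta1 P -> Delta1 (fun e => ~ P e).
Proof.
move=> [H1 H2]; split=> //; apply: Sigma1_ext H1 => e.
by split=> [p /(_ p)|/contrapT].
Qed.

Lemma Delta1_and P R : Delta1 P -> Delta1 R -> Delta1 (fun e => P e /\ R e).
Proof.
move=> [P1 P2] [R1 R2]; split; first exact: Sigma1_and.
by apply: Sigma1_ext (Sigma1_or P2 R2) => e; rewrite not_andE.
Qed.

Lemma Delta1_or P R : Delta1 P -> Delta1 R -> Delta1 (fun e => P e \/ R e).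
Proof.
move=> [P1 P2] [R1 R2]; split; first exact: Sigma1_or.
by apply: Sigma1_ext (Sigma1_and P2 R2) => e; rewrite not_orE.
Qed.

Lemma Delta1_imp P R : Delta1 P -> Delta1 R -> Delta1 (fun e => P e -> R e).
Proof.
move=> HP HR; apply: Delta1_ext (Delta1_or (Delta1_not HP) HR) => e.
by rewrite implyE.
Qed.

Lemma Delta1_iff P R : Delta1 P -> Delta1 R -> Delta1 (fun e => P e <-> R e).
Proof. by move=> HP HR; apply: Delta1_and; apply: Delta1_imp. Qed.

Lemma Sigma1_comp f (T : M -> env -> Prop) :
  Comp f -> Sigma1 (fun e => T (e 0%N) (tl e)) -> Sigma1 (fun e => T (f e) e).
Proof.
move=> Hf HT; apply: (Sigma1_ext (P := fun e => exists y, y = f e /\ T y e)) => [e|].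
  by split=> [[y [->]]|H] //; exists (f e).
exact/Sigma1_ex/Sigma1_and.
Qed.

Lemma Delta1_comp f (T : M -> env -> Prop) :
  Comp f -> Delta1 (fun e => T (e 0%N) (tl e)) -> Delta1 (fun e => T (f e) e).
Proof.
by move=> Hf [H1 H2]; split;
  [apply: Sigma1_comp|apply: (Sigma1_comp (T := fun y e => ~ T y e))].
Qed.

Lemma Comp_ext f g : f =1 g -> Comp f -> Comp g.
Proof. by move=> H; apply: Sigma1_ext => e; rewrite H. Qed.

Lemma Comp_weaken f : Comp f -> Comp (fun e => f (tl e)).
Proof. exact: (Sigma1_spec (fun i => inl (if i is 0 then 0%N else i.+1))). Qed.

Lemma Delta1_weaken P : Delta1 P -> Delta1 (fun e => P (tl e)).
Proof. by move=> [H1 H2]; split; [exact: Sigma1_weaken|exact: (Sigma1_weaken H2)]. Qed.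

Lemma Delta1_spec rho P : Delta1 P -> Delta1 (fun e => P (spec rho e)).
Proof. by move=> [H1 H2]; split; [exact: Sigma1_spec|exact: (Sigma1_spec rho H2)]. Qed.

Lemma Comp_comp f (F : M -> env -> M) :
  Comp f -> Comp (fun e => F (e 0%N) (tl e)) -> Comp (fun e => F (f e) e).
Proof.
move=> Hf HF; apply: (Sigma1_comp (T := fun y e => e 0%N = F y (tl e)) (Comp_weaken Hf)).
by apply: Sigma1_ext (Sigma1_spec (fun i => inl (match i with 0 => 1 | 1 => 0 | i =>
  i end)%N) HF).
Qed.

Lemma Comp_var i : Comp (fun e => e i).
Proof. by apply/Delta1_Sg/Delta1_D0; delta0. Qed.

Lemma Comp_cst (c : M) : Comp (fun e => c).
Proof. by apply/Delta1_Sg/Delta1_D0; delta0. Qed.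

Lemma Comp_op2 (op : M -> M -> M) : Comp (fun e => op (e 0%N) (e 1%N)) ->
  forall f g, Comp f -> Comp g -> Comp (fun e => op (f e) (g e)).
Proof.
move=> Hop f g Hf Hg; apply: (Comp_comp (F := fun y e => op y (g e)) Hf).
apply: (Comp_comp (F := fun y e => op (e 0%N) y) (Comp_weaken Hg)).
exact: (Sigma1_spec (fun i => inl (match i with 0 => 0 | 1 => 2 | 2 => 1 | i =>
  i end)%N) Hop).
Qed.

Lemma Comp_op1 (op : M -> M) : Comp (fun e => op (e 0%N)) ->
  forall f, Comp f -> Comp (fun e => op (f e)).
Proof. by move=> Hop f Hf; apply: (Comp_comp (F := fun y e => op y) Hf). Qed.

Lemma Delta1_op2 (T : M -> M -> Prop) : Delta1 (fun e => T (e 0%N) (e 1%N)) ->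
  forall f g, Comp f -> Comp g -> Delta1 (fun e => T (f e) (g e)).
Proof.
move=> HT f g Hf Hg; apply: (Delta1_comp (T := fun y e => T y (g e)) Hf).
apply: (Delta1_comp (T := fun y e => T (e 0%N) y) (Comp_weaken Hg)).
exact: (Delta1_spec (fun i => inl (match i with 0 => 1 | 1 => 0 | i => i end)%N) HT).
Qed.

Lemma Delta1_op1 (T : M -> Prop) : Delta1 (fun e => T (e 0%N)) ->
  forall f, Comp f -> Delta1 (fun e => T (f e)).
Proof. by move=> HT f Hf; apply: (Delta1_comp (T := fun y e => T y) Hf). Qed.

Lemma Comp_add f g : Comp f -> Comp g -> Comp (fun e => f e + g e).
Proof. by apply: (Comp_op2 (op := +%R)); apply/Delta1_Sg/Delta1_D0; delta0. Qed.

Lemma Comp_mul f g : Comp f -> Comp g -> Comp (fun e => f e * g e).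
Proof. by apply: (Comp_op2 (op := *%R)); apply/Delta1_Sg/Delta1_D0; delta0. Qed.

Lemma Delta1_eq f g : Comp f -> Comp g -> Delta1 (fun e => f e = g e).
Proof. by apply: Delta1_op2; apply/Delta1_D0; delta0. Qed.

Lemma Delta1_lt f g : Comp f -> Comp g -> Delta1 (fun e => (f e)%:q < (g e)%:q).
Proof. by apply: (Delta1_op2 (T := fun x y : M => x%:q < y%:q)); apply/Delta1_D0; delta0.
  Qed.

Lemma Delta1_le f g : Comp f -> Comp g -> Delta1 (fun e => (f e)%:q <= (g e)%:q).
Proof. by apply: (Delta1_op2 (T := fun x y : M => x%:q <= y%:q)); apply/Delta1_D0;
  delta0. Qed.

Lemma Delta1_mem f X : Comp f -> Delta1 (fun e => mmem (f e) X).
Proof. by apply: (Delta1_op1 (T := fun x => mmem x X)); apply/Delta1_D0; delta0. Qed.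

Lemma Delta1_true (P : Prop) : Delta1 (fun=> P).
Proof.
apply/Delta1_D0; have [p|n] := EM P.
- by apply: Delta0_ext (Delta0_not (Delta0_false A)) => e; tauto.
- by apply: Delta0_ext (Delta0_false A) => e; tauto.
Qed.

Lemma Delta1_all f (T : M -> env -> Prop) : Comp f -> Delta1 (fun e => T (e 0%N) (tl e)) ->
  Delta1 (fun e => forall x : M, x%:q < (f e)%:q -> T x e).
Proof.
move=> Hf HT; apply: (Delta1_comp (T := fun b e => forall x : M, x%:q < b%:q -> T x e) Hf).
have HT' : Delta1 (fun e => T (e 0%N) (fun i => e i.+2)).
  exact: (Delta1_spec (fun i => inl (if i is i'.+1 then i'.+2 else 0)%N) HT).
split; first by apply: Sigma1_all; [apply: TermFun_var|apply: Delta1_Sg].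
apply: (Sigma1_ext (P := fun e => exists x : M, x%:q < (e 0%N)%:q /\ ~ T x (tl e))).
  move=> e; split=> [[x [xe nT]] /(_ x xe)|H] //.
  by apply: contrapT => nH; apply: H => x xe; apply: contrapT => nT; apply: nH; exists x.
apply: Sigma1_ex; apply: Sigma1_and; last by case: HT'.
by apply/Delta1_Sg/Delta1_D0; delta0.
Qed.

Lemma Delta1_ex f (T : M -> env -> Prop) : Comp f -> Delta1 (fun e => T (e 0%N) (tl e)) ->
  Delta1 (fun e => exists x : M, x%:q < (f e)%:q /\ T x e).
Proof.
move=> Hf /Delta1_not HT; apply: Delta1_ext (Delta1_not (Delta1_all (T := fun x e =>
  ~ T x e) Hf HT)) => e.
split=> [H|[x [xe Tx]] /(_ x xe)] //.
by apply: contrapT => nH; apply: H => x xe Tx; apply: nH; exists x.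
Qed.

Lemma Sigma1_allc f (T : M -> env -> Prop) : Comp f -> Sigma1 (fun e => T (e 0%N) (tl e)) ->
  Sigma1 (fun e => forall x : M, x%:q < (f e)%:q -> T x e).
Proof.
move=> Hf HT; apply: (Sigma1_comp (T := fun b e => forall x : M, x%:q < b%:q -> T x e) Hf).
apply: Sigma1_all; first exact: TermFun_var.
exact: (Sigma1_spec (fun i => inl (if i is i'.+1 then i'.+2 else 0)%N) HT).
Qed.

Definition ite (T : Type) (P : Prop) (x y : T) : T := if pselect P then x else y.

Lemma iteT (T : Type) (P : Prop) (x y : T) : P -> ite P x y = x.
Proof. by rewrite /ite; case: pselect. Qed.

Lemma iteF (T : Type) (P : Prop) (x y : T) : ~ P -> ite P x y = y.
Proof. by rewrite /ite; case: pselect. Qed.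

Lemma Comp_if P f g : Delta1 P -> Comp f -> Comp g -> Comp (fun e => ite (P e) (f e) (g e)).
Proof.
move=> HP Hf Hg; apply: (Sigma1_ext (P := fun e => (P (tl e) /\ e 0%N = f (tl e)) \/
    (~ P (tl e) /\ e 0%N = g (tl e)))).
  move=> e; rewrite /ite; case: pselect => p; first by split=> [[[? ?]|[? ?]]|?]; [| |left].
  by split=> [[[? ?]|[? ?]]|?]; [| |right].
have [H1 H2] := Delta1_weaken HP.
by apply: Sigma1_or; apply: Sigma1_and.
Qed.

Lemma leastP (P : M -> Prop) : Delta1 (fun e => P (e 0%N)) -> (exists x, P x) ->
  P (least P) /\ forall y : M, y%:q < (least P)%:q -> ~ P y.
Proof.
move=> HP [x Px]; rewrite least.unlock; case: pselect => [H|n]; first exact: svalP (cid H).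
suff H : forall z y : M, y%:q < z%:q -> ~ P y.
  by case: (H (x + 1) x) => //; rewrite !iotaE; lra.
apply: sigma1_induction.
- apply: Delta1_Sg; apply: (Delta1_all (T := fun y e => ~ P y)); first exact: Comp_var.
  exact: Delta1_not.
- by move=> y; rewrite iota0; have := iota_ge0 y; lra.
- move=> z IH y; rewrite iotaD iota1 iota_le le_eqVlt => /orP [/eqP/iota_inj ->|];
    last exact: IH.
  by move=> Pz; apply: n; exists z.
Qed.

(** Unbounded search. Witnesses that have to depend computably on their data are chosen in this way
    throughout. *)
Lemma Comp_least (T : M -> env -> Prop) : Delta1 (fun e => T (e 0%N) (tl e)) ->
  (forall e, exists x, T x e) -> Comp (fun e => least (T^~ e)).
Proof.
move=> HT H.
have HT1 e : Delta1 (fun e' => T (e' 0%N) e).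
  exact: (Delta1_spec (fun i => if i is i'.+1 then inr (e i') else inl 0%N) HT).
apply: (Sigma1_ext (P := fun e => T (e 0%N) (tl e) /\
    forall y : M, y%:q < (e 0%N)%:q -> ~ T y (tl e))).
  move=> e; have [T1 T2] := leastP (HT1 (tl e)) (H (tl e)).
  split=> [[T3 T4]|->] //; apply: iota_inj; apply: le_anti; apply/andP; split.
  - by rewrite leNgt; apply/negP => /T4; apply.
  - by rewrite leNgt; apply/negP => /T2; apply.
apply: Sigma1_and; first exact: Delta1_Sg.
apply: Delta1_Sg; apply: (Delta1_all (T := fun y e => ~ T y (tl e))); first exact: Comp_var.
apply: Delta1_not.
exact: (Delta1_spec (fun i => inl (if i is i'.+1 then i'.+2 else 0)%N) HT).
Qed.

Lemma Comp_graph f (G : M -> env -> Prop) : Sigma1 (fun e => G (e 0%N) (tl e)) ->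
  (forall e, G (f e) e) -> (forall e y, G y e -> y = f e) -> Comp f.
Proof. by move=> HG H1 H2; apply: Sigma1_ext HG => e; split=> [/H2|->]. Qed.

End Computable.

(** The hook is redefined whenever further computable operations become available. *)
Ltac definable_hook := fail.
Ltac definable := repeat (cbv beta; first
  [ assumption
  | match goal with
    | |- Comp _ => first [apply: Comp_cst | apply: Comp_var | definable_hook | apply:
      Comp_add
        | apply: Comp_mul | apply: Comp_if | apply: Comp_least]
    | |- Delta1 _ => first [apply: Delta1_true | apply: Delta1_and | apply:
      Delta1_or | apply: Delta1_not
        | apply: Delta1_iff | apply: Delta1_eq | apply: Delta1_lt | apply:
          Delta1_le | apply: Delta1_mem
        | definable_hook | apply: Delta1_all | apply: Delta1_imp | apply: Delta1_ex]
    | |- Sigma1 _ => first [apply: Sigma1_and | apply: Sigma1_or | apply: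
      Sigma1_ex | apply: Sigma1_allc
        | apply: Delta1_Sg]
    end ]).

(** * Pairing and its projections *)

Section Pairing.
Variable A : arith.
Local Notation M := (dom A).
Implicit Types s t n : M.

Definition pair s t : M := (s + t) * (s + t) + s.

(** A pair with sum [n] lies between the square of [n] and that square plus [n], hence below the
    square of [n + 1]; so the code determines the sum, and then the first component. *)
Lemma pair_inj s t s' t' : pair s t = pair s' t' -> s = s' /\ t = t'.
Proof.
have lt x y x' y' : (x + y)%:q < (x' + y')%:q -> (pair x y)%:q < (pair x' y')%:q.
  move=> /iota_lt; rewrite /pair !iotaE.
  have := iota_ge0 x; have := iota_ge0 y; have := iota_ge0 x'; have := iota_ge0 y'; nra.
move=> E; have S : s + t = s' + t'.
  apply: iota_inj; apply/eqP; rewrite eq_le !leNgt.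
  by apply/andP; split; apply/negP => /lt; rewrite E ltxx.
move: E; rewrite /pair S => /addMI Es; split=> //.
by move: S; rewrite Es => /addMI.
Qed.

Lemma pair_le s t : s%:q <= (pair s t)%:q /\ t%:q <= (pair s t)%:q.
Proof.
rewrite /pair !iotaE; have := iota_ge0 s; have := iota_ge0 t.
have [->|[d ->]] := caseM s; have [->|[d' ->]] := caseM t;
  rewrite !iotaE; try (have := iota_ge0 d); try (have := iota_ge0 d'); split; nra.
Qed.

Definition is_pair n := exists s t, n = pair s t.
(** The premise [is_pair n] makes the search total; off the pairs it stops at 0. *)
Definition pfst n := least (fun s => is_pair n -> exists t, n = pair s t).
Definition psnd n := least (fun t => is_pair n -> n = pair (pfst n) t).

Lemma Comp_pair f g : Comp f -> Comp g -> Comp (fun e : nat -> M => pair (f e) (g e)).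
Proof. by move=> Hf Hg; rewrite /pair; definable. Qed.

Lemma ltS_pair s t : s%:q < (pair s t + 1)%:q /\ t%:q < (pair s t + 1)%:q.
Proof. by rewrite iotaD iota1 !iota_le; apply: pair_le. Qed.

Lemma Delta1_pairl : Delta1 (fun e : nat -> M => exists t, e 1%N = pair (e 0%N) t).
Proof.
apply: (Delta1_ext (P := fun e => exists t, t%:q < (e 1%N + 1)%:q /\
  e 1%N = pair (e 0%N) t)).
  move=> e; split=> [[t [_ ?]]|[t E]]; exists t => //; split=> //.
  by have [_] := ltS_pair (e 0%N) t; rewrite -E.
by rewrite /pair; definable.
Qed.

Lemma Delta1_is_pair f : Comp f -> Delta1 (fun e : nat -> M => is_pair (f e)).
Proof.
apply: Delta1_op1.
apply: (Delta1_ext (P := fun e => exists s, s%:q < (e 0%N + 1)%:q /\ exists t,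
  e 0%N = pair s t)).
  move=> e; split=> [[s [_ [t ?]]]|[s [t E]]]; exists s; first by exists t.
  by split; [have [? _] := ltS_pair s t; rewrite E|exists t].
apply: Delta1_ex; first by definable.
exact: (Delta1_spec (fun i => inl i) Delta1_pairl).
Qed.

Lemma least_spec (T : M -> (nat -> M) -> Prop) :
  Delta1 (fun e => T (e 0%N) (fun i => e i.+1)) ->
  forall e, (exists x, T x e) -> T (least (T^~ e)) e.
Proof.
move=> HT e H.
have HT1 : Delta1 (fun e' => T (e' 0%N) e).
  exact: (Delta1_spec (fun i => if i is i'.+1 then inr (e i') else inl 0%N) HT).
by have [] := leastP HT1 H.
Qed.

Let pfstT s (e : nat -> M) := is_pair (e 0%N) -> exists t, e 0%N = pair s t.

Lemma Delta1_pfst : Delta1 (fun e => pfstT (e 0%N) (fun i => e i.+1)).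
Proof.
apply: Delta1_imp; first exact/Delta1_is_pair/Comp_var.
exact: Delta1_pairl.
Qed.

Lemma pfst_ex e : exists s, pfstT s e.
Proof.
have [[s [t E]]|n] := EM (is_pair (e 0%N)); first by exists s => _; exists t.
by exists 0 => /n.
Qed.

Lemma Comp_pfst f : Comp f -> Comp (fun e : nat -> M => pfst (f e)).
Proof. exact: Comp_op1 (Comp_least Delta1_pfst pfst_ex) _. Qed.

Lemma pfst_pair s t : pfst (pair s t) = s.
Proof.
have := least_spec Delta1_pfst (pfst_ex (fun=> pair s t)).
by case=> [|t' /pair_inj []]; first by exists s, t.
Qed.

Let psndT t (e : nat -> M) := is_pair (e 0%N) -> e 0%N = pair (pfst (e 0%N)) t.

Lemma Delta1_psnd : Delta1 (fun e => psndT (e 0%N) (fun i => e i.+1)).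
Proof.
apply: Delta1_imp; first exact/Delta1_is_pair/Comp_var.
apply: Delta1_eq; first exact: Comp_var.
by apply: Comp_pair; [apply: Comp_pfst|]; apply: Comp_var.
Qed.

Lemma psnd_ex e : exists s, psndT s e.
Proof.
have [[s [t E]]|n] := EM (is_pair (e 0%N)).
  by exists t => _; rewrite E pfst_pair.
by exists 0 => /n.
Qed.

Lemma Comp_psnd f : Comp f -> Comp (fun e : nat -> M => psnd (f e)).
Proof. exact: Comp_op1 (Comp_least Delta1_psnd psnd_ex) _. Qed.

Lemma psnd_pair s t : psnd (pair s t) = t.
Proof.
have ip : is_pair (pair s t) by exists s, t.
have H : pair s t = pair (pfst (pair s t)) (psnd (pair s t)) :=
  least_spec Delta1_psnd (psnd_ex (fun=> pair s t)) ip.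
by move: H; rewrite pfst_pair => /pair_inj [].
Qed.

End Pairing.

Ltac definable_hook ::= match goal with
  | |- Comp _ => first [apply: Comp_pair | apply: Comp_pfst | apply: Comp_psnd]
  | |- Delta1 _ => apply: Delta1_is_pair
  end.

(** * Codes of rational numbers and computable rational functions *)

Section Codes.
Variable A : arith.
Local Notation M := (dom A).
Local Notation Q := (QM A).
Local Notation env := (nat -> M).
Local Notation tl e := (fun i => e i.+1).

Definition numerl (z : M) := pfst (pfst z).
Definition numerr (z : M) := psnd (pfst z).
Definition denom1 (z : M) := psnd z.

Definition qval (z : M) : Q := ((numerl z)%:q - (numerr z)%:q) / ((denom1 z)%:q + 1).
Definition is_code (z : M) := is_pair z /\ is_pair (pfst z).
(** The least code is the one that [is_rat] accepts, so every element of [QM] has exactly one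
    rational number of the model as its name. *)
Definition code_of (q : Q) : M := least (fun z => is_code z /\ qval z = q).

Lemma qval_code a b c : qval (pair (pair a b) c) = (a%:q - b%:q) / (c%:q + 1).
Proof. by rewrite /qval /numerl /numerr /denom1 !(pfst_pair, psnd_pair). Qed.

Lemma is_code_code a b c : is_code (pair (pair a b) c).
Proof. by split; rewrite ?pfst_pair; eexists; eexists. Qed.

Lemma is_codeP z : is_code z -> exists a b c, z = pair (pair a b) c.
Proof.
move=> [[x [c E]]]; rewrite E pfst_pair => -[a [b ->]].
by exists a, b, c.
Qed.

Lemma frac_lt (a b c a' b' c' : M) :
  (a%:q - b%:q) / (c%:q + 1) < (a'%:q - b'%:q) / (c'%:q + 1) <->
  (a * (c' + 1) + b' * (c + 1))%:q < (a' * (c + 1) + b * (c' + 1))%:q.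
Proof.
rewrite !iotaE; have := iota_ge0 c; have := iota_ge0 c' => h' h.
rewrite ltr_pdivrMr; last by lra.
rewrite mulrAC ltr_pdivlMr; last by lra.
by split; lra.
Qed.

Lemma frac_eq (a b c a' b' c' : M) :
  (a%:q - b%:q) / (c%:q + 1) = (a'%:q - b'%:q) / (c'%:q + 1) <->
  a * (c' + 1) + b' * (c + 1) = a' * (c + 1) + b * (c' + 1).
Proof.
rewrite -!qclsE; split=> [/qcls_eq /eqP //|H]; apply/qcls_eq; exact/eqP.
Qed.

Lemma frac_le (a b c a' b' c' : M) :
  (a%:q - b%:q) / (c%:q + 1) <= (a'%:q - b'%:q) / (c'%:q + 1) <->
  (a * (c' + 1) + b' * (c + 1))%:q <= (a' * (c + 1) + b * (c' + 1))%:q.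
Proof.
rewrite !le_eqVlt; split=> /orP [/eqP H|H]; apply/orP.
- by left; apply/eqP; congr iota; apply/frac_eq.
- by right; apply/frac_lt.
- by left; apply/eqP/frac_eq/iota_inj.
- by right; apply/frac_lt.
Qed.

Lemma Delta1_is_code f : Comp f -> Delta1 (fun e : env => is_code (f e)).
Proof. by move=> Hf; rewrite /is_code; definable. Qed.

Lemma Delta1_qval_eq f g : Comp f -> Comp g -> Delta1 (fun e : env =>
  qval (f e) = qval (g e)).
Proof.
move=> Hf Hg; apply: Delta1_ext => [e|]; first by symmetry; apply: frac_eq.
by rewrite /numerl /numerr /denom1; definable.
Qed.

Lemma Delta1_qval_lt f g : Comp f -> Comp g -> Delta1 (fun e : env =>
  qval (f e) < qval (g e)).
Proof.
move=> Hf Hg; apply: Delta1_ext => [e|]; first by symmetry; apply: frac_lt.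
by rewrite /numerl /numerr /denom1; definable.
Qed.

Lemma Delta1_qval_le f g : Comp f -> Comp g -> Delta1 (fun e : env =>
  qval (f e) <= qval (g e)).
Proof.
move=> Hf Hg; apply: Delta1_ext => [e|]; first by symmetry; apply: frac_le.
by rewrite /numerl /numerr /denom1; definable.
Qed.

Lemma code_of_spec q : [/\ is_code (code_of q), qval (code_of q) = q &
  forall z, is_code z -> qval z = q -> (code_of q)%:q <= z%:q].
Proof.
have [a [b [c Eq]]] := QMP q.
have HD : Delta1 (fun e : env => is_code (e 0%N) /\ qval (e 0%N) = q).
  rewrite Eq -(qval_code a b c); apply: Delta1_and; [apply: Delta1_is_code|apply:
    Delta1_qval_eq]; definable.
have [|[H1 H2] H3] := leastP (P := fun z => is_code z /\ qval z = q) HD.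
  by exists (pair (pair a b) c); split; [apply: is_code_code|rewrite qval_code].
split=> // z z1 z2; rewrite leNgt; apply/negP => /H3; tauto.
Qed.

Lemma code_ofK q : qval (code_of q) = q. Proof. by case: (code_of_spec q). Qed.

Lemma is_code_code_of q : is_code (code_of q). Proof. by case: (code_of_spec q). Qed.

Definition QComp (g : env -> Q) := Comp (fun e => code_of (g e)).

Lemma QComp_ext g h : g =1 h -> QComp g -> QComp h.
Proof. by move=> H; apply: Comp_ext => e; rewrite H. Qed.

Lemma QComp_graph (g : env -> Q) : Delta1 (fun e => qval (e 0%N) = g (tl e)) -> QComp g.
Proof.
move=> H; apply: (Comp_least (T := fun z e => is_code z /\ qval z = g e)).
- by apply: Delta1_and => //; apply: Delta1_is_code; definable.
- by move=> e; exists (code_of (g e)); case: (code_of_spec (g e)).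
Qed.

Lemma QComp_qval f : Comp f -> QComp (fun e => qval (f e)).
Proof.
by move=> Hf; apply: QComp_graph; apply: Delta1_qval_eq; [definable|exact: Comp_weaken].
Qed.

Lemma QComp_frac f g h : Comp f -> Comp g -> Comp h ->
  QComp (fun e => ((f e)%:q - (g e)%:q) / ((h e)%:q + 1)).
Proof.
move=> Hf Hg Hh; apply: (QComp_ext (g := fun e => qval (pair (pair (f e) (g e)) (h e)))).
  by move=> e; rewrite qval_code.
by apply: QComp_qval; definable.
Qed.

Lemma QComp_iota f : Comp f -> QComp (fun e => (f e)%:q).
Proof.
move=> Hf; apply: (QComp_ext (g := fun e => ((f e)%:q - 0%:q) / (0%:q + 1))).
  by move=> e; rewrite iota0; field.
by apply: QComp_frac; definable.
Qed.

Lemma QComp_cst (q : Q) : QComp (fun=> q).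
Proof. exact: Comp_cst. Qed.

Lemma Comp_code_of g : QComp g -> Comp (fun e => code_of (g e)). Proof. by []. Qed.

Lemma QComp_weaken g : QComp g -> QComp (fun e => g (tl e)).
Proof. exact: Comp_weaken. Qed.

Lemma QComp_op2 (op : Q -> Q -> Q) : QComp (fun e => op (qval (e 0%N)) (qval (e 1%N))) ->
  forall g h, QComp g -> QComp h -> QComp (fun e => op (g e) (h e)).
Proof.
move=> Hop g h Hg Hh.
apply: Comp_ext (Comp_op2 (op := fun x y => code_of (op (qval x) (qval y))) Hop Hg Hh) => e.
by rewrite !code_ofK.
Qed.

Lemma QComp_op1 (op : Q -> Q) : QComp (fun e => op (qval (e 0%N))) ->
  forall g, QComp g -> QComp (fun e => op (g e)).
Proof.
move=> Hop g Hg.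
by apply: Comp_ext (Comp_op1 (op := fun x => code_of (op (qval x))) Hop Hg) => e;
  rewrite !code_ofK.
Qed.

Lemma Delta1_qop2 (T : Q -> Q -> Prop) : Delta1 (fun e =>
  T (qval (e 0%N)) (qval (e 1%N))) ->
  forall g h, QComp g -> QComp h -> Delta1 (fun e => T (g e) (h e)).
Proof.
move=> HT g h Hg Hh.
apply: Delta1_ext (Delta1_op2 (T := fun x y => T (qval x) (qval y)) HT Hg Hh) => e.
by rewrite !code_ofK.
Qed.

Lemma Delta1_qeq g h : QComp g -> QComp h -> Delta1 (fun e => g e = h e).
Proof. by apply: Delta1_qop2; apply: Delta1_qval_eq; definable. Qed.

Lemma Delta1_qlt g h : QComp g -> QComp h -> Delta1 (fun e => g e < h e).
Proof. by apply: (Delta1_qop2 (T := fun x y => x < y)); apply: Delta1_qval_lt; definable.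
  Qed.

Lemma Delta1_qle g h : QComp g -> QComp h -> Delta1 (fun e => g e <= h e).
Proof. by apply: (Delta1_qop2 (T := fun x y => x <= y)); apply: Delta1_qval_le;
  definable. Qed.

Lemma QComp_cls f g h : Comp f -> Comp g -> Comp h -> QComp (fun e => qcls (f e, g e, h e)).
Proof.
by move=> Hf Hg Hh; apply: QComp_ext (QComp_frac Hf Hg Hh) => e; rewrite qclsE.
Qed.

Lemma QComp_add g h : QComp g -> QComp h -> QComp (fun e => g e + h e).
Proof.
apply: (QComp_op2 (op := +%R)); rewrite /qval.
apply: QComp_ext => [e|]; first by rewrite -!qclsE [X in _ = X]qaddE.
by apply: QComp_cls; rewrite /numerl /numerr /denom1; definable.
Qed.

Lemma QComp_mul g h : QComp g -> QComp h -> QComp (fun e => g e * h e).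
Proof.
apply: (QComp_op2 (op := *%R)); rewrite /qval.
apply: QComp_ext => [e|]; first by rewrite -!qclsE [X in _ = X]qmulE.
by apply: QComp_cls; rewrite /numerl /numerr /denom1; definable.
Qed.

Lemma QComp_opp g : QComp g -> QComp (fun e => - g e).
Proof.
apply: (QComp_op1 (op := -%R)); rewrite /qval.
apply: QComp_ext => [e|]; first by rewrite -!qclsE [X in _ = X]qoppE.
by apply: QComp_cls; rewrite /numerl /numerr /denom1; definable.
Qed.

Lemma QComp_if P g h : Delta1 P -> QComp g -> QComp h -> QComp (fun e =>
  ite (P e) (g e) (h e)).
Proof.
move=> HP Hg Hh; apply: Comp_ext (Comp_if HP Hg Hh) => e.
by rewrite /ite; case: pselect.
Qed.

Lemma QComp_inv g : QComp g -> QComp (fun e => (g e)^-1).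
Proof.
apply: (QComp_op1 (op := GRing.inv)); apply: QComp_graph.
apply: (Delta1_ext (P := fun e => (qval (e 1%N) = 0 /\ qval (e 0%N) = 0) \/
   (qval (e 1%N) * qval (e 0%N) = 1))).
  move=> e; have [->|n0] := eqVneq (qval (e 1%N)) 0.
    by rewrite invr0 mul0r; split=> [[[]//|/esym/eqP]|->]; [rewrite oner_eq0|left].
  split=> [[[/eqP]|H]|->]; [by rewrite (negbTE n0)| |by right; rewrite mulfV].
  by apply: (mulfI n0); rewrite H mulfV.
have H i : QComp (fun e => qval (e i)) by apply: QComp_qval; definable.
apply: Delta1_or; first by apply: Delta1_and; apply: Delta1_qeq => //; apply: QComp_cst.
by apply: Delta1_qeq; [apply: QComp_mul|apply: QComp_cst].
Qed.

Lemma QComp_norm g : QComp g -> QComp (fun e => `|g e|).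
Proof.
move=> Hg; apply: (QComp_ext (g := fun e => ite (0 <= g e) (g e) (- g e))).
  move=> e; have [H|H] := leP 0 (g e); first by rewrite iteT // ger0_norm.
  by rewrite iteF ?ltr0_norm //; apply/negP; rewrite -ltNge.
by apply: QComp_if => //; [apply: Delta1_qle => //; apply: QComp_cst|apply: QComp_opp].
Qed.

Lemma QComp_max g h : QComp g -> QComp h -> QComp (fun e => Num.max (g e) (h e)).
Proof.
move=> Hg Hh; apply: (QComp_ext (g := fun e => ite (g e <= h e) (h e) (g e))).
  move=> e; have [H|H] := leP (g e) (h e); first by rewrite iteT.
  by rewrite iteF //; apply/negP; rewrite -ltNge.
by apply: QComp_if => //; apply: Delta1_qle.
Qed.

End Codes.

Section ComputableFunctions.
Variable A : arith.
Local Notation M := (dom A).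
Local Notation Q := (QM A).
Local Notation env := (nat -> M).

(** Stated for all computable arguments, so that a hypothesis of this form serves [definable] as a
    closure rule. *)
Definition QFun1 (f : M -> Q) := forall h : env -> M, Comp h -> QComp (fun e => f (h e)).
Definition QFun2 (f : M -> M -> Q) :=
  forall h h' : env -> M, Comp h -> Comp h' -> QComp (fun e => f (h e) (h' e)).

Lemma QFun1P f : QComp (fun e => f (e 0%N)) -> QFun1 f.
Proof. by move=> H h; apply: (Comp_op1 (op := fun x => code_of (f x))). Qed.

Lemma QFun2P f : QComp (fun e => f (e 0%N) (e 1%N)) -> QFun2 f.
Proof. by move=> H h h'; apply: (Comp_op2 (op := fun x y => code_of (f x y))). Qed.

Definition QQFun (G : Q -> M -> Q) :=
  forall (g : env -> Q) (h : env -> M), QComp g -> Comp h -> QComp (fun e => G (g e) (h e)).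

Lemma QQFunP (G : Q -> M -> Q) : QComp (fun e => G (qval (e 0%N)) (e 1%N)) -> QQFun G.
Proof.
move=> H g h Hg Hh.
apply: Comp_ext (Comp_op2 (op := fun x y =>
  code_of (G (qval x) y)) H (Comp_code_of Hg) Hh) => e.
by rewrite code_ofK.
Qed.

End ComputableFunctions.

Ltac definable ::= repeat (cbv beta; first
  [ assumption
  | lazymatch goal with
    | |- QFun1 _ => apply: QFun1P
    | |- QFun2 _ => apply: QFun2P
    | |- Comp (fun e => e _) => apply: Comp_var
    | |- QComp (fun e => @?f e + @?g e) => apply: QComp_add
    | |- QComp (fun e => @?f e * @?g e) => apply: QComp_mul
    | |- QComp (fun e => - @?f e) => apply: QComp_opp
    | |- QComp (fun e => (@?f e)^-1) => apply: QComp_inv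
    | |- QComp (fun e => iota (@?f e)) => apply: QComp_iota
    | |- QComp (fun e => qval (@?f e)) => apply: QComp_qval
    | |- QComp (fun e => `|@?f e|) => apply: QComp_norm
    | |- QComp (fun e => ite (@?P e) (@?f e) (@?g e)) => apply: QComp_if
    | |- Comp (fun e => @?f e + @?g e) => apply: Comp_add
    | |- Comp (fun e => @?f e * @?g e) => apply: Comp_mul
    | |- Comp (fun e => code_of (@?f e)) => apply: Comp_code_of
    | |- Comp (fun e => ite (@?P e) (@?f e) (@?g e)) => apply: Comp_if
    | |- QComp _ => first
      [ apply: QComp_cst
      | match goal with
        | H : QFun1 _ |- _ => apply: H
        | H : QFun2 _ |- _ => apply: H
        | H : QQFun _ |- _ => apply: H
        | H : forall f, Comp f -> _ |- _ => apply: H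
        | H : forall f g, Comp f -> Comp g -> _ |- _ => apply: H
        | H : forall f g h, Comp f -> Comp g -> Comp h -> _ |- _ => apply: H
        end
      | definable_hook | apply: QComp_max ]
    | |- Comp _ => first
      [ apply: Comp_cst
      | match goal with
        | H : forall f, Comp f -> _ |- _ => apply: H
        | H : forall f g, Comp f -> Comp g -> _ |- _ => apply: H
        | H : forall f g h, Comp f -> Comp g -> Comp h -> _ |- _ => apply: H
        end
      | definable_hook | apply: Comp_add | apply: Comp_mul ]
    | |- Delta1 (fun e => is_true (Order.lt (iota (@?f e)) (iota (@?g e)))) => apply:
      Delta1_lt
    | |- Delta1 (fun e => is_true (Order.le (iota (@?f e)) (iota (@?g e)))) => apply:
      Delta1_le
    | |- Delta1 (fun e => is_true (Order.lt (@?f e) (@?g e))) => apply: Delta1_qlt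
    | |- Delta1 (fun e => is_true (Order.le (@?f e) (@?g e))) => apply: Delta1_qle
    | |- Delta1 (fun e => @?f e /\ @?g e) => apply: Delta1_and
    | |- Delta1 (fun e => @?f e \/ @?g e) => apply: Delta1_or
    | |- Delta1 (fun e => ~ @?f e) => apply: Delta1_not
    | |- Delta1 (fun e => mmem (@?f e) _) => apply: Delta1_mem
    | |- Delta1 (fun e => is_code (@?f e)) => apply: Delta1_is_code
    | |- Delta1 _ => first
      [ apply: Delta1_true | apply: Delta1_iff | apply: Delta1_eq | apply: Delta1_qeq
      | match goal with
        | H : forall f, Comp f -> _ |- _ => apply: H
        | H : forall f g, Comp f -> Comp g -> _ |- _ => apply: H
        | H : forall f g h, Comp f -> Comp g -> Comp h -> _ |- _ => apply: H
        end
      | definable_hook | apply: Delta1_all | apply: Delta1_imp | apply: Delta1_ex ]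
    | |- Sigma1 _ => first [apply: Sigma1_and | apply: Sigma1_or | apply:
      Sigma1_ex | apply: Sigma1_allc
        | apply: Delta1_Sg]
    end ]).

(** * Primitive recursion and finite sums *)

Section Beta.
Variable A : arith.
Local Notation M := (dom A).
Local Notation env := (nat -> M).
Local Notation tl e := (fun i => e i.+1).

Definition modulus (d i : M) : M := (i + 1) * d + 1.
(** The least such [r] is the remainder of [c]; bounding the quotient keeps the search condition
    decidable. *)
Definition beta (c d i : M) : M :=
  least (fun r => exists q : M, q%:q < (c + 1)%:q /\ c = q * modulus d i + r).

Let betaT r (e : env) := exists q : M,
  q%:q < (e 0%N + 1)%:q /\ e 0%N = q * modulus (e 1%N) (e 2) + r.

Lemma Delta1_betaT : Delta1 (fun e => betaT (e 0%N) (tl e)).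
Proof. by rewrite /betaT /modulus; definable. Qed.

Lemma betaT_ex e : exists r, betaT r e.
Proof.
exists (e 0%N), 0; rewrite mul0r add0r iotaD iota0 iota1.
by split=> //; have := iota_ge0 (e 0%N); lra.
Qed.

Lemma Comp_beta f g h : Comp f -> Comp g -> Comp h -> Comp (fun e : env =>
  beta (f e) (g e) (h e)).
Proof.
move=> Hf Hg Hh.
have B : Comp (fun e : env => beta (e 0%N) (e 1%N) (e 2)) by exact:
  (Comp_least Delta1_betaT betaT_ex).
apply: (Comp_comp (F := fun x e => beta x (g e) (h e)) Hf).
apply: (Comp_comp (F := fun x e => beta (e 0%N) x (h (tl e))) (Comp_weaken Hg)).
apply: (Comp_comp (F := fun x e => beta (e 1%N) (e 0%N) x) (Comp_weaken (Comp_weaken Hh))).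
exact: (Sigma1_spec (fun i => inl (match i with 0 => 0 | 1 => 3 | 2 => 2 | 3 => 1 | i =>
  i end)%N) B).
Qed.

Lemma beta_eq (c d i q r : M) : c = q * modulus d i + r -> r%:q < (modulus d i)%:q ->
  beta c d i = r.
Proof.
move=> Ec rm; pose e : env := scons c (scons d (fun=> i)).
have HD : Delta1 (fun e' => betaT (e' 0%N) e).
  exact: (Delta1_spec (fun i => if i is i'.+1 then inr (e i') else inl 0%N) Delta1_betaT).
have [|[q' [_ E]] H] := leastP (P := fun r => betaT r e) HD; first exact: betaT_ex.
change (least _) with (beta c d i) in E, H; move: E H; move: (beta c d i) => r' /= E H.
have r'r : r'%:q <= r%:q.
  rewrite leNgt; apply/negP => /H; apply; exists q; split=> //=.
  rewrite iotaD iota1 iota_le Ec /modulus !iotaE.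
  have := iota_ge0 (q * ((i + 1) * d)); have := iota_ge0 r; rewrite !iotaE; lra.
have E' : q * modulus d i + r = q' * modulus d i + r' by rewrite -Ec -E.
move: E' rm; move: (modulus d i) (iota_ge0 (modulus d i)) => m m0.
move=> /(congr1 (@iota A)); rewrite !iotaE => E' rm; have r'0 := iota_ge0 r'.
have lt (x y u v : QM A) : x + 1 <= y -> 0 <= v -> u < m%:q ->
    x * m%:q + u = y * m%:q + v -> False.
  move=> xy v0 um E1.
  have : 0 <= (y - x - 1) * m%:q by apply: mulr_ge0 => //; lra.
  lra.
have qq : q%:q = q'%:q.
  apply/eqP; rewrite eq_le !leNgt; apply/andP; split; apply/negP => /iota_lt qq.
  - by apply: (lt q'%:q q%:q r'%:q r%:q) => //; lra.
  - by apply: (lt q%:q q'%:q r%:q r'%:q).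
by apply: iota_inj; move: E'; rewrite qq; lra.
Qed.

Lemma Comp_bounded (f : M -> M) : Comp (fun e => f (e 0%N)) ->
  forall k : M, exists b : M, forall x : M, x%:q < k%:q -> (f x)%:q < b%:q.
Proof.
move=> /Comp_op1 Hf; apply: sigma1_induction; first by definable.
- by exists 0 => x; rewrite iota0; have := iota_ge0 x; lra.
- move=> k [b Hb]; have [b' [bb' fb']] := bound2 b (f k).
  exists b' => x; rewrite iotaD iota1 iota_le le_eqVlt => /orP [/eqP/iota_inj -> //|/Hb];
    lra.
Qed.

(** A substitute for the factorial, which is not definable before recursion is. *)
Lemma common_multiple (k : M) : exists D : M, 0 < D%:q /\
  forall i : M, i%:q < k%:q -> exists y, D = (i + 1) * y.
Proof.
move: k; apply: sigma1_induction; first by definable.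
- exists 1; rewrite iota1; split=> [|i]; first by lra.
  by rewrite iota0; have := iota_ge0 i; lra.
- move=> k [D [Delta0 HD]]; exists (D * (k + 1)); rewrite !iotaE; split.
    by have := iota_ge0 k; nra.
  move=> i; rewrite iota_le le_eqVlt => /orP [/eqP/iota_inj ->|/HD [y ->]].
    by exists D; rewrite mulrC.
  by exists (y * (k + 1)); rewrite mulrA.
Qed.

Lemma modulus_coprime (j w y d : M) : d = (w + 1) * y -> 0 < d%:q ->
  exists x u, modulus d j * x = modulus d (j + (w + 1)) * u + 1.
Proof.
move=> Ed /iota_pos [d' Ed'].
pose a := j + (w + 1) + 1.
(* Modulo [a * d + 1], where [a * d] is -1, multiplication by [a] takes [modulus d j] to [w + 1].
   Multiplying further by [y], [a] and [a * d] leads to [d], then to -1, then to 1. *)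
exists (y * a * a * (a * d)), (y * a * a * d * (j + 1) + (j + (w + 1)) + a * d').
apply: iota_inj; rewrite /modulus /a !iotaE.
have E1 : d%:q = (w%:q + 1) * y%:q by rewrite Ed !iotaE.
have -> : d'%:q = d%:q - 1 by rewrite Ed' !iotaE; ring.
rewrite E1; ring.
Qed.

(* Goedel's beta function: Chinese remaindering, one modulus at a time.  [E] is
   a multiple of the moduli treated so far and invertible modulo the others. *)
Lemma beta_exists (f : M -> M) (k : M) : Comp (fun e => f (e 0%N)) ->
  exists c d, forall i : M, i%:q < k%:q -> beta c d i = f i.
Proof.
move=> Cf; have [B HB] := Comp_bounded Cf k; have Hf := Comp_op1 Cf.
have [D [Delta0 HD]] := common_multiple k.
(* The factor [D] makes the moduli coprime, the factor [B + 1] makes them exceed the values of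
   [f]. *)
have [d [Ed [d0 dB]]] : exists d, d = D * (B + 1) /\ 0 < d%:q /\ B%:q <= d%:q.
  exists (D * (B + 1)); split=> //; move: Delta0 => /iota_pos [D' ->].
  have := iota_ge0 (D' * B); have := iota_ge0 B; have := iota_ge0 D'.
  by rewrite !iotaE => *; split; lra.
suff: forall j : M, k%:q < j%:q \/ exists c E : M,
    (forall i : M, i%:q < j%:q -> exists q, c = q * modulus d i + f i) /\
    (forall i : M, i%:q < j%:q -> exists y, E = modulus d i * y) /\
    (forall i : M, i%:q < k%:q -> i%:q < j%:q \/ exists x u, E * x = modulus d i * u + 1).
  case/(_ k)=> [|[c [E [Hc _]]]]; first by lra.
  exists c, d => i ik; have [q Eq] := Hc i ik; apply: beta_eq Eq _.
  by have := iota_ge0 (i * d); have := HB i ik; rewrite /modulus !iotaE; lra.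
apply: sigma1_induction; first by rewrite /modulus; definable.
- right; exists 0, 1; do 2![split=> [i|]; first by rewrite iota0; have := iota_ge0 i; lra].
  by move=> i _; right; exists 1, 0; rewrite mulr1 mulr0 add0r.
- move=> j [kj|[c [E [Hc [HE Hcop]]]]]; first by left; rewrite !iotaE; lra.
  have [jk|kj] := ltP j%:q k%:q; last by left; rewrite !iotaE; lra.
  right; have [|[x [u Hx]]] := Hcop j jk; first by lra.
  (* Modulo [modulus d j], [E * x] is 1 and [c * ((j + 1) * d)] is [- c], which leaves [f j]. Modulo
     the earlier moduli [E] vanishes, which leaves [c]. *)
  exists (c + E * (x * (f j + c * ((j + 1) * d)))), (E * modulus d j); split; last split.
  + move=> i; rewrite iotaD iota1 iota_le le_eqVlt => /orP [/eqP/iota_inj ->|ij].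
      exists (c + u * (f j + c * ((j + 1) * d))).
      by rewrite [E * _]mulrA Hx /modulus; ring.
    have [q Eq] := Hc i ij; have [y Ey] := HE i ij.
    exists (q + y * (x * (f j + c * ((j + 1) * d)))).
    by rewrite {1}Eq {1}Ey; ring.
  + move=> i; rewrite iotaD iota1 iota_le le_eqVlt => /orP [/eqP/iota_inj ->|ij].
      by exists E; rewrite mulrC.
    by have [y ->] := HE i ij; exists (y * modulus d j); rewrite mulrA.
  + move=> i ik; have [ij|ji] := ltP i%:q (j + 1)%:q; first by left.
    right; have [|[x1 [u1 H1]]] := Hcop i ik.
      by move: ji; rewrite !iotaE; lra.
    have [w Ew] := iota_sub ji.
    have wk : w%:q < k%:q.
      by move: ik; rewrite Ew !iotaE; have := iota_ge0 j; lra.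
    have [y Ey] := HD w wk.
    have [x2 [u2 H2]] : exists x u, modulus d j * x = modulus d i * u + 1.
      rewrite Ew -addrA (addrC 1 w); apply: (@modulus_coprime j w (y * (B + 1))) => //.
      by rewrite Ed Ey mulrA.
    exists (x1 * x2), (u1 * (modulus d i * u2 + 1) + u2).
    rewrite mulrACA H1 H2; ring.
Qed.

End Beta.

Ltac definable_hook ::= match goal with
  | |- Comp _ => first [apply: Comp_pair | apply: Comp_pfst | apply: Comp_psnd | apply:
    Comp_beta]
  | |- Delta1 _ => apply: Delta1_is_pair
  end.

Section Recursion.
Variable A : arith.
Local Notation M := (dom A).
Local Notation Q := (QM A).
Local Notation env := (nat -> M).
Local Notation tl e := (fun i => e i.+1).
Implicit Types (a k y : M) (g : M -> M -> M).

Lemma iota_lt0 k (P : Prop) : k%:q < (0 : M)%:q -> P.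
Proof. by rewrite iota0 ltNge iota_ge0. Qed.

(** The value is read off a code of the whole computation. The existence of a code is Sigma1, so
    induction yields a value for every [k], nonstandard ones included. *)
Definition primrec_rel a g k y := exists c d, beta c d 0 = a /\
  (forall j : M, j%:q < k%:q -> beta c d (j + 1) = g j (beta c d j)) /\ beta c d k = y.

Definition primrec a g k : M :=
  if pselect (exists y, primrec_rel a g k y) is left H then sval (cid H) else 0.

Lemma primrec_rel_ex a g k : Comp (fun e => g (e 0%N) (e 1%N)) ->
  exists y, primrec_rel a g k y.
Proof.
move=> /Comp_op2 Hg; move: k; apply: sigma1_induction; first by rewrite /primrec_rel;
  definable.
- have [|c [d H]] := @beta_exists A (fun=> a) 1; first by definable.
  exists a, c, d; split; first by apply: H; rewrite iota0 iota1; lra.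
  split; last by apply: H; rewrite iota0 iota1; lra.
  by move=> j; apply: iota_lt0.
- move=> k [y [c [d [H0 [HS Hy]]]]].
  have [|c' [d' H]] := @beta_exists A
    (fun i => ite (i%:q <= k%:q) (beta c d i) (g k y)) (k + 1 + 1); first by definable.
  have H' (i : M) : i%:q <= k%:q -> beta c' d' i = beta c d i.
    by move=> ik; rewrite H ?iteT //; rewrite !iotaE; lra.
  have Hk : beta c' d' (k + 1) = g k y.
    by rewrite H ?iteF // ?iotaE; [apply/negP; rewrite -ltNge; lra|lra].
  exists (g k y), c', d'; split; first by rewrite H' ?iota0 ?iota_ge0.
  split=> // j; rewrite iotaD iota1 iota_le le_eqVlt => /orP [/eqP/iota_inj ->|jk].
    by rewrite Hk H' // Hy.
  by rewrite !H' ?HS //; [lra|rewrite iotaD iota1 -iota_lt].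
Qed.

Lemma primrec_rel_uniq a g k y y' :
  primrec_rel a g k y -> primrec_rel a g k y' -> y = y'.
Proof.
move=> [c [d [H0 [HS <-]]]] [c' [d' [H0' [HS' <-]]]].
suff: forall j : M, k%:q < j%:q \/ beta c d j = beta c' d' j.
  by case/(_ k) => //; rewrite ltxx.
apply: sigma1_induction; first by definable.
- by right; rewrite H0 H0'.
- move=> j [kj|E]; first by left; rewrite !iotaE; lra.
  have [jk|kj] := ltP j%:q k%:q; last by left; rewrite !iotaE; lra.
  by right; rewrite HS // HS' // E.
Qed.

Lemma primrecP a g k : Comp (fun e => g (e 0%N) (e 1%N)) ->
  primrec_rel a g k (primrec a g k).
Proof.
move=> Hg; rewrite /primrec; case: pselect => [H|[]]; first exact: svalP (cid H).
exact: primrec_rel_ex.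
Qed.

Lemma primrec0 a g : Comp (fun e => g (e 0%N) (e 1%N)) -> primrec a g 0 = a.
Proof. by move=> /(primrecP a 0) [c [d [H0 [_ <-]]]]. Qed.

Lemma primrecS a g k : Comp (fun e => g (e 0%N) (e 1%N)) ->
  primrec a g (k + 1) = g k (primrec a g k).
Proof.
move=> Hg; have [c [d [H0 [HS <-]]]] := primrecP a (k + 1) Hg.
rewrite HS; last by rewrite !iotaE; lra.
congr (g k _); apply: (@primrec_rel_uniq a g k); last exact: primrecP.
by exists c, d; do ![split=> //] => j jk; apply: HS; rewrite !iotaE; lra.
Qed.

Lemma Comp_comp2 (F : M -> M -> env -> M) (f g : env -> M) :
  Comp (fun e => F (e 0%N) (e 1%N) (fun i => e i.+2)) -> Comp f -> Comp g ->
  Comp (fun e => F (f e) (g e) e).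
Proof.
move=> HF Hf Hg; apply: (Comp_comp (F := fun x e => F x (g e) e) Hf).
apply: (Comp_comp (F := fun y e => F (e 0%N) y (tl e)) (Comp_weaken Hg)).
exact: (Sigma1_spec (fun i => inl (match i with 1 => 2 | 2 => 1 | i => i end)%N) HF).
Qed.

Lemma Comp_fix2 (F : M -> M -> env -> M) :
  Comp (fun e => F (e 0%N) (e 1%N) (fun i => e i.+2)) ->
  forall e, Comp (fun e' => F (e' 0%N) (e' 1%N) e).
Proof.
move=> HF e.
exact: (Sigma1_spec (fun i => if i is i'.+3 then inr (e i') else inl i) HF).
Qed.

Lemma Comp_primrec (a k : env -> M) (G : M -> M -> env -> M) : Comp a ->
  Comp (fun e => G (e 0%N) (e 1%N) (fun i => e i.+2)) -> Comp k ->
  Comp (fun e => primrec (a e) (fun j w => G j w e) (k e)).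
Proof.
move=> Ha HG Hk.
apply: (Comp_graph (G := fun y e => primrec_rel (a e) (fun j w => G j w e) (k e) y)).
- rewrite /primrec_rel.
  have Ha' : Comp (fun e => a (fun i => e i.+3)).
    exact: (Sigma1_spec (fun i => inl (if i is i'.+1 then i'.+4 else 0%N)) Ha).
  have Hk' : Comp (fun e => k (fun i => e i.+3)).
    exact: (Sigma1_spec (fun i => inl (if i is i'.+1 then i'.+4 else 0%N)) Hk).
  definable.
  apply: (Comp_comp2 (F := fun x y e => G x y (fun i => e i.+4))); [|definable|definable].
  exact: (Sigma1_spec (fun i => inl (if i is i'.+3 then i'.+3.+4 else i)%N) HG).
- by move=> e; apply/primrecP/Comp_fix2.
- by move=> e y H; apply: primrec_rel_uniq H _; apply/primrecP/Comp_fix2.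
Qed.

Definition qprimrec (x : Q) (g : M -> Q -> Q) (k : M) : Q :=
  qval (primrec (code_of x) (fun j w => code_of (g j (qval w))) k).

Lemma qprimrec0 (x : Q) (g : M -> Q -> Q) : QComp (fun e => g (e 0%N) (qval (e 1%N))) ->
  qprimrec x g 0 = x.
Proof. by move=> Hg; rewrite /qprimrec primrec0 // code_ofK. Qed.

Lemma qprimrecS (x : Q) (g : M -> Q -> Q) k : QComp (fun e => g (e 0%N) (qval (e 1%N))) ->
  qprimrec x g (k + 1) = g k (qprimrec x g k).
Proof. by move=> Hg; rewrite /qprimrec primrecS // code_ofK. Qed.

Lemma QComp_qprimrec (x : env -> Q) (k : env -> M) (G : M -> Q -> env -> Q) : QComp x ->
  QComp (fun e => G (e 0%N) (qval (e 1%N)) (fun i => e i.+2)) -> Comp k ->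
  QComp (fun e => qprimrec (x e) (fun j w => G j w e) (k e)).
Proof.
move=> Hx HG Hk; apply: QComp_qval.
exact: (Comp_primrec (G := fun j w e => code_of (G j (qval w) e)) Hx HG Hk).
Qed.

End Recursion.

(** The length is an element of the model, so the sum has to be formed by recursion in the model. *)
HB.lock Definition psum {A : arith} (f : dom A -> QM A) (k : dom A) : QM A :=
  qprimrec 0 (fun j w => w + f j) k.

Lemma QComp_psum (A : arith) (F : dom A -> (nat -> dom A) -> QM A) (k : (nat -> dom A) ->
  dom A) :
  QComp (fun e => F (e 0%N) (fun i => e i.+1)) -> Comp k ->
  QComp (fun e => psum (fun j => F j e) (k e)).
Proof.
move=> HF Hk.
apply: (QComp_ext (g := fun e => qprimrec 0 (fun j w => w + F j e) (k e))).
  by move=> e; rewrite psum.unlock.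
apply: (QComp_qprimrec (G := fun j w e => w + F j e)); [by definable| |by []].
have HF' : QComp (fun e => F (e 0%N) (fun i => e i.+2)).
  exact: (Sigma1_spec (fun i => inl (if i is i'.+2 then i'.+3 else i)%N) HF).
by definable.
Qed.

Ltac definable_hook ::= match goal with
  | |- Comp _ => first [apply: Comp_pair | apply: Comp_pfst | apply: Comp_psnd | apply:
    Comp_beta]
  | |- QComp _ => apply: QComp_psum
  | |- Delta1 _ => apply: Delta1_is_pair
  end.

Section Sums.
Variable A : arith.
Local Notation M := (dom A).
Local Notation Q := (QM A).
Implicit Types (f g : M -> Q) (k : M).

Lemma psum0 f : QFun1 f -> psum f 0 = 0.
Proof. by move=> Hf; rewrite psum.unlock; apply: qprimrec0; definable. Qed.

Lemma psumS f k : QFun1 f -> psum f (k + 1) = psum f k + f k.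
Proof. by move=> Hf; rewrite psum.unlock qprimrecS //; definable. Qed.

Lemma ltS_cases (j k : M) : j%:q < (k + 1)%:q -> j = k \/ j%:q < k%:q.
Proof. by rewrite iotaD iota1 iota_le le_eqVlt => /orP [/eqP/iota_inj|]; [left|right]. Qed.

Lemma lt_iotaS k : k%:q < (k + 1)%:q.
Proof. by rewrite iotaD iota1; lra. Qed.

(** The disjunct [k < j] absorbs the numbers beyond [k], for which there is no induction step. *)
Lemma bounded_induction (P : M -> Prop) k : Delta1 (fun e => P (e 0%N)) -> P 0 ->
  (forall j : M, j%:q < k%:q -> P j -> P (j + 1)) -> P k.
Proof.
move=> HP P0 PS; suff: forall j : M, k%:q < j%:q \/ P j by case/(_ k) => //; rewrite ltxx.
apply: sigma1_induction; [by definable|by right|move=> j [kj|Pj]; first by left;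
  rewrite !iotaE; lra].
have [jk|kj] := ltP j%:q k%:q; last by left; rewrite !iotaE; lra.
by right; apply: PS.
Qed.

Lemma psum_le f g k : QFun1 f -> QFun1 g ->
  (forall j : M, j%:q < k%:q -> f j <= g j) -> psum f k <= psum g k.
Proof.
move=> Hf Hg H; apply: (bounded_induction (P := fun k => psum f k <= psum g k)).
- by definable.
- by rewrite !psum0.
- by move=> j jk; have := H j jk; rewrite !psumS //; lra.
Qed.

Lemma psum_eq f g k : QFun1 f -> QFun1 g ->
  (forall j : M, j%:q < k%:q -> f j = g j) -> psum f k = psum g k.
Proof.
move=> Hf Hg H; apply/eqP; rewrite eq_le.
by apply/andP; split; apply: psum_le => // j /H ->.
Qed.

Lemma psumD f g k : QFun1 f -> QFun1 g ->
  psum (fun j => f j + g j) k = psum f k + psum g k.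
Proof.
move=> Hf Hg; have Hfg : QFun1 (fun j => f j + g j) by definable.
apply: (bounded_induction (P := fun k => psum (fun j =>
  f j + g j) k = psum f k + psum g k)).
- by definable.
- by rewrite !psum0 // addr0.
- by move=> j jk IH; rewrite !psumS // IH; ring.
Qed.

Lemma psumZ (c : Q) f k : QFun1 f -> psum (fun j => c * f j) k = c * psum f k.
Proof.
move=> Hf; have Hfg : QFun1 (fun j => c * f j) by definable.
apply: (bounded_induction (P := fun k => psum (fun j => c * f j) k = c * psum f k)).
- by definable.
- by rewrite !psum0 // mulr0.
- by move=> j jk IH; rewrite !psumS // IH; ring.
Qed.

Lemma psumB f g k : QFun1 f -> QFun1 g ->
  psum (fun j => f j - g j) k = psum f k - psum g k.
Proof.
move=> Hf Hg; rewrite -[- psum g k]mulN1r -psumZ // -psumD //; last by definable.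
by apply: psum_eq; [by definable|by definable|move=> j _; rewrite mulN1r].
Qed.

Lemma psum_cst (c : Q) k : psum (fun=> c) k = k%:q * c.
Proof.
have Hf : QFun1 (fun _ : M => c) by definable.
apply: (bounded_induction (P := fun k => psum (fun=> c) k = k%:q * c)).
- by definable.
- by rewrite psum0 // iota0 mul0r.
- by move=> j jk IH; rewrite psumS // IH !iotaE; ring.
Qed.

Lemma psum_norm f k : QFun1 f -> `|psum f k| <= psum (fun j => `|f j|) k.
Proof.
move=> Hf; have Hf' : QFun1 (fun j => `|f j|) by definable.
apply: (bounded_induction (P := fun k => `|psum f k| <= psum (fun j => `|f j|) k)).
- by definable.
- by rewrite !psum0 // normr0.
- move=> j jk IH; rewrite !psumS //; apply: le_trans (ler_normD _ _) _.
  by rewrite lerD2r.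
Qed.

Lemma psum_swap (F : M -> M -> Q) m n : QFun2 F ->
  psum (fun i => psum (fun j => F i j) n) m = psum (fun j => psum (fun i => F i j) m) n.
Proof.
move=> HF; have H1 : QFun1 (fun i => psum (fun j => F i j) n) by definable.
have H2 m' : QFun1 (fun j => psum (fun i => F i j) m') by definable.
have H3 i : QFun1 (fun j => F i j) by definable.
have H4 j : QFun1 (fun i => F i j) by definable.
apply: (bounded_induction (P := fun m => psum (fun i => psum (fun j => F i j) n) m =
  psum (fun j => psum (fun i => F i j) m) n)).
- by definable.
- rewrite psum0 // -[LHS](mulr0 n%:q) -psum_cst; apply: psum_eq; [by definable|by []|].
  by move=> j _; rewrite psum0.
- move=> i _ IH; rewrite psumS // IH -psumD //; apply: psum_eq; [by definable|by []|].
  by move=> j _; rewrite psumS.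
Qed.

Lemma psum_delta (x : Q) (a k : M) : a%:q < k%:q ->
  psum (fun j => ite (a = j) x 0) k = x.
Proof.
move=> ak; have Hf : QFun1 (fun j => ite (a = j) x 0) by definable.
suff: psum (fun j => ite (a = j) x 0) k = ite (a%:q < k%:q) x 0 by move=> ->; rewrite iteT.
apply: (bounded_induction (P := fun k => psum (fun j =>
  ite (a = j) x 0) k = ite (a%:q < k%:q) x 0)).
- by definable.
- by rewrite psum0 // iteF // ltNge iota_ge0.
- move=> j _ IH; rewrite psumS // IH.
  have [E|[jk|jk]] : a = j \/ a%:q < j%:q \/ j%:q < a%:q.
    by have [E|[[z ->]|[z ->]]] := casesM a j; [left|right; right|right; left];
      rewrite // !iotaE; have := iota_ge0 z; lra.
  + by rewrite iteF ?E ?ltxx // iteT // iteT ?lt_iotaS // add0r.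
  + rewrite iteT // iteF; last by move=> E; rewrite E ltxx in jk.
    by rewrite iteT ?addr0 // iotaD iota1; lra.
  + rewrite iteF; last by apply/negP; rewrite -leNgt ltW.
    rewrite iteF; last by move=> E; rewrite E ltxx in jk.
    by rewrite iteF ?addr0 //; apply/negP; rewrite -leNgt iotaD iota1 -iota_lt.
Qed.

End Sums.

(** * The meaning of the formulas *)

Record connectives (M S : Type) := Connectives {
  c_and : Prop -> Prop -> Prop; c_or : Prop -> Prop -> Prop;
  c_iff : Prop -> Prop -> Prop;
  c_exN : (M -> Prop) -> Prop; c_exS : (S -> Prop) -> Prop }.

(* The connectives as they are abbreviated in the object language. *)
Definition coded_connectives M S : connectives M S :=
  let neg P := P -> False in
  let con P Q := neg (P -> neg Q) in
  Connectives con (fun P Q => neg P -> Q) (fun P Q => con (P -> Q) (Q -> P))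
    (fun P => neg (forall x, neg (P x))) (fun P => neg (forall X, neg (P X))).

Definition std_connectives M S : connectives M S :=
  Connectives and or iff (fun P => exists x, P x) (fun P => exists X, P X).

Lemma connectivesE M S : coded_connectives M S = std_connectives M S.
Proof.
have contra (P : Prop) : ~ ~ P -> P by move/contrapT.
rewrite /coded_connectives /std_connectives; congr Connectives.
- apply: funext => P; apply: funext => Q; apply: propext; split; last by case=> p q /(_ p).
  by move=> H; split; apply: contra => n; apply: H => // ? /n.
- apply: funext => P; apply: funext => Q; apply: propext; split; last by case.
  by move=> H; have [|/H] := EM P; [left|right].
- apply: funext => P; apply: funext => Q; apply: propext; split; last by case=> p q /(_ p).
  by move=> H; split; apply: contra => n; apply: H => ? //; move: n; tauto.
- apply: funext => P; apply: propext; split; last by case=> x Px /(_ x).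
  by move=> H; apply: contra => n; apply: H => x Px; apply: n; exists x.
- apply: funext => P; apply: propext; split; last by case=> x Px /(_ x).
  by move=> H; apply: contra => n; apply: H => x Px; apply: n; exists x.
Qed.

(* What the formulas of the object language say about a model, with the
   connectives as a parameter: for the coded ones this is satisfaction by
   mere computation. *)
Section Meaning.
Variables (A : model) (c : connectives (dom A) (sets A)).
Local Notation M := (dom A).
Local Notation S := (sets A).
Local Open Scope m_scope.
Local Notation "P 'AND' Q" := (c_and c P Q) (at level 80, right associativity).
Local Notation "P 'OR' Q" := (c_or c P Q) (at level 85, right associativity).
Local Notation "P 'IFF' Q" := (c_iff c P Q) (at level 95).
Local Notation "'EX' x , p" := (c_exN c (fun x => p)) (at level 200, x name).
Local Notation "'EXS' x , p" := (c_exS c (fun x => p)) (at level 200, x name).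

Definition t_le (s t : M) := s < t OR s = t.
Local Notation "x <= y" := (t_le x y) : m_scope.
Definition t_pair (s t : M) : M := (s + t) * (s + t) + s.

Definition t_fun (D E : M -> Prop) (F : S) :=
  (forall z, mmem z F -> EX x, EX y, (z = t_pair x y AND D x AND E y)) AND
  (forall x, D x -> EX y, (mmem (t_pair x y) F AND
    forall y', mmem (t_pair x y') F -> y' = y)).

Definition t_value (F : S) (x : M) (K : M -> Prop) : Prop :=
  EX y, (mmem (t_pair x y) F AND K y).

Definition t_infinite (P : M -> Prop) := forall m, EX n, (m <= n AND P n).
Definition t_finite (P : M -> Prop) := EX m, forall n, P n -> n < m.

Definition t_nat (n : M) := n = n.

Definition t_IPP := forall N c0, t_fun t_nat (fun n => n <= N) c0 ->
  EX n, (n <= N AND t_infinite (fun i => mmem (t_pair i n) c0)).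

Definition t_COH := forall R, EXS C, (t_infinite (fun n => mmem n C) AND
  forall i, t_finite (fun n => mmem n C AND (mmem (t_pair i n) R -> False)) OR
    t_finite (fun n => mmem n C AND ((mmem (t_pair i n) R -> False) -> False))).

Record tfrac := TFrac { tpos : M; tneg : M; tden : M }.

Definition t_q0 := TFrac 0 0 1.
Definition t_q1 := TFrac 1 0 1.
Definition t_qinv N := TFrac 1 0 N.
Definition t_qadd u v :=
  TFrac (tpos u * tden v + tpos v * tden u)
        (tneg u * tden v + tneg v * tden u) (tden u * tden v).
Definition t_qopp u := TFrac (tneg u) (tpos u) (tden u).
Definition t_qsub u v := t_qadd u (t_qopp v).
Definition t_qmul u v :=
  TFrac (tpos u * tpos v + tneg u * tneg v)
        (tpos u * tneg v + tneg u * tpos v) (tden u * tden v).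
Definition t_qlt u v :=
  tpos u * tden v + tneg v * tden u < tpos v * tden u + tneg u * tden v.
Definition t_qeq u v :=
  tpos u * tden v + tneg v * tden u = tpos v * tden u + tneg u * tden v.
Definition t_qle u v := t_qlt u v OR t_qeq u v.
Definition t_qabs u (K : tfrac -> Prop) :=
  EX d, ((tpos u = tneg u + d OR tneg u = tpos u + d) AND K (TFrac d 0 (tden u))).

Definition t_qcode (a b d : M) := t_pair (t_pair a b) d.
Definition t_decode (q : M) (K : tfrac -> Prop) :=
  EX a, EX b, EX d, (q = t_qcode a b d AND K (TFrac a b (d + 1))).
Definition t_rat (q : M) := t_decode q (fun u =>
  forall a b d, t_qeq (TFrac a b (d + 1)) u -> q <= t_qcode a b d).
Definition t_allpos (K : tfrac -> Prop) :=
  forall q, t_rat q -> t_decode q (fun u => t_qlt t_q0 u -> K u).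
Definition t_expos (K : tfrac -> Prop) :=
  EX q, (t_rat q AND t_decode q (fun u => t_qlt t_q0 u AND K u)).

Definition tcseq := M -> (M -> Prop) -> Prop.
Definition trseq := M -> (tfrac -> Prop) -> Prop.
Definition t_fracs (x : tcseq) : trseq := fun n K => x n (fun q => t_decode q K).
Definition t_seq (X : S) : tcseq := fun n K => t_value X n K.
Definition t_row (L : S) (j : M) : tcseq := fun n K => t_value L (t_pair j n) K.
Definition t_const u : trseq := fun n K => K u.
Definition t_lift2 op (x y : trseq) : trseq :=
  fun n K => x n (fun u => y n (fun v => K (op u v))).
Definition t_rsub := t_lift2 t_qsub.
Definition t_rmul := t_lift2 t_qmul.
Definition t_rabs (x : trseq) : trseq := fun n K => x n (fun u => t_qabs u K).

Definition t_cauchy (x : trseq) := t_allpos (fun e => EX N, forall m n, N <= m -> N <= n ->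
  x m (fun u => x n (fun v => t_qabs (t_qsub u v) (fun d => t_qlt d e)))).
Definition t_rle (x y : trseq) := t_allpos (fun e => EX N, forall n, N <= n ->
  x n (fun u => y n (fun v => t_qle u (t_qadd v e)))).
Definition t_req x y := t_rle x y AND t_rle y x.
Definition t_rlt x y := t_rle x y AND (t_req x y -> False).
Definition t_real X := t_fun t_nat t_rat X AND t_cauchy (t_fracs (t_seq X)).
Definition t_unit x := t_rle (t_const t_q0) x AND t_rle x (t_const t_q1).
Definition t_family (k : M) (L : S) :=
  t_fun (fun z => EX j, EX n, (z = t_pair j n AND j < k)) t_rat L AND
  (forall j, j < k -> t_cauchy (t_fracs (t_row L j))).
Definition t_rmax (k : M) (x : M -> trseq) : trseq := fun n K =>
  EX i, (i < k AND x i n (fun u =>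
    (forall j, j < k -> x j n (fun v => t_qle v u)) AND K u)).
Definition t_rsum (k : M) (x : M -> trseq) : trseq := fun n K =>
  EXS W, (t_fun t_nat t_rat W AND
    t_fracs (t_seq W) 0 (fun w => t_qeq w t_q0) AND
    (forall j, j < k -> t_fracs (t_seq W) j (fun w => t_fracs (t_seq W) (j + 1) (fun w' =>
         x j n (fun u => t_qeq w' (t_qadd w u))))) AND
    t_fracs (t_seq W) k K).

Definition t_partial (F : S) :=
  t_fun (fun z => EX q, EX i, (z = t_pair q i AND t_rat q)) t_rat F.
Definition t_ball e x q :=
  t_decode q (fun u => t_rlt (t_rabs (t_rsub x (t_const u))) (t_const e)).
Definition t_indom F x := t_allpos (fun e => EX N, (0 < N AND
  forall q r, (t_rat q AND t_ball (t_qinv N) x q) -> (t_rat r AND t_ball (t_qinv N) x r) ->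
  forall i j, N <= i -> N <= j ->
  t_fracs (t_row F q) i (fun u => t_fracs (t_row F r) j (fun v =>
    t_qabs (t_qsub u v) (fun d => t_qlt d e))))).
Definition t_fval F (x : tcseq) : tcseq := fun n K => x n (fun q => t_row F q n K).
Definition t_continuous F := t_partial F AND
  (forall X, (t_real X AND t_unit (t_fracs (t_seq X))) -> t_indom F (t_fracs (t_seq X))).

Definition t_in (L R X Y : S) (j : M) (z : trseq) :=
  (mmem j X -> t_rle (t_fracs (t_row L j)) z) AND
  ((mmem j X -> False) -> t_rlt (t_fracs (t_row L j)) z) AND
  (mmem j Y -> t_rle z (t_fracs (t_row R j))) AND
  ((mmem j Y -> False) -> t_rlt z (t_fracs (t_row R j))).
Definition t_length L R j := t_rsub (t_fracs (t_row R j)) (t_fracs (t_row L j)).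
Definition t_partition k L R X Y :=
  t_family k L AND t_family k R AND
  (forall j, j < k -> t_rle (t_fracs (t_row L j)) (t_fracs (t_row R j))) AND
  (forall i j, i < k -> j < k -> (i = j -> False) ->
    (EXS Z, (t_real Z AND t_in L R X Y i (t_fracs (t_seq Z)) AND
      t_in L R X Y j (t_fracs (t_seq Z)))) -> False) AND
  (forall Z, t_real Z -> (t_unit (t_fracs (t_seq Z)) IFF
     EX j, (j < k AND t_in L R X Y j (t_fracs (t_seq Z))))).
Definition t_mesh k L R := t_rmax k (t_length L R).
Definition t_riemann_sum F k L R T :=
  t_rsum k (fun j => t_rmul (t_fracs (t_fval F (t_row T j))) (t_length L R j)).
Definition t_integrable F := EXS J, (t_real J AND
  t_allpos (fun e => t_expos (fun d => forall k L R X Y,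
    t_partition k L R X Y -> t_rlt (t_mesh k L R) (t_const d) ->
    forall T, t_family k T ->
    (forall j, j < k -> t_in L R X Y j (t_fracs (t_row T j))) ->
    t_rlt (t_rabs (t_rsub (t_fracs (t_seq J)) (t_riemann_sum F k L R T))) (t_const e)))).
Definition t_CRI := forall F, t_continuous F -> t_integrable F.

End Meaning.

Lemma sat_IPP (A : model) e d :
  @sat A e d (sentence IPP) = t_IPP (coded_connectives (dom A) (sets A)).
Proof. by []. Qed.

Lemma sat_COH (A : model) e d :
  @sat A e d (sentence COH) = t_COH (coded_connectives (dom A) (sets A)).
Proof. by []. Qed.

Lemma sat_CRI (A : model) e d :
  @sat A e d (sentence continuous_riemann_integrable) = t_CRI (coded_connectives (dom A) (sets A)).
Proof. by []. Qed.

(** * Fractions and coded functions *)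

Lemma fracD (F : fieldType) (a b c a' b' c' : F) : c != 0 -> c' != 0 ->
  (a * c' + a' * c - (b * c' + b' * c)) / (c * c') = (a - b) / c + (a' - b') / c'.
Proof. by move=> c0 c0'; field; apply/andP. Qed.

Lemma fracM (F : fieldType) (a b c a' b' c' : F) : c != 0 -> c' != 0 ->
  (a * a' + b * b' - (a * b' + b * a')) / (c * c') = (a - b) / c * ((a' - b') / c').
Proof. by move=> c0 c0'; field; apply/andP. Qed.

Section Values.
Variable A : arith.
Local Notation M := (dom A).
Local Notation S := (sets A).
Local Notation Q := (QM A).
Local Notation env := (nat -> M).
Local Notation std := (std_connectives M S).
Local Notation frac := (tfrac A).

Lemma t_leE (s t : M) : t_le std s t <-> s%:q <= t%:q.
Proof.
rewrite /t_le /= ltmE le_eqVlt; split=> [[->|->]|/orP [/eqP/iota_inj|]];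
  rewrite ?eqxx ?orbT //.
- by right.
- by left.
Qed.

Lemma t_pairE (s t : M) : t_pair s t = pair s t. Proof. by []. Qed.

(* The value is 0 outside the domain of the function coded by F. *)
Definition fapp (F : S) (x : M) : M :=
  if pselect (exists y, mmem (pair x y) F) is left H then sval (cid H) else 0.

Lemma fappP D E (F : S) x : t_fun std D E F -> D x ->
  E (fapp F x) /\ forall y, mmem (pair x y) F <-> y = fapp F x.
Proof.
move=> [H1 H2] Dx; have [y [Fy Hy]] := H2 x Dx.
have -> : fapp F x = y.
  rewrite /fapp; case: pselect => [H|[]]; last by exists y.
  by case: (cid H) => z /= /Hy.
split; last by move=> z; split=> [/Hy|->].
by have [x' [y' [/pair_inj [_ ->] []]]] := H1 _ Fy.
Qed.

Lemma t_valueE D E (F : S) x K : t_fun std D E F -> D x ->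
  (t_value std F x K <-> K (fapp F x)).
Proof.
move=> HF Dx; have [_ H] := fappP HF Dx; rewrite /t_value /=.
by split=> [[y [/H ->]]|HK] //; exists (fapp F x); split=> //; apply/H.
Qed.

Lemma Comp_fapp (D E : M -> Prop) (F : S) : t_fun std D E F ->
  Delta1 (fun e : env => D (e 0%N)) -> Comp (fun e : env =>
    ite (D (e 0%N)) (fapp F (e 0%N)) 0).
Proof.
move=> HF /Delta1_op1 HD.
apply: (Comp_graph (G := fun y e => (D (e 0%N) /\ mmem (pair (e 0%N) y) F) \/
  (~ D (e 0%N) /\ y = 0))).
- by definable.
- move=> e; have [d|d] := EM (D (e 0%N)); last by right; rewrite iteF.
  by left; split=> //; rewrite iteT //; have [_ ->] := fappP HF d.
- move=> e y [[d H]|[d ->]]; last by rewrite iteF.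
  by rewrite iteT //; apply/(proj2 (fappP HF d)).
Qed.

Lemma set_exists (P : M -> Prop) : Delta1 (fun e : env => P (e 0%N)) ->
  exists X : S, forall x, mmem x X <-> P x.
Proof. by case; apply: delta1_comprehension. Qed.

Lemma fun_exists (D E : M -> Prop) (f : M -> M) :
  Delta1 (fun e : env => D (e 0%N)) -> Comp (fun e : env => f (e 0%N)) ->
  (forall x, D x -> E (f x)) ->
  exists2 F : S, t_fun std D E F & forall x, D x -> fapp F x = f x.
Proof.
move=> HD Hf HE; have HD' := Delta1_op1 HD; have Hf' := Comp_op1 Hf.
have [|F HF] := @set_exists (fun z => is_pair z /\ D (pfst z) /\ psnd z = f (pfst z)).
  by definable.
have HF' x y : mmem (pair x y) F <-> D x /\ y = f x.
  rewrite HF pfst_pair psnd_pair; split=> [[_ []]|[]] //.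
  by split=> //; exists x, y.
have tF : t_fun std D E F.
  split=> /= [z /HF [[x [y ->]]]|x Dx].
    by rewrite pfst_pair psnd_pair => -[Dx ->]; exists x, (f x); do ![split=> //]; apply:
      HE.
  by exists (f x); split=> [|y' /HF' []] //; apply/HF'.
exists F => // x Dx; have [_ H] := fappP tF Dx.
by symmetry; apply/H/HF'.
Qed.

Definition tval (u : frac) : Q := ((tpos u)%:q - (tneg u)%:q) / (tden u)%:q.
Definition good (u : frac) : Prop := 0 < (tden u)%:q.
(** A continuation on fractions that depends only on the value of the fraction, [K'] being what it
    says of this value. Evaluating a formula in continuation style means finding [K']. *)
Definition ext (K : frac -> Prop) (K' : Q -> Prop) := forall u, good u -> (K u <->
  K' (tval u)).

Lemma good_qadd u v : good u -> good v -> good (t_qadd u v).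
Proof. by rewrite /good iotaM => *; apply: mulr_gt0. Qed.

Lemma tval_qadd u v : good u -> good v -> tval (t_qadd u v) = tval u + tval v.
Proof.
case: u v => [a b c] [a' b' c']; rewrite /good /tval /= => gu gv.
by rewrite !(iotaD, iotaM) fracD // gt_eqF.
Qed.

Lemma good_qsub u v : good u -> good v -> good (t_qsub u v).
Proof. by move=> gu gv; apply: good_qadd. Qed.

Lemma tval_qsub u v : good u -> good v -> tval (t_qsub u v) = tval u - tval v.
Proof.
move=> gu gv; rewrite tval_qadd //; congr (_ + _).
by rewrite /tval /= -mulNr opprB.
Qed.

Lemma good_qmul u v : good u -> good v -> good (t_qmul u v).
Proof. by rewrite /good iotaM => *; apply: mulr_gt0. Qed.

Lemma tval_qmul u v : good u -> good v -> tval (t_qmul u v) = tval u * tval v.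
Proof.
case: u v => [a b c] [a' b' c']; rewrite /good /tval /= => gu gv.
by rewrite !(iotaD, iotaM) fracM // gt_eqF.
Qed.

Lemma t_qltE u v : good u -> good v -> (t_qlt u v <-> tval u < tval v).
Proof.
case: u v => [a b c] [a' b' c']; rewrite /good /= => gu gv;
  rewrite /t_qlt /= ltmE /tval /= !(iotaD, iotaM).
by rewrite ltr_pdivrMr // mulrAC ltr_pdivlMr //; split; lra.
Qed.

Lemma t_qeqE u v : good u -> good v -> (t_qeq u v <-> tval u = tval v).
Proof.
case: u v => [a b c] [a' b' c']; rewrite /good /= => gu gv.
have gu' : c%:q != 0 by rewrite gt_eqF.
have gv' : c'%:q != 0 by rewrite gt_eqF.
rewrite /t_qeq /tval /=; split=> [/(congr1 (@iota A))|/eqP].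
- by rewrite !(iotaD, iotaM) => H; apply/eqP; rewrite eqr_div //; apply/eqP; lra.
- by rewrite eqr_div // => /eqP H; apply: iota_inj; rewrite !(iotaD, iotaM); lra.
Qed.

Lemma t_qleE u v : good u -> good v -> (t_qle std u v <-> tval u <= tval v).
Proof.
move=> gu gv; rewrite /t_qle /= t_qltE // t_qeqE // le_eqVlt.
by split=> [[->|->]|/orP [/eqP|]]; rewrite ?eqxx ?orbT //; [right|left].
Qed.

Lemma t_qabsE u K K' : good u -> ext K K' -> (t_qabs std u K <-> K' `|tval u|).
Proof.
move=> gu H; rewrite /t_qabs /=.
have E d : (tpos u = tneg u + d \/ tneg u = tpos u + d) ->
    tval (TFrac d 0 (tden u)) = `|tval u|.
  rewrite /tval /= iota0 subr0 normrM normfV (gtr0_norm gu) => -[->|->].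
  - by rewrite iotaD addrAC subrr add0r ger0_norm // iota_ge0.
  - by rewrite iotaD opprD addrA subrr add0r normrN ger0_norm // iota_ge0.
have gd d : good (TFrac d 0 (tden u)) by [].
split=> [[d [Hd /(H _ (gd d))]]|HK]; first by rewrite E.
have [d Hd] : exists d, tpos u = tneg u + d \/ tneg u = tpos u + d.
  have [->|[[z ->]|[z ->]]] := casesM (tpos u) (tneg u).
  - by exists 0; left; rewrite addr0.
  - by exists (z + 1); left.
  - by exists (z + 1); right.
by exists d; split=> //; apply/(H _ (gd d)); rewrite E.
Qed.

Lemma tval_code a b d : tval (TFrac a b (madd d (mone A))) = qval (pair (pair a b) d).
Proof. by rewrite qval_code /tval /= iotaD iota1. Qed.

Lemma good_code a b (d : M) : good (TFrac a b (madd d (mone A))).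
Proof. by rewrite /good /= iotaD iota1; have := iota_ge0 d; lra. Qed.

Lemma t_decodeE q K K' : is_code q -> ext K K' -> (t_decode std q K <-> K' (qval q)).
Proof.
move=> /is_codeP [a [b [d ->]]] H; rewrite /t_decode /= /t_qcode.
split=> [[a' [b' [d' [/pair_inj [/pair_inj [-> ->] ->]]]]]|HK].
- by move/(H _ (good_code _ _ _)); rewrite tval_code.
- by exists a, b, d; split=> //; apply/(H _ (good_code _ _ _)); rewrite tval_code.
Qed.

Lemma t_ratE q : t_rat std q <-> code_of (qval q) = q.
Proof.
have H0 (K : frac -> Prop) : t_decode std q K -> is_code q.
  by move=> [a [b [d [-> _]]]]; apply: is_code_code.
have H1 : ext (fun u => forall a b d, t_qeq (TFrac a b (madd d (mone A))) u ->
    t_le std q (t_qcode a b d)) (fun v => forall z, is_code z -> qval z = v ->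
      q%:q <= z%:q).
  move=> u gu; split=> H.
  - move=> z /is_codeP [a [b [d ->]]]; rewrite -tval_code => /t_qeqE E.
    by apply/t_leE/H/E => //; apply: good_code.
  - move=> a b d; rewrite t_qeqE //; last exact: good_code.
    by rewrite tval_code => E; apply/t_leE/H => //; apply: is_code_code.
split=> [H|E].
- have cq := H0 _ H; move: H; rewrite /t_rat (t_decodeE cq H1) => H.
  have [c1 c2 c3] := code_of_spec (qval q).
  by apply: iota_inj; apply: le_anti; rewrite c3 //= H.
- have [c1 c2 c3] := code_of_spec (qval q); rewrite E in c1 c2 c3.
  by rewrite /t_rat (t_decodeE c1 H1).
Qed.

Lemma t_rat_code_of (q : Q) : t_rat std (code_of q).
Proof. by apply/t_ratE; rewrite code_ofK. Qed.

Lemma t_ratP z : t_rat std z -> is_code z.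
Proof. by move=> /t_ratE <-; apply: is_code_code_of. Qed.

Lemma t_allposE K K' : ext K K' -> (t_allpos std K <-> forall e : Q, 0 < e -> K' e).
Proof.
move=> H; have H1 : ext (fun u => t_qlt (t_q0 A) u -> K u) (fun v => 0 < v -> K' v).
  move=> u gu; have g0 : good (t_q0 A) by rewrite /good /= iota1; lra.
  rewrite t_qltE // {1}/tval /= iota0 subrr mul0r.
  by split=> H1 /H1 /(H _ gu).
rewrite /t_allpos; split=> [H2 e|H2 q Hq].
- by have /(t_decodeE (is_code_code_of e) H1) := H2 _ (t_rat_code_of e); rewrite code_ofK.
- by apply/(t_decodeE (t_ratP Hq) H1)/H2.
Qed.

End Values.

(** * Sequences of rationals, reals and families *)

Section Sequences.
Variable A : arith.
Local Notation M := (dom A).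
Local Notation S := (sets A).
Local Notation Q := (QM A).
Local Notation env := (nat -> M).
Local Notation std := (std_connectives M S).
Implicit Types (f g : M -> Q) (x y : trseq A).

(** This exchanges a sequence given by continuations for a function into the field; [creps] is the
    same for sequences of codes. *)
Definition reps x f := forall n K K', ext K K' -> (x n K <-> K' (f n)).
Definition creps (x : tcseq A) f := forall n K, x n K <-> K (code_of (f n)).

Lemma reps_fracs (x : tcseq A) f : creps x f -> reps (t_fracs std x) f.
Proof.
move=> H n K K' HK; rewrite /t_fracs H (t_decodeE (is_code_code_of _) HK).
by rewrite code_ofK.
Qed.

Lemma reps_const u : good u -> reps (t_const u) (fun=> tval u).
Proof. by move=> gu n K K' HK; apply: HK. Qed.

Lemma reps_sub x y f g : reps x f -> reps y g -> reps (t_rsub x y) (fun n => f n - g n).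
Proof.
move=> Hx Hy n K K' HK; apply: (Hx n _ (fun a => K' (a - g n))) => u gu.
apply: (Hy n _ (fun b => K' (tval u - b))) => v gv.
by rewrite -tval_qsub //; apply: HK; apply: good_qsub.
Qed.

Lemma reps_mul x y f g : reps x f -> reps y g -> reps (t_rmul x y) (fun n => f n * g n).
Proof.
move=> Hx Hy n K K' HK; apply: (Hx n _ (fun a => K' (a * g n))) => u gu.
apply: (Hy n _ (fun b => K' (tval u * b))) => v gv.
by rewrite -tval_qmul //; apply: HK; apply: good_qmul.
Qed.

Lemma reps_abs x f : reps x f -> reps (t_rabs std x) (fun n => `|f n|).
Proof.
move=> Hx n K K' HK; apply: (Hx n _ (fun a => K' `|a|)) => u gu.
exact: t_qabsE.
Qed.

Definition cauchyq f := forall e : Q, 0 < e -> exists N : M, forall m n : M,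
  N%:q <= m%:q -> N%:q <= n%:q -> `|f m - f n| < e.
Definition real_le f g := forall e : Q, 0 < e -> exists N : M, forall n : M,
  N%:q <= n%:q -> f n <= g n + e.
Definition real_lt f g := real_le f g /\ ~ real_le g f.

Lemma t_cauchyE x f : reps x f -> (t_cauchy std x <-> cauchyq f).
Proof.
move=> Hx; rewrite /t_cauchy; apply: t_allposE => e ge /=.
have H m n : x m (fun u => x n (fun v => t_qabs std (t_qsub u v) (fun d => t_qlt d e))) <->
    `|f m - f n| < tval e.
  apply: (Hx m _ (fun a => `|a - f n| < tval e)) => u gu.
  apply: (Hx n _ (fun b => `|tval u - b| < tval e)) => v gv.
  rewrite -tval_qsub //; apply: (t_qabsE (K' := fun d => d < tval e)).
  - exact: good_qsub.
  - by move=> d gd; apply: t_qltE.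
by split=> -[N HN]; exists N => m n /t_leE Nm /t_leE Nn; apply/H/HN.
Qed.

Lemma t_rleE x y f g : reps x f -> reps y g -> (t_rle std x y <-> real_le f g).
Proof.
move=> Hx Hy; rewrite /t_rle; apply: t_allposE => e ge /=.
have H n : x n (fun u => y n (fun v => t_qle std u (t_qadd v e))) <-> f n <= g n + tval e.
  apply: (Hx n _ (fun a => a <= g n + tval e)) => u gu.
  apply: (Hy n _ (fun b => tval u <= b + tval e)) => v gv.
  by rewrite -tval_qadd //; apply: t_qleE => //; apply: good_qadd.
by split=> -[N HN]; exists N => n /t_leE /HN /H.
Qed.

Lemma t_rltE x y f g : reps x f -> reps y g -> (t_rlt std x y <-> real_lt f g).
Proof.
by move=> Hx Hy; rewrite /t_rlt /t_req /= !(t_rleE Hx Hy) (t_rleE Hy Hx) /real_lt; tauto.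
Qed.

Lemma real_ltW f g : real_lt f g -> real_le f g. Proof. by case. Qed.

Lemma real_lt_gap f g d N : 0 < d -> (forall n : M, N%:q <= n%:q -> f n + d <= g n) ->
  real_lt f g.
Proof.
move=> d0 H; split=> [e e0|gf]; first by exists N => n /H; lra.
have d2 : 0 < d / 2 by lra.
have [N' H'] := gf _ d2; have [n [n1 n2]] := bound2 N N'.
by have := H n (ltW n1); have := H' n (ltW n2); lra.
Qed.

Lemma real_le_of f g N : (forall n : M, N%:q <= n%:q -> f n <= g n) -> real_le f g.
Proof. by move=> H e e0; exists N => n /H; lra. Qed.

Definition unitq f := real_le (fun=> 0) f /\ real_le f (fun=> 1).

Lemma tval_q0 : good (t_q0 A) /\ tval (t_q0 A) = 0.
Proof. by rewrite /good /tval /= iota0 iota1 subrr mul0r; split=> //; lra. Qed.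

Lemma tval_q1 : good (t_q1 A) /\ tval (t_q1 A) = 1.
Proof. by rewrite /good /tval /= iota0 iota1 subr0 divr1; split=> //; lra. Qed.

Lemma t_unitE x f : reps x f -> (t_unit std x <-> unitq f).
Proof.
move=> Hx; have [[g0 v0] [g1 v1]] := (tval_q0, tval_q1).
have H0 := reps_const g0; have H1 := reps_const g1.
by rewrite /t_unit /= (t_rleE H0 Hx) (t_rleE Hx H1) v0 v1.
Qed.

Definition rval (X : S) : M -> Q := fun n => qval (fapp X n).

Lemma creps_seq X D : t_fun std D (t_rat std) X -> (forall n, D n) ->
  creps (t_seq std X) (rval X).
Proof.
move=> HX HD n K; rewrite /t_seq (t_valueE _ HX (HD n)) /rval.
by have [/t_ratE -> _] := fappP HX (HD n).
Qed.

Definition realq f := QFun1 f /\ cauchyq f.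

Lemma t_real_reps X : t_real std X -> creps (t_seq std X) (rval X).
Proof. by move=> [H _]; apply: (creps_seq H). Qed.

Lemma Delta1_nat : Delta1 (fun e : env => t_nat (e 0%N)).
Proof. by apply: Delta1_eq; definable. Qed.

Lemma t_realP X : t_real std X -> realq (rval X).
Proof.
move=> HX; have [/= H /(t_cauchyE (reps_fracs (t_real_reps HX))) C] := HX.
split=> //; apply: QFun1P; apply: QComp_qval.
by apply: Comp_ext (Comp_fapp H Delta1_nat) => e; rewrite iteT.
Qed.

Lemma seq_exists f : QFun1 f -> exists2 X : S,
  t_fun std (@t_nat A) (t_rat std) X & rval X = f.
Proof.
move=> Hf.
have [||X HX HX'] := @fun_exists A (@t_nat A) (t_rat std) (fun n =>
  code_of (f n)) Delta1_nat.
- by definable.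
- by move=> n _; apply: t_rat_code_of.
- by exists X => //; apply: funext => n; rewrite /rval HX' ?code_ofK.
Qed.

Lemma real_exists f : realq f -> exists2 X : S, t_real std X & rval X = f.
Proof.
move=> [Hf Cf]; have [X HX E] := seq_exists Hf; exists X => //; split=> //=.
by rewrite (t_cauchyE (reps_fracs (creps_seq HX _))) // E.
Qed.

(** A family is defined only below [k]; the default value makes it total and computable. *)
Definition lval (k : M) (L : S) (j n : M) : Q :=
  qval (ite (j%:q < k%:q) (fapp L (pair j n)) 0).

Definition familyq (k : M) (L : M -> M -> Q) :=
  QFun2 L /\ forall j : M, j%:q < k%:q -> cauchyq (L j).

Definition t_family_fun (k : M) (L : S) :=
  t_fun std (fun z => c_exN std (fun j => c_exN std (fun n =>
    c_and std (z = t_pair j n) (mlt j k)))) (t_rat std) L.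

Lemma family_creps k L j : t_family_fun k L -> j%:q < k%:q ->
  creps (t_row std L j) (lval k L j).
Proof.
move=> HL jk n K; rewrite /t_row.
have D : exists j0 n0, t_pair j n = t_pair j0 n0 /\ mlt j0 k.
  by exists j, n; split=> //; apply/ltmE.
rewrite (t_valueE _ HL D) /lval iteT // t_pairE.
by have [/t_ratE -> _] := fappP HL D.
Qed.

Lemma t_family_reps k L j : t_family std k L -> j%:q < k%:q ->
  creps (t_row std L j) (lval k L j).
Proof. by move=> [H _]; apply: family_creps. Qed.

Lemma Delta1_family_dom (k : M) : Delta1 (fun e : env =>
  exists j n, e 0%N = t_pair j n /\ mlt j k).
Proof.
apply: (Delta1_ext (P := fun e => is_pair (e 0%N) /\ (pfst (e 0%N))%:q < k%:q));
  last by definable.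
move=> e; split=> [[[j [n E]]]|[j [n [-> jk]]]].
- by rewrite E pfst_pair => jk; exists j, n; split=> //; apply/ltmE.
- by rewrite t_pairE pfst_pair -ltmE; split=> //; exists j, n.
Qed.

Lemma t_familyP k L : t_family std k L -> familyq k (lval k L).
Proof.
move=> HL; have [/= H C] := HL; split=> [|j jk].
  apply: QFun2P; apply: QComp_qval.
  pose D (z : M) := exists j n, z = t_pair j n /\ mlt j k.
  have F := Comp_op1 (op := fun z => ite (D z) (fapp L z) 0)
    (Comp_fapp (D := D) H (Delta1_family_dom k)).
  apply: Comp_ext (F _ (Comp_pair (Comp_var A 0%N) (Comp_var A 1%N))) => e /=.
  have [jk|jk] := EM ((e 0%N)%:q < k%:q).
  - by rewrite !iteT //; exists (e 0%N), (e 1%N); split=> //; apply/ltmE.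
  - by rewrite !iteF // => -[j [n [/pair_inj [<- _] /ltmE]]].
by apply/(t_cauchyE (reps_fracs (t_family_reps HL jk)))/C; apply/ltmE.
Qed.

Lemma family_exists k (L : M -> M -> Q) : familyq k L -> exists2 X : S,
  t_family std k X & forall j n : M, j%:q < k%:q -> lval k X j n = L j n.
Proof.
move=> [HL CL].
have [||X HX HX'] := @fun_exists A
  (fun z => exists j n, z = t_pair j n /\ mlt j k) (t_rat std)
  (fun z => code_of (L (pfst z) (psnd z))) (Delta1_family_dom k).
- by definable.
- by move=> z _; apply: t_rat_code_of.
have E j n : j%:q < k%:q -> lval k X j n = L j n.
  move=> jk; rewrite /lval iteT // HX'; last by exists j, n; split=> //; apply/ltmE.
  by rewrite code_ofK pfst_pair psnd_pair.
exists X => //; split=> //= j /ltmE jk.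
apply/(t_cauchyE (reps_fracs (family_creps HX jk))).
by move=> e /(CL j jk) [N HN]; exists N => m n; rewrite !E //; apply: HN.
Qed.

End Sequences.

Ltac std_simpl := lazy beta iota delta [c_and c_or c_iff c_exN c_exS std_connectives].

(** * Continuity, partitions and Riemann sums *)

Section Integrals.
Variable A : arith.
Local Notation M := (dom A).
Local Notation S := (sets A).
Local Notation Q := (QM A).
Local Notation env := (nat -> M).
Local Notation std := (std_connectives M S).

Definition Fq (F : S) (q : Q) (i : M) : Q := qval (fapp F (pair (code_of q) i)).

Lemma Delta1_partial_dom : Delta1 (fun e : env => exists q i, e 0%N = t_pair q i /\
  t_rat std q).
Proof.
apply: (Delta1_ext (P := fun e => is_pair (e 0%N) /\
  code_of (qval (pfst (e 0%N))) = pfst (e 0%N))).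
  move=> e; split=> [[[q [i E]]]|[q [i [-> /t_ratE Eq]]]].
  - by rewrite E pfst_pair => Eq; exists q, i; split=> //; apply/t_ratE.
  - by rewrite t_pairE pfst_pair; split=> //; exists q, i.
by definable.
Qed.

Lemma t_partialP F : t_partial std F -> QQFun (Fq F).
Proof.
move=> HF; apply: QQFunP; apply: QComp_qval.
pose D (z : M) := exists q i, z = t_pair q i /\ t_rat std q.
have H := Comp_op1 (op := fun z => ite (D z) (fapp F z) 0) (Comp_fapp (D :=
  D) HF Delta1_partial_dom).
have H' : Comp (fun e : env => pair (code_of (qval (e 0%N))) (e 1%N)) by definable.
apply: Comp_ext (H _ H') => e; rewrite iteT //.
by exists (code_of (qval (e 0%N))), (e 1%N); split=> //; apply: t_rat_code_of.
Qed.

Lemma partial_creps F q : t_partial std F -> creps (t_row std F (code_of q)) (Fq F q).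
Proof.
move=> HF n K; rewrite /t_row.
have D : exists q0 i, t_pair (code_of q) n = t_pair q0 i /\ t_rat std q0.
  by exists (code_of q), n; split=> //; apply: t_rat_code_of.
rewrite (t_valueE _ HF D) /Fq t_pairE.
by have [/t_ratE -> _] := fappP HF D.
Qed.

Lemma partial_exists (G : Q -> M -> Q) : QQFun G -> exists2 F : S,
  t_partial std F & Fq F = G.
Proof.
move=> HG.
have [||X HX HX'] := @fun_exists A (fun z => exists q i, z = t_pair q i /\ t_rat std q)
  (t_rat std) (fun z => code_of (G (qval (pfst z)) (psnd z))) Delta1_partial_dom.
- by definable.
- by move=> z _; apply: t_rat_code_of.
exists X => //; apply: funext => q; apply: funext => i; rewrite /Fq HX'.
  by rewrite pfst_pair psnd_pair !code_ofK.
by exists (code_of q), i; split=> //; apply: t_rat_code_of.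
Qed.

Definition ballq (N : M) (f : M -> Q) (q : Q) :=
  real_lt (fun n => `|f n - q|) (fun=> N%:q^-1).
Definition indomq (G : Q -> M -> Q) (f : M -> Q) := forall e : Q, 0 < e ->
  exists N : M, 0 < N%:q /\ forall q r, ballq N f q -> ballq N f r ->
  forall i j : M, N%:q <= i%:q -> N%:q <= j%:q -> `|G q i - G r j| < e.
Definition contq (G : Q -> M -> Q) := forall f, realq f -> unitq f -> indomq G f.

Lemma t_ballE N x f q : 0 < N%:q -> reps x f -> t_rat std q ->
  (t_ball std (t_qinv N) x q <-> ballq N f (qval q)).
Proof.
move=> N0 Hx /t_ratP cq; rewrite /t_ball.
have gN : good (t_qinv N) by [].
rewrite (t_decodeE (K' := ballq N f) cq) // => u gu.
rewrite (t_rltE (reps_abs (reps_sub Hx (reps_const gu))) (reps_const gN)).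
by rewrite /ballq /tval /= iota0 iota1 subr0 mul1r.
Qed.

Lemma t_indomE F x f : t_partial std F -> reps x f ->
  (t_indom std F x <-> indomq (Fq F) f).
Proof.
move=> HF Hx; rewrite /t_indom; apply: t_allposE => e ge /=.
have H q r i j : t_fracs std (t_row std F (code_of q)) i (fun u =>
    t_fracs std (t_row std F (code_of r)) j (fun v =>
    t_qabs std (t_qsub u v) (fun d => t_qlt d e))) <-> `|Fq F q i - Fq F r j| < tval e.
  apply: (reps_fracs (partial_creps q HF) i (K' := fun a => `|a - Fq F r j| < tval e)) =>
    u gu.
  apply: (reps_fracs (partial_creps r HF) j (K' := fun b => `|tval u - b| < tval e)) =>
    v gv.
  rewrite -tval_qsub //; apply: (t_qabsE (K' := fun d => d < tval e)).
  - exact: good_qsub.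
  - by move=> d gd; apply: t_qltE.
split=> -[N [N0 HN]]; exists N.
- move: N0 => /ltmE N0; split=> [|q r Bq Br i j /t_leE Ni /t_leE Nj]; first exact: N0.
  apply/H/HN => //; split; try exact: t_rat_code_of.
  + by apply/(t_ballE N0 Hx (t_rat_code_of q)); rewrite code_ofK.
  + by apply/(t_ballE N0 Hx (t_rat_code_of r)); rewrite code_ofK.
- split=> [|q r [rq Bq] [rr Br] i j /t_leE Ni /t_leE Nj]; first exact/ltmE.
  have Eq : code_of (qval q) = q by apply/t_ratE.
  have Er : code_of (qval r) = r by apply/t_ratE.
  rewrite -Eq -Er; apply/H/HN => //; first exact/(t_ballE N0 Hx rq).
  exact/(t_ballE N0 Hx rr).
Qed.

Lemma t_continuousE F : t_continuous std F <-> t_partial std F /\ contq (Fq F).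
Proof.
rewrite /t_continuous; std_simpl; split=> -[HF H]; split=> //.
- move=> f /real_exists [X HX <-] Uf.
  have RX := reps_fracs (t_real_reps HX).
  by apply/(t_indomE HF RX)/H; split=> //; apply/(t_unitE RX).
- move=> X [HX UX]; have RX := reps_fracs (t_real_reps HX).
  by apply/(t_indomE HF RX)/H; [apply: t_realP|apply/(t_unitE RX)].
Qed.

(** [p] and [q] tell whether the left and the right endpoint belong to the interval. *)
Definition inq (a b : M -> Q) (p q : Prop) (f : M -> Q) :=
  (p -> real_le a f) /\ (~ p -> real_lt a f) /\ (q -> real_le f b) /\ (~ q -> real_lt f b).

Lemma inq_le a b p q f : inq a b p q f -> real_le a f /\ real_le f b.
Proof.
move=> [H1 [H2 [H3 H4]]]; split.
- by have [/H1|/H2/real_ltW] := EM p.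
- by have [/H3|/H4/real_ltW] := EM q.
Qed.

Lemma t_inE k L R X Y j x f : t_family std k L -> t_family std k R -> j%:q < k%:q ->
  reps x f -> (t_in std L R X Y j x <->
    inq (lval k L j) (lval k R j) (mmem j X) (mmem j Y) f).
Proof.
move=> HL HR jk Hx; rewrite /t_in /inq; std_simpl.
have Lj := reps_fracs (t_family_reps HL jk); have Rj := reps_fracs (t_family_reps HR jk).
by rewrite (t_rleE Lj Hx) (t_rltE Lj Hx) (t_rleE Hx Rj) (t_rltE Hx Rj).
Qed.

Definition partq (k : M) (l r : M -> M -> Q) (X Y : M -> Prop) :=
  [/\ forall j : M, j%:q < k%:q -> real_le (l j) (r j),
     forall i j : M, i%:q < k%:q -> j%:q < k%:q -> i <> j -> forall f, realq f ->
       inq (l i) (r i) (X i) (Y i) f -> inq (l j) (r j) (X j) (Y j) f -> False &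
     forall f, realq f -> (unitq f <->
       exists2 j : M, j%:q < k%:q & inq (l j) (r j) (X j) (Y j) f)].

Lemma t_partitionE k L R X Y : t_partition std k L R X Y <->
  [/\ t_family std k L, t_family std k R &
    partq k (lval k L) (lval k R) (fun j => mmem j X) (fun j => mmem j Y)].
Proof.
rewrite /t_partition; std_simpl; split=> [[HL [HR [H1 [H2 H3]]]]|[HL HR [H1 H2 H3]]].
- have HI j x f := @t_inE k L R X Y j x f HL HR; split=> //; split.
  + move=> j jk; have /ltmE/H1 := jk.
    by move/(t_rleE (reps_fracs (t_family_reps HL jk)) (reps_fracs (t_family_reps HR jk))).
  + move=> i j ik jk ij f /real_exists [Z HZ <-] Hi Hj.
    have RZ := reps_fracs (t_real_reps HZ).
    apply: (H2 i j) => //; [exact/ltmE|exact/ltmE|exists Z; split=> //; split].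
    * exact/(HI i _ _ ik RZ).
    * exact/(HI j _ _ jk RZ).
  + move=> f /real_exists [Z HZ <-]; have RZ := reps_fracs (t_real_reps HZ).
    have := H3 Z HZ; rewrite (t_unitE RZ) => ->; split=> -[j].
    * by move=> [/ltmE jk /(HI j _ _ jk RZ)]; exists j.
    * by move=> jk Hj; exists j; split; [apply/ltmE|apply/(HI j _ _ jk RZ)].
- have HI j x f := @t_inE k L R X Y j x f HL HR; split=> //; split=> //; split; last split.
  + move=> j /ltmE jk.
    apply/(t_rleE (reps_fracs (t_family_reps HL jk)) (reps_fracs (t_family_reps HR jk))).
    exact: H1.
  + move=> i j /ltmE ik /ltmE jk ij [Z [HZ [Hi Hj]]].
    have RZ := reps_fracs (t_real_reps HZ).
    apply: (H2 i j ik jk ij _ (t_realP HZ)); first exact/(HI i _ _ ik RZ).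
    exact/(HI j _ _ jk RZ).
  + move=> Z HZ; have RZ := reps_fracs (t_real_reps HZ).
    have := H3 _ (t_realP HZ); rewrite (t_unitE RZ) => ->; split=> -[j].
    * by move=> jk Hj; exists j; split; [apply/ltmE|apply/(HI j _ _ jk RZ)].
    * by move=> [/ltmE jk /(HI j _ _ jk RZ)]; exists j.
Qed.

(** When all entries agree the maximum is attained at index 0, so no maximum has to be searched
    for. *)
Lemma reps_rmax_cst (k : M) (x : M -> trseq A) (f : M -> M -> Q) (c : Q) :
  (forall j : M, j%:q < k%:q -> reps (x j) (f j)) -> 0 < k%:q ->
  (forall j n : M, j%:q < k%:q -> f j n = c) -> reps (t_rmax std k x) (fun=> c).
Proof.
move=> Hx k0 Hf n K K' HK; rewrite /t_rmax /=.
have H i : i%:q < k%:q -> (x i n (fun u => (forall j, mlt j k -> x j n (fun v =>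
  t_qle std v u)) /\ K u)
    <-> (forall j : M, j%:q < k%:q -> f j n <= f i n) /\ K' (f i n)).
  move=> ik; apply: (Hx i ik n _ (fun a => (forall j : M, j%:q < k%:q -> f j n <= a) /\
    K' a)).
  move=> u gu; rewrite HK //; split=> -[H Ka]; split=> // j jk.
  - have /ltmE/H := jk; rewrite (Hx j jk n _ (fun b => b <= tval u)) //.
    by move=> v gv; apply: t_qleE.
  - have /ltmE jk' := jk; apply/(Hx j jk' n _ (fun b => b <= tval u)); last exact: H.
    by move=> v gv; apply: t_qleE.
split=> [[i [/ltmE ik /(H i ik) [_]]]|HK']; first by rewrite Hf.
exists 0; split; first by apply/ltmE; rewrite iota0.
by apply/H; [rewrite iota0|split=> [j jk|]; rewrite !Hf // iota0].
Qed.

(** The mesh is a maximum taken entry by entry, so a bound on it holds from one [N] on for all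
    intervals together. *)
Lemma t_mesh_le k L R d : t_family std k L -> t_family std k R -> good d ->
  t_rlt std (t_mesh std k L R) (t_const d) -> forall e : Q, 0 < e ->
  exists N : M, forall n : M, N%:q <= n%:q -> forall j : M, j%:q < k%:q ->
    lval k R j n - lval k L j n <= tval d + e.
Proof.
move=> HL HR gd [+ _] e e0.
pose f j n := lval k R j n - lval k L j n.
have Hf j : j%:q < k%:q -> reps (t_length std L R j) (f j).
  by move=> jk; apply: reps_sub; apply: reps_fracs; apply: t_family_reps.
have HK : ext (fun e => c_exN std (fun N => forall n, t_le std N n ->
    t_rmax std k (t_length std L R) n (fun u => t_qle std u (t_qadd d e))))
  (fun e => exists N : M, forall n : M, N%:q <= n%:q -> exists2 i : M, i%:q < k%:q &
    (forall j : M, j%:q < k%:q -> f j n <= f i n) /\ f i n <= tval d + e).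
  move=> e' ge; rewrite /t_rmax /=.
  have H i n : i%:q < k%:q -> (t_length std L R i n (fun u =>
      (forall j, mlt j k -> t_length std L R j n (fun v => t_qle std v u)) /\
        t_qle std u (t_qadd d e'))
    <-> (forall j : M, j%:q < k%:q -> f j n <= f i n) /\ f i n <= tval d + tval e').
    move=> ik; apply: (Hf i ik n _ (fun a => (forall j : M, j%:q < k%:q -> f j n <= a) /\
      a <= tval d + tval e')).
    move=> u gu; rewrite t_qleE ?tval_qadd //; last exact: good_qadd.
    split=> -[H Ka]; split=> // j jk.
    - have /ltmE/H := jk; rewrite (Hf j jk n _ (fun b => b <= tval u)) //.
      by move=> v gv; apply: t_qleE.
    - have /ltmE jk' := jk; apply/(Hf j jk' n _ (fun b => b <= tval u)); last exact: H.
      by move=> v gv; apply: t_qleE.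
  split=> -[N HN]; exists N => n /t_leE /HN.
  - by move=> [i [/ltmE ik /(H i n ik)]]; exists i.
  - by move=> [i ik /(H i n ik)]; exists i; split=> //; apply/ltmE.
move=> /(t_allposE HK) /(_ e e0) [N HN]; exists N => n /HN [i ik [Hi Hi']] j /Hi.
by move/le_trans; apply.
Qed.

(** Induction identifies any witness [W] with the partial sums up to [k]; conversely these form a
    set because [psum] is computable. *)
Lemma reps_rsum (k : M) (x : M -> trseq A) (f : M -> M -> Q) : QFun2 f ->
  (forall j : M, j%:q < k%:q -> reps (x j) (f j)) ->
  reps (t_rsum std k x) (fun n => psum (fun j => f j n) k).
Proof.
move=> Hf Hx n K K' HK; rewrite /t_rsum /=.
have [g0 v0] := tval_q0 A.
have Hfn : QFun1 (fun j => f j n) by definable.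
have HW W : t_fun std (@t_nat A) (t_rat std) W ->
    (t_fracs std (t_seq std W) 0%m (fun w => t_qeq w (t_q0 A)) <-> rval W 0 = 0) /\
    (forall j : M, j%:q < k%:q -> t_fracs std (t_seq std W) j (fun w =>
        t_fracs std (t_seq std W) (j + 1)%m (fun w' =>
         x j n (fun u => t_qeq w' (t_qadd w u)))) <-> rval W (j + 1) = rval W j + f j n) /\
    (t_fracs std (t_seq std W) k K <-> K' (rval W k)).
  move=> tW; have RW := reps_fracs (creps_seq tW (fun=> erefl)); split; last split.
  - apply: (RW _ _ (fun w => w = 0)) => u gu; rewrite -v0; exact: t_qeqE.
  - move=> j jk; apply: (RW _ _ (fun w => rval W (j + 1) = w + f j n)) => u gu.
    apply: (RW _ _ (fun w' => w' = tval u + f j n)) => v gv.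
    apply: (Hx j jk n _ (fun a => tval v = tval u + a)) => w gw.
    by rewrite -tval_qadd //; apply: t_qeqE => //; apply: good_qadd.
  - exact: RW.
split=> [[W [tW [W0 [WS WK]]]]|HK'].
- have [/(proj1) H0 [HS HK1]] := HW W tW; have {}W0 := H0 W0; move: WK => /HK1.
  suff -> : rval W k = psum (fun j => f j n) k by [].
  have CW : QFun1 (rval W).
    by apply: QFun1P; apply: QComp_qval; apply: Comp_ext (Comp_fapp tW (Delta1_nat A)) =>
      e; rewrite iteT.
  apply: (bounded_induction (P := fun k => rval W k = psum (fun j => f j n) k)).
  + by definable.
  + by rewrite psum0.
  + move=> j jk IH; rewrite psumS // -IH; apply/(HS j jk)/WS; exact/ltmE.
- have [|W tW EW] := @seq_exists A (fun j => psum (fun j => f j n) j); first by definable.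
  have [H0 [HS HK1]] := HW W tW; exists W; split=> //; split; last split.
  + by apply/H0; rewrite EW psum0.
  + by move=> j /ltmE jk; apply/HS => //; rewrite EW psumS.
  + by apply/HK1; rewrite EW.
Qed.

Lemma reps_riemann F k L R T : t_partial std F -> t_family std k L -> t_family std k R ->
  t_family std k T -> reps (t_riemann_sum std F k L R T) (fun n =>
   psum (fun j => Fq F (lval k T j n) n * (lval k R j n - lval k L j n)) k).
Proof.
move=> HF HL HR HT.
have [CL _] := t_familyP HL; have [CR _] := t_familyP HR; have [CT _] := t_familyP HT.
have CF := t_partialP HF.
apply: (reps_rsum (f := fun j n => Fq F (lval k T j n) n * (lval k R j n - lval k L j n))).
  by definable.
move=> j jk; apply: reps_mul; last by apply: reps_sub; apply: reps_fracs; apply: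
  t_family_reps.
apply: reps_fracs => n K; rewrite /t_fval.
by rewrite (t_family_reps HT jk); apply: partial_creps.
Qed.

Definition riemannq (G : Q -> M -> Q) (k : M) (l r t : M -> M -> Q) : M -> Q :=
  fun n => psum (fun j => G (t j n) n * (r j n - l j n)) k.

(** The mesh is only assumed to be at most [d], in the uniform form that [t_mesh_le] provides; this
    makes the notion at least as strong as integrability in the formal sense. *)
Definition integrableq (G : Q -> M -> Q) := exists2 J, realq J &
  forall e : Q, 0 < e -> exists2 d : Q, 0 < d & forall k l r X Y,
    familyq k l -> familyq k r -> partq k l r X Y ->
    (forall e' : Q, 0 < e' -> exists N : M, forall n : M, N%:q <= n%:q ->
       forall j : M, j%:q < k%:q -> r j n - l j n <= d + e') ->
    forall t, familyq k t -> (forall j : M, j%:q < k%:q ->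
      inq (l j) (r j) (X j) (Y j) (t j)) ->
    real_lt (fun n => `|J n - riemannq G k l r t n|) (fun=> e).

(** This and the next three lemmas treat continuations that are not known to satisfy [ext]. *)
Lemma t_allposI (K : tfrac A -> Prop) :
  (forall u, good u -> 0 < tval u -> K u) -> t_allpos std K.
Proof.
move=> H q /t_ratP /is_codeP [a [b [d ->]]]; exists a, b, d; split=> // H0.
by apply: H; [apply: good_code|move/t_qltE: H0; rewrite (proj2 (tval_q0 A)); apply;
  [case: (tval_q0 A)|apply: good_code]].
Qed.

Lemma t_allposD (K : tfrac A -> Prop) : t_allpos std K ->
  forall e : Q, 0 < e -> exists2 u, good u & tval u = e /\ K u.
Proof.
move=> H e e0; have [a [b [d [E Ku]]]] := H _ (t_rat_code_of e).
exists (TFrac a b (madd d (mone A))); first exact: good_code.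
have Ev : tval (TFrac a b (madd d (mone A))) = e by rewrite tval_code -(code_ofK e) E.
split=> //; apply: Ku; apply/t_qltE; rewrite ?(proj2 (tval_q0 A)) ?Ev //.
- by case: (tval_q0 A).
- exact: good_code.
Qed.

Lemma t_exposI (K : tfrac A -> Prop) (e : Q) : 0 < e ->
  (forall u, good u -> tval u = e -> K u) -> t_expos std K.
Proof.
move=> e0 H; have [a [b [d E]]] := is_codeP (is_code_code_of e).
have Ev : tval (TFrac a b (madd d (mone A))) = e by rewrite tval_code -(code_ofK e) E.
exists (code_of e); split; first exact: t_rat_code_of.
exists a, b, d; split=> //; split; last by apply: H => //; apply: good_code.
apply/t_qltE; rewrite ?(proj2 (tval_q0 A)) ?Ev //; last exact: good_code.
by case: (tval_q0 A).
Qed.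

Lemma t_exposD (K : tfrac A -> Prop) : t_expos std K ->
  exists2 u, good u & 0 < tval u /\ K u.
Proof.
move=> [q [Hq [a [b [d [E [H0 Ku]]]]]]]; exists (TFrac a b (madd d (mone A))).
  exact: good_code.
split=> //; move/t_qltE: H0; rewrite (proj2 (tval_q0 A)); apply.
- by case: (tval_q0 A).
- exact: good_code.
Qed.

Lemma reps_distance J F k L R T : t_real std J -> t_partial std F -> t_family std k L ->
  t_family std k R -> t_family std k T ->
  reps (t_rabs std (t_rsub (t_fracs std (t_seq std J)) (t_riemann_sum std F k L R T)))
    (fun n => `|rval J n - riemannq (Fq F) k (lval k L) (lval k R) (lval k T) n|).
Proof.
move=> HJ HF HL HR HT; apply: reps_abs; apply: reps_sub; last exact: reps_riemann.
exact: reps_fracs (t_real_reps HJ).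
Qed.

Lemma t_integrable_of F : t_partial std F -> integrableq (Fq F) -> t_integrable std F.
Proof.
move=> HF [J0 /real_exists [J HJ <-] H]; exists J; split=> //.
apply: t_allposI => e ge e0; have [d d0 Hd] := H _ e0.
apply: (t_exposI d0) => d' gd Ed k L R X Y /t_partitionE [HL HR HP] Hm T HT Hin.
apply/(t_rltE (reps_distance HJ HF HL HR HT) (reps_const ge)).
apply: Hd HP _ _ (t_familyP HT) _; [exact: t_familyP|exact: t_familyP| |].
  by rewrite -Ed; apply: t_mesh_le Hm.
move=> j jk; apply/(t_inE _ _ HL HR jk (reps_fracs (t_family_reps HT jk))).
exact/Hin/ltmE.
Qed.

Lemma partq_ext k l r l' r' X Y X' Y' :
  (forall j : M, j%:q < k%:q -> l j = l' j) -> (forall j : M, j%:q < k%:q -> r j = r' j) ->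
  (forall j, X j <-> X' j) -> (forall j, Y j <-> Y' j) ->
  partq k l r X Y -> partq k l' r' X' Y'.
Proof.
move=> El Er EX EY [H1 H2 H3].
have EX' : X = X' by apply: funext => j; apply: propext.
have EY' : Y = Y' by apply: funext => j; apply: propext.
subst X' Y'; split.
- by move=> j jk; rewrite -El // -Er //; apply: H1.
- by move=> i j ik jk ij f Hf; rewrite -!El // -!Er //; apply: H2.
- move=> f Hf; rewrite H3 //; split=> -[j jk Hj]; exists j => //; move: Hj;
    by rewrite El // Er.
Qed.

(* Restricted to intervals of equal length, for which the mesh is constant. *)
Lemma t_integrable_elim F : t_partial std F -> t_integrable std F ->
  exists2 J, realq J & forall e : Q, 0 < e -> exists2 d : Q, 0 < d &
    forall (k : M) l r X Y (c : Q), 0 < k%:q -> c < d ->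
    familyq k l -> familyq k r ->
    Delta1 (fun e : env => X (e 0%N)) -> Delta1 (fun e : env => Y (e 0%N)) ->
      partq k l r X Y ->
    (forall j n : M, j%:q < k%:q -> r j n - l j n = c) ->
    forall t, familyq k t -> (forall j : M, j%:q < k%:q ->
      inq (l j) (r j) (X j) (Y j) (t j)) ->
    real_le (fun n => `|J n - riemannq (Fq F) k l r t n|) (fun=> e).
Proof.
move=> HF [J [HJ H]]; exists (rval J); first exact: t_realP.
move=> e e0; have [ue ge [Ee /t_exposD [d gd [d0 Hd]]]] := t_allposD H e0.
exists (tval d) => // k l r X Y c k0 cd Cl Cr CX CY HP Hc t Ct Hin.
have [L HL EL] := family_exists Cl; have [R HR ER] := family_exists Cr.
have [T HT ET] := family_exists Ct.
have [SX HX] := set_exists CX; have [SY HY] := set_exists CY.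
have EL' j : j%:q < k%:q -> lval k L j = l j by move=> jk; apply: funext => n; apply: EL.
have ER' j : j%:q < k%:q -> lval k R j = r j by move=> jk; apply: funext => n; apply: ER.
have ET' j : j%:q < k%:q -> lval k T j = t j by move=> jk; apply: funext => n; apply: ET.
have HP' : t_partition std k L R SX SY.
  apply/t_partitionE; split=> //; apply: partq_ext HP.
  - by move=> j jk; rewrite EL'.
  - by move=> j jk; rewrite ER'.
  - by move=> j; rewrite HX.
  - by move=> j; rewrite HY.
have Hm : t_rlt std (t_mesh std k L R) (t_const d).
  have Rm : reps (t_mesh std k L R) (fun=> c).
    apply: (reps_rmax_cst (f := fun j n => lval k R j n - lval k L j n)) => //.
    - by move=> j jk; apply: reps_sub; apply: reps_fracs; apply: t_family_reps.
    - by move=> j n jk; rewrite ER' // EL' // Hc.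
  apply/(t_rltE Rm (reps_const gd)); apply: (real_lt_gap (d := tval d - c) (N := 0)).
    by lra.
  by move=> n _; lra.
have Hin' j : mlt j k -> t_in std L R SX SY j (t_fracs std (t_row std T j)).
  move=> /ltmE jk; apply/(t_inE _ _ HL HR jk (reps_fracs (t_family_reps HT jk))).
  rewrite EL' // ER' // ET' //.
  have -> : mmem j SX = X j by apply: propext.
  have -> : mmem j SY = Y j by apply: propext.
  exact: Hin.
have := Hd k L R SX SY HP' Hm T HT Hin'.
move=> /(t_rltE (reps_distance HJ HF HL HR HT) (reps_const ge)) /real_ltW.
rewrite Ee; congr real_le; apply: funext => n; congr (`|_ - _|).
have [CL _] := t_familyP HL; have [CR _] := t_familyP HR; have [CT _] := t_familyP HT.
have [Cl' _] := Cl; have [Cr' _] := Cr; have [Ct' _] := Ct; have CF := t_partialP HF.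
apply: psum_eq; [by definable|by definable|].
by move=> j jk; rewrite EL' // ER' // ET'.
Qed.

End Integrals.

(** * The pigeonhole and cohesive principles in a model *)

Section Principles.
Variable A : arith.
Local Notation M := (dom A).
Local Notation S := (sets A).
Local Notation Q := (QM A).
Local Notation env := (nat -> M).
Local Notation std := (std_connectives M S).

Definition unbounded (P : M -> Prop) := forall m : M, exists n : M, m%:q <= n%:q /\ P n.
Definition eventually (P : M -> Prop) := exists m : M, forall n : M, m%:q <= n%:q -> P n.

Lemma pigeonhole (k : M) (c : M -> M) : Comp (fun e : env => c (e 0%N)) ->
  (forall i, (c i)%:q <= k%:q) ->
  exists n : M, n%:q <= k%:q /\ unbounded (fun i => c i = n).
Proof.
move=> Hc ck.
have [|F HF EF] := @fun_exists A (@t_nat A) (fun n => t_le std n k) c (Delta1_nat A) Hc.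
  by move=> i _; apply/t_leE.
have := models_RCA0_IPP (a := A) (or_intror erefl) (fun=> 0) (fun=> F).
rewrite sat_IPP connectivesE => /(_ k F HF) [n [/t_leE nk Hn]].
exists n; split=> // m; have [i [/t_leE mi Hi]] := Hn m; exists i; split=> //.
by rewrite -EF //; symmetry; apply/(proj2 (fappP HF (erefl i))).
Qed.

Definition cohesion := forall R : M -> M -> Prop, Delta1 (fun e : env =>
  R (e 0%N) (e 1%N)) ->
  exists2 C : M -> Prop, Delta1 (fun e : env => C (e 0%N)) & unbounded C /\
  forall i, eventually (fun n => C n -> R i n) \/ eventually (fun n => C n -> ~ R i n).

Lemma t_finiteE (C P : M -> Prop) :
  t_finite std (fun n => c_and std (C n) (P n -> False)) <-> eventually (fun n => C n ->
    P n).
Proof.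
split=> -[m Hm]; exists m => n /=.
- move=> mn Cn; apply: contrapT => nP.
  by have /ltmE := Hm n (conj Cn nP); rewrite ltNge mn.
- move=> [Cn nP]; apply/ltmE; rewrite ltNge; apply/negP => /Hm; tauto.
Qed.

Lemma t_COH_iff : t_COH std <-> cohesion.
Proof.
split=> [H R HR|H R].
- have HR' := Delta1_op2 HR.
  have [|SR HSR] := @set_exists A (fun z => R (pfst z) (psnd z)); first by definable.
  have [C [HC1 HC2]] := H SR; exists (fun n => mmem n C); first by definable.
  split=> [m|i]; first by have [n [/t_leE mn Cn]] := HC1 m; exists n.
  have HRi n : mmem (t_pair i n) SR <-> R i n by rewrite HSR t_pairE pfst_pair psnd_pair.
  have [/t_finiteE [m Hm]|/t_finiteE [m Hm]] := HC2 i; [left|right]; exists m => n mn Cn.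
  + exact/HRi/Hm.
  + by rewrite -HRi; apply: Hm.
- have [|C HC [C1 C2]] := H (fun i n => mmem (pair i n) R); first by definable.
  have [SC HSC] := set_exists HC; exists SC; split=> [m|i].
    by have [n [mn Cn]] := C1 m; exists n; split; [apply/t_leE|apply/HSC].
  have [[m Hm]|[m Hm]] := C2 i; [left|right]; apply/t_finiteE; exists m => n mn /HSC Cn;
    exact: Hm.
Qed.

End Principles.

(** * Cohesive sets yield Riemann integrals *)

Section Estimate.
Variable A : arith.
Local Notation M := (dom A).
Local Notation Q := (QM A).
Local Notation env := (nat -> M).

Lemma ind_ge0 (P : Prop) : 0 <= ite P 1 0 :> Q.
Proof. by have [p|p] := EM P; [rewrite iteT|rewrite iteF]. Qed.

Lemma psum_ge0 (f : M -> Q) (k : M) : QFun1 f -> (forall j, 0 <= f j) -> 0 <= psum f k.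
Proof.
move=> Hf H; rewrite -[X in X <= _](mulr0 k%:q) -psum_cst.
by apply: psum_le => //; definable.
Qed.

Definition count (a b : Q) (p : M) : Q := psum (fun i => ite (a <= i%:q /\
  i%:q <= b) 1 0) p.

Lemma QFun1_between (a b : Q) : QFun1 (fun i : M => ite (a <= i%:q /\ i%:q <= b) (1 : Q) 0).
Proof. by definable. Qed.

Lemma countS a b (p : M) : count a b (p + 1) = count a b p + ite (a <= p%:q /\
  p%:q <= b) 1 0.
Proof. by rewrite /count psumS //; apply: QFun1_between. Qed.

Lemma count_le a b p : count a b p <= 0 \/ count a b p <= b + 1 - a.
Proof.
(* The induction also needs the bound [p - a]: when a further point [p <= b] is counted, it yields
   the bound [b + 1 - a]. *)
suff: count a b p <= 0 \/ (count a b p <= p%:q - a /\ count a b p <= b + 1 - a) by tauto.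
have Hf := QFun1_between a b.
apply: (bounded_induction (P := fun p => count a b p <= 0 \/
  (count a b p <= p%:q - a /\ count a b p <= b + 1 - a))).
- by rewrite /count; definable.
- by left; rewrite /count psum0.
- move=> {}p _ IH; rewrite countS !iotaE.
  have [[ap pb]|n] := EM (a <= p%:q /\ p%:q <= b).
  + by rewrite iteT //; right; case: IH => [|[]] *; split; lra.
  + by rewrite iteF // addr0; case: IH => [|[]] *; [left|right; split; lra].
Qed.

Lemma count_ge a b p : 0 <= a -> b <= p%:q -> b - a - 1 <= count a b p.
Proof.
move=> a0 bp; have Hf := QFun1_between a b.
have c0 q : 0 <= count a b q by apply: psum_ge0 => // j; apply: ind_ge0.
suff: (p%:q <= b /\ p%:q - a - 1 <= count a b p) \/ (b < p%:q /\ b - a - 1 <= count a b p).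
  by case=> -[]; lra.
apply: (bounded_induction (P := fun p => (p%:q <= b /\ p%:q - a - 1 <= count a b p) \/
  (b < p%:q /\ b - a - 1 <= count a b p))).
- by rewrite /count; definable.
- have := c0 0; rewrite iota0 => H.
  by have [b0|b0] := lerP 0 b; [left|right]; split=> //; lra.
- move=> q _ IH; have := c0 q; rewrite countS !iotaE => cq.
  have [[aq qb]|n] := EM (a <= q%:q /\ q%:q <= b).
  + by rewrite iteT //; have [qb'|qb'] := lerP (q%:q + 1) b; [left|right];
      case: IH => -[] *; split=> //; lra.
  + rewrite iteF // addr0; have [aq|qa] := lerP a q%:q; last first.
      by have [qb'|qb'] := lerP (q%:q + 1) b; [left|right]; split=> //; lra.
    have qb : b < q%:q by rewrite ltNge; apply/negP => qb; apply: n.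
    by right; case: IH => -[] *; split; lra.
Qed.

Lemma psum_unique_le (P : M -> Prop) (k : M) : Delta1 (fun e : env => P (e 0%N)) ->
  (forall i j : M, i%:q < k%:q -> j%:q < k%:q -> P i -> P j -> i = j) ->
  psum (fun j => ite (P j) (1 : Q) 0) k <= 1.
Proof.
move=> /Delta1_op1 HP H; have Hf : QFun1 (fun j => ite (P j) (1 : Q) 0) by definable.
have [[j [jk Pj]]|n] := EM (exists j : M, j%:q < k%:q /\ P j).
- rewrite -[X in _ <= X](psum_delta 1 jk); apply: psum_le => //; first by definable.
  move=> i ik; have [Pi|nPi] := EM (P i); last by rewrite iteF // ind_ge0.
  by rewrite !iteT //; apply: H.
- apply: (@le_trans _ _ 0); last by lra.
  rewrite -[X in _ <= X](mulr0 k%:q) -psum_cst; apply: psum_le => //; first by definable.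
  by move=> i ik; rewrite iteF // => Pi; apply: n; exists i.
Qed.

(* The sum over the [k] intervals [l j, r j] is compared with the sum over the
   grid [i / m], where the grid point [i / m] is assigned to an interval close
   to it.  The number of points assigned to [l j, r j] exceeds its length times
   [m] at most by a little; as the lengths add up to about 1, it cannot be much
   smaller for any of the intervals either. *)
Lemma riemann_estimate (k m : M) (l r u v : M -> Q) (e eta B : Q) :
  QFun1 l -> QFun1 r -> QFun1 u -> QFun1 v -> 0 < m%:q -> 0 <= eta -> 0 <= B ->
  (forall i : M, i%:q < m%:q -> exists2 j : M, j%:q < k%:q &
     l j - eta <= i%:q / m%:q /\ i%:q / m%:q <= r j + eta) ->
  (forall i j j' : M, i%:q < m%:q -> j%:q < k%:q -> j'%:q < k%:q ->
     l j + eta <= i%:q / m%:q -> i%:q / m%:q <= r j - eta ->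
     l j' + eta <= i%:q / m%:q -> i%:q / m%:q <= r j' - eta -> j = j') ->
  (forall j : M, j%:q < k%:q -> l j <= r j + eta) ->
  (forall j : M, j%:q < k%:q -> l j + eta <= r j - eta -> 0 <= l j + eta /\
    r j - eta <= 1) ->
  (forall j : M, j%:q < k%:q -> `|u j| <= B) ->
  (forall i j : M, i%:q < m%:q -> j%:q < k%:q ->
     l j - eta <= i%:q / m%:q -> i%:q / m%:q <= r j + eta -> `|u j - v i| <= e) ->
  `|psum (fun j => u j * (r j - l j)) k - m%:q^-1 * psum v m| <=
    e + 3 * (B * (k%:q * (2 * eta + m%:q^-1))).
Proof.
move=> Hl Hr Hu Hv m0 eta0 B0 H1 H2 H3 H4 H5 H6.
have m0' : m%:q != 0 by rewrite gt_eqF.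
pose near j i := l j - eta <= i%:q / m%:q /\ i%:q / m%:q <= r j + eta.
pose inner j i := l j + eta <= i%:q / m%:q /\ i%:q / m%:q <= r j - eta.
(* The first disjunct makes the search for an interval total; it concerns only indices beyond the
   grid. *)
pose T j (e : env) := m%:q <= (e 0%N)%:q \/ (j%:q < k%:q /\ near j (e 0%N)).
have HT : Delta1 (fun e => T (e 0%N) (fun i => e i.+1)) by rewrite /T /near; definable.
have HTex (e' : env) : exists j, T j e'.
  have [im|mi] := ltP (e' 0%N)%:q m%:q; last by exists 0; left.
  by have [j jk Hj] := H1 _ im; exists j; right.
pose a (i : M) := least (fun j => T j (fun=> i)).
have Ha : forall h : env -> M, Comp h -> Comp (fun e => a (h e)) := Comp_op1 (op :=
  a) (Comp_least HT HTex).
have aP i : i%:q < m%:q -> (a i)%:q < k%:q /\ near (a i) i.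
  by move=> im; case: (least_spec HT (HTex (fun=> i))) => //=; rewrite leNgt im.
have ak i : i%:q < m%:q -> (a i)%:q < k%:q by move=> /aP [].
pose ind i j : Q := ite (a i = j) 1 0.
have Hind : QFun2 ind by rewrite /ind; definable.
pose n_ j := psum (fun i => ind i j) m.
have Hn : QFun1 n_ by rewrite /n_; definable.
(* An interval widened by [eta] on both sides has at most [m] times its new length plus 1 grid
   points. Divided by [m], this exceeds the original length by [kap]. *)
pose kap : Q := 2 * eta + m%:q^-1.
have mi0 : 0 < m%:q^-1 by rewrite invr_gt0.
have kap0 : 0 <= kap by rewrite /kap; lra.
have Eu : psum (fun i => u (a i)) m = psum (fun j => u j * n_ j) k.
  transitivity (psum (fun i => psum (fun j => u j * ind i j) k) m).
    apply: psum_eq; [by definable|by definable|move=> i im].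
    rewrite -(psum_delta (u (a i)) (ak i im)); apply: psum_eq; [by definable|by definable|].
    move=> j _; rewrite /ind; have [->|n] := EM (a i = j); first by rewrite !iteT // mulr1.
    by rewrite !iteF // mulr0.
  rewrite psum_swap; last by definable.
  by apply: psum_eq; [by definable|by definable|move=> j _; rewrite psumZ //; definable].
have En : psum n_ k = m%:q.
  rewrite -psum_swap // -[RHS]mulr1 -psum_cst; apply: psum_eq; [by definable|by definable|].
  by move=> i im; rewrite psum_delta // ak.
have n_le j : j%:q < k%:q -> m%:q^-1 * n_ j - (r j - l j) <= kap.
  move=> jk; have H3j := H3 j jk.
  have : n_ j <= count (m%:q * (l j - eta)) (m%:q * (r j + eta)) m.
    apply: psum_le; [by rewrite /ind; definable|exact: QFun1_between|move=> i im].
    have [E|n] := EM (a i = j); last by rewrite /ind iteF // ind_ge0.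
    rewrite /ind iteT // iteT //; have [_] := aP i im; rewrite E /near.
    by rewrite ler_pdivlMr // ler_pdivrMr // !(mulrC m%:q).
  have Hd : m%:q^-1 * (m%:q * (r j + eta) + 1 - m%:q * (l j - eta)) = r j - l j + kap.
    have -> : m%:q * (r j + eta) + 1 - m%:q * (l j - eta) = m%:q * (r j - l j + 2 * eta) + 1.
      by ring.
    by rewrite mulrDr mulKf // mulr1 /kap; ring.
  case: (count_le (m%:q * (l j - eta)) (m%:q * (r j + eta)) m) => C1 C2.
  - have : m%:q^-1 * n_ j <= 0 by rewrite pmulr_rle0 //; lra.
    rewrite /kap; lra.
  - have : m%:q^-1 * n_ j <= m%:q^-1 * (m%:q * (r j + eta) + 1 - m%:q * (l j - eta)).
      by rewrite ler_pM2l //; lra.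
    by rewrite Hd; lra.
(* A grid point is inner for at most one interval, so these counts add up to at most [m]. Each is at
   least [m] times the length less [kap], so the lengths add up to at most [1 + k * kap]. *)
pose N_ j := psum (fun i => ite (inner j i) (1 : Q) 0) m.
have HN : QFun1 N_ by rewrite /N_ /inner; definable.
have N_ge j : j%:q < k%:q -> r j - l j - kap <= m%:q^-1 * N_ j.
  move=> jk; have N0 : 0 <= N_ j.
    by apply: psum_ge0 => [|i]; [rewrite /inner; definable|apply: ind_ge0].
  have [lr|rl] := lerP (l j + eta) (r j - eta); last first.
    have : 0 <= m%:q^-1 * N_ j by rewrite pmulr_rge0.
    by rewrite /kap; lra.
  have [lj rj] := H4 j jk lr.
  have -> : N_ j = count (m%:q * (l j + eta)) (m%:q * (r j - eta)) m.
    apply: psum_eq; [by rewrite /inner; definable|exact: QFun1_between|move=> i im].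
    congr ite; apply: propext.
    by rewrite /inner ler_pdivlMr // ler_pdivrMr // !(mulrC m%:q).
  have C1 : 0 <= m%:q * (l j + eta) by rewrite pmulr_rge0.
  have C2 : m%:q * (r j - eta) <= m%:q by rewrite ger_pMr.
  have -> : r j - l j - kap = m%:q^-1 * (m%:q * (r j - eta) - m%:q * (l j + eta) - 1).
    have -> : m%:q * (r j - eta) - m%:q * (l j + eta) - 1 = m%:q * (r j - l j - 2 * eta) - 1.
      by ring.
    by rewrite mulrBr mulKf // mulr1 /kap; ring.
  by rewrite ler_pM2l // count_ge.
have N_le : psum N_ k <= m%:q.
  rewrite /N_ -psum_swap; last by rewrite /inner; definable.
  rewrite -[X in _ <= X]mulr1 -psum_cst; apply: psum_le; [by rewrite /inner;
    definable|by definable|].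
  move=> i im; apply: psum_unique_le; first by rewrite /inner; definable.
  by move=> j j' jk jk' [? ?] [? ?]; apply: (H2 i).
have len_le : psum (fun j => r j - l j) k <= 1 + k%:q * kap.
  apply: (@le_trans _ _ (psum (fun j => m%:q^-1 * N_ j + kap) k)).
    by apply: psum_le; [by definable|by definable|move=> j jk; have := N_ge j jk; lra].
  rewrite psumD; [|by definable|by definable]; rewrite psumZ // psum_cst lerD2r.
  by rewrite -(mulVf m0') ler_pM2l.
have step1 : `|psum (fun j => u j * (r j - l j)) k - m%:q^-1 * psum (fun i => u (a i)) m| <=
    3 * (B * (k%:q * kap)).
  rewrite Eu -psumZ; last by definable.
  rewrite -psumB; [|by definable|by definable].
  apply: le_trans (psum_norm _ _) _; first by definable.
  (* The difference of length and share [m^-1 * n_ j] is at least [- kap], so its absolute value is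
     at most itself plus [2 * kap]. The shares add up to 1 and the lengths to at most [1 + k * kap]:
     hence the factor 3. *)
  apply: (@le_trans _ _ (psum (fun j => B * (2 * kap + (r j - l j) - m%:q^-1 * n_ j)) k)).
    apply: psum_le; [by definable|by definable|move=> j jk].
    have -> : u j * (r j - l j) - m%:q^-1 * (u j * n_ j) = u j * (r j - l j - m%:q^-1 * n_ j).
      by ring.
    rewrite normrM; apply: ler_pM => //; first exact: H5.
    by have := n_le j jk; rewrite ler_norml => ?; apply/andP; split; lra.
  rewrite psumZ; last by definable.
  rewrite psumB; [|by definable|by definable]; rewrite psumD; [|by definable|by definable].
  rewrite psum_cst psumZ // En mulVf //.
  have -> : 3 * (B * (k%:q * kap)) = B * (k%:q * (2 * kap) + (1 + k%:q * kap) - 1) by ring.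
  by apply: ler_wpM2l => //; lra.
have step2 : `|m%:q^-1 * psum (fun i => u (a i)) m - m%:q^-1 * psum v m| <= e.
  rewrite -mulrBr -psumB; [|by definable|by definable].
  rewrite normrM gtr0_norm // mulrC ler_pdivrMr //.
  apply: le_trans (psum_norm _ _) _; first by definable.
  rewrite mulrC -psum_cst; apply: psum_le; [by definable|by definable|move=> i im].
  by have [? []] := aP i im; apply: H6.
rewrite -/kap; apply: le_trans (ler_distD (m%:q^-1 * psum (fun i => u (a i)) m) _ _) _.
by rewrite addrC; apply: lerD.
Qed.

End Estimate.

(** * Uniform continuity and boundedness *)

Lemma dist_quarter (R : realFieldType) (x y z d : R) :
  `|x - y| < d / 4 -> `|y - z| <= d / 4 -> `|x - z| + d / 4 <= d.
Proof.
rewrite ltr_norml ler_norml => /andP [? ?] /andP [? ?].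
suff : `|x - z| <= d / 2 by lra.
by rewrite ler_norml; apply/andP; split; lra.
Qed.

Section UniformContinuity.
Variable A : arith.
Local Notation M := (dom A).
Local Notation Q := (QM A).
Local Notation env := (nat -> M).

(** The field is archimedean relative to M: the bound may be nonstandard. *)
Lemma archimedean (q : Q) : exists n : M, q < n%:q.
Proof.
have [a [b [c ->]]] := QMP q; exists (a + 1); rewrite iotaD iota1.
have a0 := iota_ge0 a; have b0 := iota_ge0 b; have c0 := iota_ge0 c.
have c1 : 0 < c%:q + 1 by lra.
rewrite ltr_pdivrMr // mulrDr mulr1 mulrDl mul1r.
by have := mulr_ge0 a0 c0; lra.
Qed.

(** The integer part for nonnegative [q]; for negative [q] the search stops at 0. *)
Definition ipart (q : Q) : M := least (fun n => q < n%:q + 1).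

Lemma Comp_floor (g : env -> Q) : QComp g -> Comp (fun e => ipart (g e)).
Proof.
move=> Hg; apply: (Comp_least (T := fun n e => g e < n%:q + 1)).
  by have Hg' := QComp_weaken Hg; definable.
by move=> e; have [n Hn] := archimedean (g e); exists n; lra.
Qed.

Lemma ipart_lt q : q < (ipart q)%:q + 1.
Proof.
have [||] := leastP (P := fun n : M => q < n%:q + 1); [by definable| |by []].
by have [n Hn] := archimedean q; exists n; lra.
Qed.

Lemma ipart_le q : 0 <= q -> (ipart q)%:q <= q.
Proof.
move=> q0; have [||_ H] := leastP (P := fun n : M => q < n%:q + 1); [by definable| |].
  by have [n Hn] := archimedean q; exists n; lra.
change (least _) with (ipart q) in H.
have [->|[n E]] := caseM (ipart q); first by rewrite iota0.
rewrite E iotaD iota1 leNgt; apply/negP => qn.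
by apply: (H n) => //; rewrite E iotaD iota1; lra.
Qed.

Lemma ipart_max q (k : M) : q < k%:q + 1 -> (ipart q)%:q <= k%:q.
Proof.
move=> qk; have [||_ H] := leastP (P := fun n : M => q < n%:q + 1);
  [by definable|by exists k|].
by rewrite leNgt; apply/negP => /H; apply.
Qed.

Lemma pos_inv (e : Q) : 0 < e -> exists2 N : M, 0 < N%:q & N%:q^-1 < e.
Proof.
move=> e0; have [N HN] := archimedean e^-1.
have N0 : 0 < N%:q by apply: lt_trans HN; rewrite invr_gt0.
by exists N => //; rewrite -[e]invrK ltf_pV2 // posrE invr_gt0.
Qed.

Lemma QFun1_bounded (f : M -> Q) (k : M) : QFun1 f ->
  exists2 b : M, 0 <= b%:q & forall j : M, j%:q < k%:q -> f j <= b%:q.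
Proof.
move=> Hf; suff: exists b : M, forall j : M, j%:q < k%:q -> f j <= b%:q.
  by case=> b Hb; exists b => //; apply: iota_ge0.
move: k; apply: sigma1_induction; first by definable.
- by exists 0 => j; apply: iota_lt0.
- move=> k [b Hb]; have [n Hn] := archimedean (f k); have [c [bc nc]] := bound2 b n.
  exists c => j /ltS_cases [->|/Hb]; lra.
Qed.

(* Contrapositively, finitely many Pi_1 conditions that eventually hold do so
   from a common point on. *)
Lemma pigeonhole_witness (k : M) (T : M -> M -> M -> Prop) :
  Delta1 (fun e : env => T (e 0%N) (e 1%N) (e 2)) ->
  (forall N, exists2 j : M, j%:q < k%:q & exists w, T j N w) ->
  exists2 j : M, j%:q < k%:q & unbounded (fun N => exists w, T j N w).
Proof.
move=> HT H.
pose T' z (e : env) := is_pair z /\ (psnd z)%:q < k%:q /\ T (psnd z) (e 0%N) (pfst z).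
have HT' : Delta1 (fun e => T' (e 0%N) (fun i => e i.+1)).
  rewrite /T'; have X : forall f g h : env -> M, Comp f -> Comp g -> Comp h ->
      Delta1 (fun e => T (f e) (g e) (h e)).
    move=> f g h Hf Hg Hh; apply: (Delta1_comp (T := fun x e => T x (g e) (h e)) Hf).
    apply: (Delta1_comp (T := fun x e => T (e 0%N) x (h (fun i =>
      e i.+1))) (Comp_weaken Hg)).
    apply: (Delta1_comp (T := fun x e =>
      T (e 1%N) (e 0%N) x) (Comp_weaken (Comp_weaken Hh))).
    exact: (Delta1_spec (fun i => inl (match i with 0 => 2 | 1 => 1 | 2 => 0 | i =>
      i end)%N) HT).
  by definable.
have ex e : exists z, T' z e.
  have [j jk [w Hw]] := H (e 0%N); exists (pair w j).
  by rewrite /T' pfst_pair psnd_pair; split=> //; exists w, j.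
pose s N := least (fun z => T' z (fun=> N)).
have Hs : forall f : env -> M, Comp f -> Comp (fun e => s (f e)) :=
  Comp_op1 (op := s) (Comp_least HT' ex).
have sP N : T' (s N) (fun=> N) by apply: (least_spec HT').
have [||j [jk Hj]] := @pigeonhole A k (fun N => psnd (s N)); first by definable.
  by move=> N; have [_ [? _]] := sP N; apply: ltW.
exists j.
  by have [N [_ <-]] := Hj 0; have [_ []] := sP N.
move=> m; have [N [mN E]] := Hj m; exists N; split=> //.
by exists (pfst (s N)); rewrite -E; have [_ []] := sP N.
Qed.

(** Without a common [N], some member of the family varies by [eta] beyond each number; by the
    pigeonhole principle a single member does so beyond arbitrarily large numbers and is not
    Cauchy. *)
Lemma family_accuracy k (l : M -> M -> Q) (eta : Q) : familyq k l -> 0 < eta ->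
  exists N : M, forall n m : M, N%:q <= n%:q -> N%:q <= m%:q ->
    forall j : M, j%:q < k%:q -> `|l j m - l j n| < eta.
Proof.
move=> [Hl Cl] eta0; apply: contrapT => n.
pose T j (N w : M) := N%:q <= (pfst w)%:q /\ N%:q <= (psnd w)%:q /\
  eta <= `|l j (pfst w) - l j (psnd w)|.
have [||j jk Hj] := @pigeonhole_witness k T; first by rewrite /T; definable.
  move=> N; apply: contrapT => nj; apply: n; exists N => n m Nn Nm j jk.
  rewrite ltNge; apply/negP => H; apply: nj; exists j => //.
  by exists (pair m n); rewrite /T pfst_pair psnd_pair.
have [N HN] := Cl j jk eta eta0; have [N' [NN' [w [w1 [w2 w3]]]]] := Hj N.
have := HN (pfst w) (psnd w) (le_trans NN' w1) (le_trans NN' w2).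
by rewrite ltNge w3.
Qed.

(** Some cell from [j / K] to [(j + 1) / K] is visited arbitrarily late. Both ends are cuts on which
    the values along [C] eventually stay on one side, and the visits show which side it is. *)
Lemma cohesive_cauchy (f : M -> Q) (C : M -> Prop) (s : M -> M) (b : M) : QFun1 f ->
  Comp (fun e : env => s (e 0%N)) -> (forall k, C (s k) /\ k%:q <= (s k)%:q) ->
  (forall k, 0 <= f k < b%:q) ->
  (forall q : Q, eventually (fun n => C n -> f n < q) \/
     eventually (fun n => C n -> ~ f n < q)) ->
  cauchyq (fun k => f (s k)).
Proof.
move=> Hf /Comp_op1 Hs sP fb Hcut e e0; have [K K0 Ke] := pos_inv e0.
have fK0 n : 0 <= f (s n) * K%:q by have /andP [? _] := fb (s n); apply: mulr_ge0 => //;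
  apply: ltW.
have [||j [_ Hj]] := @pigeonhole A (b * K) (fun n => ipart (f (s n) * K%:q)).
- by apply: Comp_floor; definable.
- move=> n; apply: ipart_max; rewrite iotaM.
  have /andP [_ fb2] := fb (s n).
  have : f (s n) * K%:q <= b%:q * K%:q by rewrite ler_pM2r // ltW.
  lra.
have [N1 H1] : exists N : M, forall n : M, N%:q <= n%:q -> j%:q / K%:q <= f (s n).
- case: (Hcut (j%:q / K%:q)) => -[N HN].
  + have [n [Nn E]] := Hj N; have [Cn nn] := sP n.
    have := HN _ (le_trans Nn nn) Cn; rewrite ltr_pdivlMr // => H.
    by have := ipart_le (fK0 n); rewrite E leNgt H.
  + exists N => n Nn; have [Cn nn] := sP n.
    by rewrite leNgt; apply/negP; apply: HN => //; apply: le_trans nn.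
have [N2 H2] : exists N : M, forall n : M, N%:q <= n%:q -> f (s n) < (j%:q + 1) / K%:q.
- case: (Hcut ((j%:q + 1) / K%:q)) => -[N HN].
  + by exists N => n Nn; have [Cn nn] := sP n; apply: HN => //; apply: le_trans nn.
  + have [n [Nn E]] := Hj N; have [Cn nn] := sP n.
    case: (HN _ (le_trans Nn nn) Cn); rewrite ltr_pdivlMr //.
    by have := ipart_lt (f (s n) * K%:q); rewrite E.
have [N [n1 n2]] := bound2 N1 N2; exists N => m n Nm Nn.
have m1 := H1 m (le_trans (ltW n1) Nm); have m2 := H2 m (le_trans (ltW n2) Nm).
have p1 := H1 n (le_trans (ltW n1) Nn); have p2 := H2 n (le_trans (ltW n2) Nn).
have E : (j%:q + 1) / K%:q = j%:q / K%:q + K%:q^-1 by rewrite mulrDl mul1r.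
by rewrite ltr_norml; apply/andP; split; lra.
Qed.

(* Otherwise there are counterexamples at every scale, and a cohesive set for
   the cuts of the rationals among them makes them converge to a real at which
   the function would be undefined. *)
Lemma uniform_continuity (G : Q -> M -> Q) : cohesion A -> QQFun G -> contq G ->
  forall e : Q, 0 < e -> exists2 N : M, 0 < N%:q & forall q r : Q,
    - N%:q^-1 <= q -> q <= 1 + N%:q^-1 -> `|q - r| <= N%:q^-1 ->
    forall i j : M, N%:q <= i%:q -> N%:q <= j%:q -> `|G q i - G r j| < e.
Proof.
move=> Hcoh HG CG e e0; apply: contrapT => nH.
pose qz (z : M) := qval (pfst (pfst z)); pose rz (z : M) := qval (psnd (pfst z)).
pose iz (z : M) := pfst (psnd z); pose jz (z : M) := psnd (psnd z).
pose T (z n : M) := [/\ - (n%:q + 1)^-1 <= qz z, qz z <= 1 + (n%:q + 1)^-1,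
  `|qz z - rz z| <= (n%:q + 1)^-1, n%:q + 1 <= (iz z)%:q &
  n%:q + 1 <= (jz z)%:q /\ e <= `|G (qz z) (iz z) - G (rz z) (jz z)|].
have HT : Delta1 (fun ev : env => T (ev 0%N) (ev 1%N)).
  pose T' z (n : M) := - (n%:q + 1)^-1 <= qz z /\ qz z <= 1 + (n%:q + 1)^-1 /\
    `|qz z - rz z| <= (n%:q + 1)^-1 /\ n%:q + 1 <= (iz z)%:q /\
    n%:q + 1 <= (jz z)%:q /\ e <= `|G (qz z) (iz z) - G (rz z) (jz z)|.
  apply: (Delta1_ext (P := fun ev => T' (ev 0%N) (ev 1%N))).
    by move=> ev; rewrite /T /T'; split=> [[? [? [? []]]]|[]].
  by rewrite /T' /qz /rz /iz /jz; definable.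
have ex n : exists z, T z n.
  apply: contrapT => nz; apply: nH; exists (n + 1).
    by rewrite iotaD iota1; have := iota_ge0 n; lra.
  rewrite iotaD iota1 => q r q1 q2 qr i j ni nj; rewrite ltNge; apply/negP => H.
  apply: nz; exists (pair (pair (code_of q) (code_of r)) (pair i j)).
  by rewrite /T /qz /rz /iz /jz !(pfst_pair, psnd_pair) !code_ofK.
have HT1 : Delta1 (fun ev : env => T (ev 0%N) (ev 1%N)) := HT.
pose w n := least (T^~ n).
have Hw : forall f : env -> M, Comp f -> Comp (fun ev => w (f ev)).
  by apply: (Comp_op1 (op := w)); apply: (Comp_least (T := fun z ev => T z (ev 0%N))).
have wP n : T (w n) n by exact: (least_spec (T := fun z ev => T z (ev 0%N)) HT (e :=
  fun=> n) (ex n)).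
pose qs n := qz (w n).
have Hqs : QFun1 qs by rewrite /qs /qz; definable.
have inv1 (n : M) : 0 < (n%:q + 1)^-1 <= 1.
  have n0 := iota_ge0 n; rewrite invr_gt0 invf_le1; first by apply/andP; split; lra.
  by lra.
(* Cuts are indexed by codes of rationals. The points lie between -1 and 2; adding 1 makes them
   nonnegative and smaller than 4, as [cohesive_cauchy] requires with the bound [1 + 1 + 1 + 1]. *)
have [|C HC [C1 C2]] := Hcoh (fun a n => qs n + 1 < qval a).
  by definable.
have exC k : exists n, C n /\ k%:q <= n%:q by have [n [? ?]] := C1 k; exists n.
have HC' := Delta1_op1 HC.
pose s k := least (fun n => C n /\ k%:q <= n%:q).
have DC : Delta1 (fun ev : env => C (ev 0%N) /\ (ev 1%N)%:q <= (ev 0%N)%:q) by definable.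
have Hs0 : Comp (fun ev : env => s (ev 0%N)).
  by apply: (Comp_least (T := fun n ev => C n /\ (ev 0%N)%:q <= n%:q)).
have sP k : C (s k) /\ k%:q <= (s k)%:q.
  exact: (least_spec (T := fun n ev => C n /\ (ev 0%N)%:q <= n%:q) DC (e := fun=>
    k) (exC k)).
have Hs := Comp_op1 Hs0.
have CX : cauchyq (fun k => qs (s k) + 1).
  apply: (@cohesive_cauchy (fun n => qs n + 1) C s (1 + 1 + 1 + 1)) => //;
    first by definable.
  - move=> n; have [q1 q2 _ _ _] := wP n; have /andP [i1 i2] := inv1 n.
    by rewrite !iotaE; apply/andP; split; rewrite /qs; lra.
  - move=> q; have := C2 (code_of q); rewrite !code_ofK; case=> -[m Hm]; [left|right];
      exists m => n mn Cn;
      exact: Hm.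
pose X k := qs (s k).
have CX' : cauchyq X.
  move=> e' e'0; have [N HN] := CX e' e'0; exists N => m n Nm Nn.
  by have := HN m n Nm Nn; rewrite opprD addrACA subrr addr0.
have RX : realq X by split=> //; rewrite /X; definable.
have bX k e' : 0 < e' -> e'^-1 < k%:q -> - e' <= X k /\ X k <= 1 + e'.
  move=> e'0 ek; have [q1 q2 _ _ _] := wP (s k); have [_ ks] := sP k.
  have n0 := iota_ge0 (s k).
  have : ((s k)%:q + 1)^-1 <= e'.
    rewrite -[e']invrK lef_pV2 ?posrE ?invr_gt0 //; lra.
  by rewrite /X /qs; split; lra.
have UX : unitq X.
  split=> e' e'0; have [k Hk] := archimedean e'^-1; exists k => n kn;
    have [] := @bX n e' e'0 (lt_le_trans Hk kn); lra.
have [N [N0 HN]] := CG X RX UX e e0.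
have Ni0 : 0 < N%:q^-1 by rewrite invr_gt0.
(* A quarter of the radius is for the entries after [X N1], a quarter for the distance from [X N1]
   to the counterexample; what is left makes the inequality of reals strict. *)
have [K HK] := CX' (N%:q^-1 / 4) ltac:(lra).
have [K1 HK1] := archimedean (4 * N%:q).
have [k0 [Kk K1k]] := bound2 K K1.
have [N1 [k0N NN1]] := bound2 k0 N.
have [Ck ks] := sP N1.
have [q1 q2 q3 q4 [q5 q6]] := wP (s N1).
have n0 := iota_ge0 (s N1).
have small : ((s N1)%:q + 1)^-1 <= N%:q^-1 / 4.
  have -> : N%:q^-1 / 4 = (4 * N%:q)^-1 by rewrite invfM mulrC.
  by rewrite lef_pV2 ?posrE; lra.
have ball r : `|X N1 - r| <= N%:q^-1 / 4 -> ballq N X r.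
  move=> Hr; apply: (real_lt_gap (d := N%:q^-1 / 4) (N := K)); first by lra.
  by move=> n Kn; apply: dist_quarter Hr; apply: HK => //; apply: ltW (lt_trans Kk k0N).
have B1 : ballq N X (qz (w (s N1))) by apply: ball; rewrite /X /qs subrr normr0; lra.
have B2 : ballq N X (rz (w (s N1))) by apply: ball; apply: le_trans small.
have := HN _ _ B1 B2 (iz (w (s N1))) (jz (w (s N1))).
have i1 : N%:q <= (iz (w (s N1)))%:q by lra.
have j1 : N%:q <= (jz (w (s N1)))%:q by lra.
by move=> /(_ i1 j1); rewrite ltNge q6.
Qed.

(** Each point of the slightly widened interval is within [1 / N] of some [p / N] with [p < N + 3].
    The values there at accuracy [N] are finitely many, and uniform continuity adds at most 1 to
    their bound. *)
Lemma uniform_bound (G : Q -> M -> Q) : cohesion A -> QQFun G -> contq G ->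
  exists B : Q, 0 <= B /\ exists2 N : M, 0 < N%:q & forall q,
    - N%:q^-1 <= q -> q <= 1 + N%:q^-1 -> forall i : M, N%:q <= i%:q -> `|G q i| <= B.
Proof.
move=> Hcoh HG CG; have [N N0 HN] := uniform_continuity Hcoh HG CG ltr01.
have [|b b0 Hb] := @QFun1_bounded (fun p => `|G (p%:q / N%:q) N|) (N + 1 + 1 + 1);
  first by definable.
exists (b%:q + 1); split; first by lra.
exists N => // q q1 q2 i Ni; have Ni0 : 0 < N%:q^-1 by rewrite invr_gt0.
pose p := if 0 <= q then ipart (q * N%:q) else 0.
have [pN pq] : p%:q < (N + 1 + 1 + 1)%:q /\ `|q - p%:q / N%:q| <= N%:q^-1.
  rewrite /p !iotaE; case: (lerP 0 q) => q0; last first.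
    rewrite iota0 mul0r subr0 ler_norml; split; first by lra.
    by apply/andP; split; lra.
  have qN : 0 <= q * N%:q by apply: mulr_ge0 => //; apply: ltW.
  have f1 := ipart_le qN; have f2 := ipart_lt (q * N%:q).
  have qN1 : q * N%:q <= N%:q + 1.
    by rewrite -ler_pdivlMr // mulrDl mulfV ?gt_eqF // mul1r.
  split; first by lra.
  have H1 : (ipart (q * N%:q))%:q / N%:q <= q by rewrite ler_pdivrMr.
  have H2 : q <= (ipart (q * N%:q))%:q / N%:q + N%:q^-1.
    by rewrite -[X in _ + X]mul1r -mulrDl ler_pdivlMr // ltW.
  by rewrite ler_norml; apply/andP; split; lra.
have H1 := Hb p pN; have H2 := HN q _ q1 q2 pq i N Ni (lexx _).
rewrite -[G q i](subrK (G (p%:q / N%:q) N)).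
by apply: le_trans (ler_normD _ _) _; lra.
Qed.

End UniformContinuity.

(** * Convergence of Riemann sums *)

Lemma dist_interval (R : realFieldType) (l r t g eta d : R) :
  l - eta <= t -> t <= r + eta -> l - eta <= g -> g <= r + eta ->
  r - l <= 2 * d -> eta <= d -> `|t - g| <= 4 * d.
Proof. by move=> *; rewrite ler_norml; apply/andP; split; lra. Qed.

Lemma small_error (R : realFieldType) (B k x e : R) : 0 <= B -> 0 <= k ->
  x <= e / (3 * (B * k) + 1) -> 0 <= x -> 3 * (B * (k * x)) <= e.
Proof.
move=> B0 k0 xe x0; have Bk : 0 <= B * k by apply: mulr_ge0.
have c0 : 0 < 3 * (B * k) + 1 by lra.
move: xe; rewrite ler_pdivlMr // => xe.
have -> : 3 * (B * (k * x)) = x * (3 * (B * k) + 1) - x by ring.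
lra.
Qed.

Section Integrability.
Variable A : arith.
Local Notation M := (dom A).
Local Notation Q := (QM A).
Local Notation env := (nat -> M).

Definition gridsum (G : Q -> M -> Q) (m n : M) : Q :=
  m%:q^-1 * psum (fun i => G (i%:q / m%:q) n) m.

Definition inner (l r : M -> Q) (eta : Q) (j : M) (g : Q) :=
  l j + eta <= g /\ g <= r j - eta.

(** What remains of a partition when its real endpoints are replaced with late entries of their
    sequences, which are accurate only up to [eta]. *)
Definition approx_partition (k : M) (l r : M -> Q) (eta : Q) :=
  [/\ forall g, 0 <= g -> g <= 1 ->
        exists2 j : M, j%:q < k%:q & l j - eta <= g /\ g <= r j + eta,
      forall g (j j' : M), j%:q < k%:q -> j'%:q < k%:q ->
        inner l r eta j g -> inner l r eta j' g -> j = j',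
      forall j : M, j%:q < k%:q -> l j <= r j + eta &
      forall g (j : M), j%:q < k%:q -> inner l r eta j g -> 0 <= g <= 1].

(** [d], [B] and [N] are fixed before the partition. Only the last summand involves the number [k]
    of intervals, and it is made small afterwards by the choice of [eta] and [m]. *)
Lemma riemann_close (G : Q -> M -> Q) (e : Q) : cohesion A -> QQFun G -> contq G -> 0 < e ->
  exists d B N, [/\ 0 < d, 0 <= B &
    forall (k m n n' : M) (l r t : M -> Q) (eta : Q), QFun1 l -> QFun1 r -> QFun1 t ->
    0 <= eta -> eta <= d -> N%:q <= n%:q -> N%:q <= n'%:q -> 0 < m%:q ->
    approx_partition k l r eta ->
    (forall j : M, j%:q < k%:q -> [/\ - eta <= t j, t j <= 1 + eta, l j - eta <= t j,
       t j <= r j + eta & r j - l j <= 2 * d]) ->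
    `|psum (fun j => G (t j) n * (r j - l j)) k - gridsum G m n'| <=
      e + 3 * (B * (k%:q * (2 * eta + m%:q^-1)))].
Proof.
move=> Hcoh HG CG e0.
have [N1 N10 H1] := uniform_continuity Hcoh HG CG e0.
have [B [B0 [N2 N20 H2]]] := uniform_bound Hcoh HG CG.
(* Tag and grid point lie in one interval of length at most [2 * d], widened by [eta <= d] on either
   side, and so are at most [4 * d] apart. *)
have [d d0 [d1 d2]] : exists2 d : Q, 0 < d & 4 * d <= N1%:q^-1 /\ 4 * d <= N2%:q^-1.
  have [N [n1 n2]] := bound2 N1 N2; have N0 : 0 < N%:q by lra.
  exists (N%:q^-1 / 4); first by rewrite divr_gt0 // invr_gt0.
  have -> : 4 * (N%:q^-1 / 4) = N%:q^-1 by lra.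
  by split; rewrite lef_pV2 ?posrE //; apply: ltW.
have [N [n1 n2]] := bound2 N1 N2.
exists d, B, N; split=>
  // k m n n' l r t eta Hl Hr Ht eta0 etad Nn Nn' m0 [P1 P2 P3 P4] Htag.
have grid (i : M) : i%:q < m%:q -> 0 <= i%:q / m%:q <= 1.
  move=> im; have i0 := iota_ge0 i; apply/andP; split.
    by apply: divr_ge0 => //; apply: ltW.
  by rewrite ler_pdivrMr // mul1r ltW.
have Hu : QFun1 (fun j => G (t j) n) by definable.
have Hv : QFun1 (fun i => G (i%:q / m%:q) n') by definable.
apply: (riemann_estimate Hl Hr Hu Hv m0 eta0 B0).
- by move=> i im; have /andP [g0 g1] := grid i im; apply: P1.
- by move=> i j j' _ jk jk' *; apply: (P2 (i%:q / m%:q)) => //; split.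
- exact: P3.
- move=> j jk lr; split.
  + by have /andP [] : 0 <= l j + eta <= 1 by apply: (P4 _ j) => //; split.
  + by have /andP [] : 0 <= r j - eta <= 1 by apply: (P4 _ j) => //; split.
- move=> j jk; have [t1 t2 _ _ _] := Htag j jk.
  by apply: H2; [lra|lra|apply: le_trans Nn; apply: ltW].
- move=> i j im jk g1 g2; have [t1 t2 t3 t4 t5] := Htag j jk; apply: ltW; apply: H1.
  + lra.
  + lra.
  + by apply: le_trans d1; apply: dist_interval t3 t4 g1 g2 t5 etad.
  + by apply: le_trans Nn; apply: ltW.
  + by apply: le_trans Nn'; apply: ltW.
Qed.

(** The integral as a sequence of rationals: grid and accuracy of the values are refined
    together. *)
Definition meanq (G : Q -> M -> Q) (n : M) : Q := gridsum G (n + 1) n.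

Lemma small_scale (B e d : Q) (k : M) : 0 <= B -> 0 < e -> 0 < d ->
  exists2 eta : Q, 0 < eta <= d & exists2 m0 : M, 0 < m0%:q & forall m : M, m0%:q <= m%:q ->
    3 * (B * (k%:q * (2 * eta + m%:q^-1))) <= e.
Proof.
move=> B0 e0 d0; have k0 := iota_ge0 k.
set c := 3 * (B * k%:q) + 1; have c0 : 0 < c by have := mulr_ge0 B0 k0; rewrite /c; lra.
have ec : 0 < e / c / 4 by do ?apply: divr_gt0.
have [m0 m00 Hm0] := pos_inv ec.
have [eta [h1 h2 h3]] : exists eta, [/\ 0 < eta, eta <= d & eta <= e / c / 4].
  have [H|H] := lerP d (e / c / 4); [by exists d|exists (e / c / 4)].
  by split=> //; apply: ltW.
exists eta; first by rewrite h1 h2.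
exists m0 => // m mm; have m1 : 0 < m%:q by lra.
have mi : m%:q^-1 <= m0%:q^-1 by rewrite lef_pV2 ?posrE.
have mi0 : 0 < m%:q^-1 by rewrite invr_gt0.
by apply: small_error => //; rewrite -/c; lra.
Qed.

Lemma uniform_approx (n : M) (eta : Q) : 0 < eta ->
  approx_partition (n + 1) (fun j => j%:q / (n + 1)%:q) (fun j =>
    (j%:q + 1) / (n + 1)%:q) eta.
Proof.
move=> eta0; have n0 : 0 < (n + 1)%:q by rewrite iotaD iota1; have := iota_ge0 n; lra.
set N := (n + 1)%:q in n0 *; have Ni : 0 < N^-1 by rewrite invr_gt0.
have E j : (j%:q + 1) / N = j%:q / N + N^-1 by rewrite mulrDl mul1r.
split.
- move=> g g0 g1; have [g1'|] := ltP g 1; last first.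
    move=> g1'; exists n; first by rewrite /N iotaD iota1; lra.
    have -> : (n%:q + 1) / N = 1 by rewrite /N iotaD iota1 mulfV // gt_eqF //; move: n0;
      rewrite /N iotaD iota1.
    have : n%:q / N <= 1 by rewrite ler_pdivrMr // mul1r /N iotaD iota1; lra.
    by split; lra.
  have gN0 : 0 <= g * N by apply: mulr_ge0 => //; apply: ltW.
  have f1 := ipart_le gN0; have f2 := ipart_lt (g * N).
  exists (ipart (g * N)).
    by apply: le_lt_trans f1 _; rewrite gtr_pMl.
  have h1 : (ipart (g * N))%:q / N <= g by rewrite ler_pdivrMr.
  have h2 : g <= ((ipart (g * N))%:q + 1) / N by rewrite ler_pdivlMr // ltW.
  by split; lra.
- have lt g (j j' : M) : inner (fun j => j%:q / N) (fun j => (j%:q + 1) / N) eta j g ->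
      inner (fun j => j%:q / N) (fun j => (j%:q + 1) / N) eta j' g -> j%:q < j'%:q -> False.
    move=> [_ a2] [b1 _] /iota_lt jj.
    have : (j%:q + 1) / N <= j'%:q / N by rewrite ler_pM2r.
    lra.
  move=> g j j' _ _ Hj Hj'; apply: iota_inj; apply: le_anti; rewrite !leNgt.
  by apply/andP; split; apply/negP; [apply: lt Hj' Hj|apply: lt Hj Hj'].
- by move=> j _; rewrite E; lra.
- move=> g j /iota_lt jN [a1 a2]; have j0 := iota_ge0 j.
  have : 0 <= j%:q / N by apply: divr_ge0 => //; apply: ltW.
  have : (j%:q + 1) / N <= 1 by rewrite ler_pdivrMr // mul1r.
  by move=> *; apply/andP; split; lra.
Qed.

(** The coarse grid is treated as a partition into [n + 1] intervals. The required fineness [m0]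
    depends on this number, the accuracy [N] does not. *)
Lemma mean_close (G : Q -> M -> Q) (e : Q) : cohesion A -> QQFun G -> contq G -> 0 < e ->
  exists N : M, forall n : M, N%:q <= n%:q -> exists m0 : M, forall m n' : M,
    m0%:q <= m%:q -> N%:q <= n'%:q -> `|meanq G n - gridsum G m n'| <= e + e.
Proof.
move=> Hcoh HG CG e0; have [d [B [N1 [d0 B0 H]]]] := riemann_close Hcoh HG CG e0.
have [N2 N20 HN2] := pos_inv d0.
have [N [n1 n2]] := bound2 N1 N2.
exists N => n Nn; have [eta /andP [eta0 etad] [m0 m00 Hm]] := small_scale (n + 1) B0 e0 d0.
exists m0 => m n' mm Nn'.
have nn : 0 < (n + 1)%:q by rewrite iotaD iota1; have := iota_ge0 n; lra.
have Ed (j : M) : (j%:q + 1) / (n + 1)%:q - j%:q / (n + 1)%:q = (n + 1)%:q^-1.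
  by rewrite mulrDl mul1r addrAC subrr add0r.
have nd : (n + 1)%:q^-1 <= d.
  apply: ltW; apply: le_lt_trans HN2; rewrite lef_pV2 ?posrE // iotaD iota1; lra.
have := H (n + 1) m n n' (fun j => j%:q / (n + 1)%:q) (fun j => (j%:q + 1) / (n + 1)%:q)
  (fun j => j%:q / (n + 1)%:q) eta.
have -> : psum (fun j => G (j%:q / (n + 1)%:q) n *
    ((j%:q + 1) / (n + 1)%:q - j%:q / (n + 1)%:q)) (n + 1) = meanq G n.
  rewrite /meanq /gridsum -psumZ; last by definable.
  by apply: psum_eq; [by definable|by definable|move=> j _; rewrite Ed mulrC].
move=> H'; apply: le_trans (H' _ _ _ _ _ _ _ _ _ _) _ => //; try by definable.
- exact: ltW.
- by apply: le_trans Nn; apply: ltW.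
- by apply: le_trans Nn'; apply: ltW.
- exact: lt_le_trans mm.
- exact: uniform_approx.
- move=> j /iota_lt jn; rewrite Ed; have j0 := iota_ge0 j.
  have h1 : 0 <= j%:q / (n + 1)%:q by apply: divr_ge0 => //; apply: ltW.
  have h2 : (j%:q + 1) / (n + 1)%:q <= 1 by rewrite ler_pdivrMr // mul1r.
  have h3 := Ed j; have h4 : 0 < (n + 1)%:q^-1 by rewrite invr_gt0.
  by clear - nd eta0 etad d0 h1 h2 h3 h4; split; lra.
- by rewrite lerD2l; apply: Hm.
Qed.

Lemma QFun1_mean (G : Q -> M -> Q) : QQFun G -> QFun1 (meanq G).
Proof. by move=> HG; rewrite /meanq /gridsum; definable. Qed.

(** Two means are compared with the sum over one grid that is fine enough for both. *)
Lemma mean_cauchy (G : Q -> M -> Q) : cohesion A -> QQFun G -> contq G -> cauchyq (meanq G).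
Proof.
(* Each of the two comparisons costs twice this amount. *)
move=> Hcoh HG CG e e0; have e5 : 0 < e / 5 by lra.
have [N HN] := mean_close Hcoh HG CG e5; exists N => a b Na Nb.
have [ma Ha] := HN a Na; have [mb Hb] := HN b Nb.
have [m [m1 m2]] := bound2 ma mb.
have h1 := Ha m N (ltW m1) (lexx _); have h2 := Hb m N (ltW m2) (lexx _).
rewrite distrC in h2.
apply: le_lt_trans (ler_distD (gridsum G m N) _ _) _; lra.
Qed.

Lemma cst_real (q : Q) : realq (fun _ : M => q).
Proof. by split; [definable|move=> e e0; exists 0 => m n _ _; rewrite subrr normr0]. Qed.

Lemma real_le_cst_inv (p q : Q) : real_le (fun _ : M => p) (fun=> q) -> p <= q.
Proof.
move=> H; rewrite leNgt; apply/negP => qp.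
have [|N HN] := H ((p - q) / 2); first by lra.
by have := HN N (lexx _); lra.
Qed.

(** A rational point is the real of a constant sequence, so the clauses of the real partition apply
    to it. Endpoints move by less than [eta / 4] after entry [n], and an inequality of reals holds
    up to [eta / 4] at some later entry. *)
Lemma partition_approx (k n : M) (l r : M -> M -> Q) (X Y : M -> Prop) (eta : Q) :
  partq k l r X Y -> 0 < eta ->
  (forall m : M, n%:q <= m%:q -> forall j : M, j%:q < k%:q ->
     `|l j m - l j n| < eta / 4 /\ `|r j m - r j n| < eta / 4) ->
  approx_partition k (fun j => l j n) (fun j => r j n) eta.
Proof.
move=> [P1 P2 P3] eta0 acc.
have acc' m j : n%:q <= m%:q -> j%:q < k%:q -> [/\ l j n - eta / 4 <= l j m,
    l j m <= l j n + eta / 4, r j n - eta / 4 <= r j m & r j m <= r j n + eta / 4].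
  move=> nm jk; have [] := acc m nm j jk; rewrite !ltr_norml => /andP [? ?] /andP [? ?].
  by split; lra.
have inn g j : j%:q < k%:q -> inner (fun j => l j n) (fun j => r j n) eta j g ->
    inq (l j) (r j) (X j) (Y j) (fun=> g).
  move=> jk [g1 g2].
  have L : real_lt (l j) (fun=> g).
    by apply: (real_lt_gap (d := eta / 2) (N := n)) => [|m nm]; [|have [] :=
      acc' m j nm jk]; lra.
  have R : real_lt (fun=> g) (r j).
    by apply: (real_lt_gap (d := eta / 2) (N := n)) => [|m nm]; [|have [] :=
      acc' m j nm jk]; lra.
  split=> [_|]; first exact: real_ltW.
  by split=> [_|] //; split=> [_|] //; apply: real_ltW.
have eta4 : 0 < eta / 4 by lra.
have lim f g j : j%:q < k%:q -> real_le f g -> exists2 m : M,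
  n%:q <= m%:q & f m <= g m + eta / 4.
  move=> jk H; have [N HN] := H _ eta4; have [m [m1 m2]] := bound2 N n.
  by exists m; [apply: ltW|apply/HN/ltW].
split.
- move=> g g0 g1; have [U _] := P3 _ (cst_real g).
  have [|j jk /inq_le [H1 H2]] := U.
    by split; apply: (real_le_of (N := n)).
  exists j => //; have [m1 nm1 h1] := lim _ _ j jk H1; have [m2 nm2 h2] := lim _ _ j jk H2.
  by have [? ? _ _] := acc' m1 j nm1 jk; have [_ _ ? ?] := acc' m2 j nm2 jk; split; lra.
- move=> g j j' jk jk' Hj Hj'; apply: contrapT => jj.
  exact: (P2 j j' jk jk' jj _ (cst_real g) (inn g j jk Hj) (inn g j' jk' Hj')).
- move=> j jk; have [m nm h] := lim _ _ j jk (P1 j jk).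
  by have [? ? ? ?] := acc' m j nm jk; lra.
- move=> g j jk /(inn g j jk) H; have [_ U] := P3 _ (cst_real g).
  have [|/real_le_cst_inv -> /real_le_cst_inv -> //] := U; by exists j.
Qed.

Lemma tag_approx (k n : M) (a b t : M -> Q) (p q : Prop) (eta : Q) :
  unitq t -> inq a b p q t -> 0 < eta ->
  (forall m : M, n%:q <= m%:q ->
    [/\ `|a m - a n| < eta / 4, `|b m - b n| < eta / 4 & `|t m - t n| < eta / 4]) ->
  [/\ - eta <= t n, t n <= 1 + eta, a n - eta <= t n & t n <= b n + eta].
Proof.
move=> [u1 u2] /inq_le [i1 i2] eta0 acc.
have eta4 : 0 < eta / 4 by lra.
have lim f g : real_le f g -> exists2 m : M, n%:q <= m%:q & f m <= g m + eta / 4.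
  move=> H; have [N HN] := H _ eta4; have [m [m1 m2]] := bound2 N n.
  by exists m; [apply: ltW|apply/HN/ltW].
have acc' m : n%:q <= m%:q -> [/\ a n - eta / 4 <= a m, b m <= b n + eta / 4,
    t n - eta / 4 <= t m & t m <= t n + eta / 4].
  move=> /acc []; rewrite !ltr_norml => /andP [? ?] /andP [? ?] /andP [? ?].
  by split; lra.
have [m1 /acc' [A1 A2 A3 A4] h1] := lim _ _ u1; have [m2 /acc' [B1 B2 B3 B4] h2] :=
  lim _ _ u2.
have [m3 /acc' [C1 C2 C3 C4] h3] := lim _ _ i1; have [m4 /acc' [D1 D2 D3 D4] h4] :=
  lim _ _ i2.
by split; lra.
Qed.

Theorem cohesion_integrable (G : Q -> M -> Q) : cohesion A -> QQFun G -> contq G ->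
  integrableq G.
Proof.
move=> Hcoh HG CG; exists (meanq G).
  by split; [apply: QFun1_mean|apply: mean_cauchy].
move=> e e0; have e3 : 0 < e / 3 by lra.
have [d [B [N1 [d0 B0 H]]]] := riemann_close Hcoh HG CG e3.
(* At a late entry the lengths are at most [d / 2 + d], within the [2 * d] allowed by
   [riemann_close]. The three thirds of [e] are for the oscillation of the function, for the term
   depending on [k], and for the gap of the strict inequality. *)
exists (d / 2); first by lra.
move=> k l r X Y Fl Fr P mesh t Ft Htag.
have [eta /andP [eta0 etad] [m0 m00 Hm]] := small_scale k B0 e3 d0.
have eta4 : 0 < eta / 4 by lra.
have [Nl Hl] := family_accuracy Fl eta4; have [Nr Hr] := family_accuracy Fr eta4.
have [Nt Ht] := family_accuracy Ft eta4.
have [Nm HNm] := mesh d d0.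
have [a1 [a11 a12]] := bound2 N1 m0; have [a2 [a21 a22]] := bound2 Nl Nr.
have [a3 [a31 a32]] := bound2 Nt Nm; have [a4 [a41 a42]] := bound2 a1 a2.
have [N [na3 na4]] := bound2 a3 a4.
apply: (real_lt_gap (d := e / 3) (N := N)) => // n Nn.
have [Cl _] := Fl; have [Cr _] := Fr; have [Ct Rt] := Ft.
have bnd : [/\ N1%:q <= n%:q, m0%:q <= n%:q, Nl%:q <= n%:q, Nr%:q <= n%:q &
    Nt%:q <= n%:q /\ Nm%:q <= n%:q].
  by clear - a11 a12 a21 a22 a31 a32 a41 a42 na3 na4 Nn; do ?split; lra.
have [b1 b2 b3 b4 [b5 b6]] := bnd.
have PA : approx_partition k (fun j => l j n) (fun j => r j n) eta.
  apply: (partition_approx P eta0) => m nm j jk.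
  by split; [apply: Hl => //; apply: le_trans nm|apply: Hr => //; apply: le_trans nm].
have n0 : 0 < (n + 1)%:q by rewrite iotaD iota1; have := iota_ge0 n; lra.
(* With the grid [n + 1] and accuracy [n] the grid sum is [meanq G n] itself. *)
have := H k (n + 1) n n (fun j => l j n) (fun j => r j n) (fun j => t j n) eta.
move=> H'; rewrite -lerBrDr distrC.
apply: le_trans (H' _ _ _ (ltW eta0) etad b1 b1 n0 PA _) _; try by definable.
- move=> j jk; have [_ _ P3] := P.
  have Rtj : realq (t j) by split; [definable|apply: Rt].
  have [] := @tag_approx k n (l j) (r j) (t j) (X j) (Y j) eta.
  + by apply/(P3 _ Rtj); exists j => //; apply: Htag.
  + exact: Htag.
  + by [].
  + by move=> m nm; split; [apply: Hl|apply: Hr|apply: Ht] => //; apply: le_trans nm.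
  + by move=> t1 t2 t3 t4; split=> //; have := HNm n b6 j jk; lra.
- have := Hm (n + 1); rewrite {1}iotaD iota1 => /(_ ltac:(lra)); lra.
Qed.

End Integrability.

(** * Riemann integrals yield cohesive sets *)

Section Digits.
Variable A : arith.
Local Notation M := (dom A).
Local Notation Q := (QM A).
Local Notation env := (nat -> M).
Variables (R : M -> M -> Prop) (HR : Delta1 (fun e : env => R (e 0%N) (e 1%N))).

Definition third (i : M) : Q := qprimrec 1 (fun _ w => w / 3) i.

Lemma third0 : third 0 = 1.
Proof. by apply: qprimrec0; definable. Qed.

Lemma thirdS i : third (i + 1) = third i / 3.
Proof. by rewrite /third qprimrecS //; definable. Qed.

Lemma QFun1_third : QFun1 third.
Proof.
apply: QFun1P; apply: (QComp_qprimrec (x := fun=> 1) (G := fun _ w _ => w / 3)); definable.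
Qed.

Lemma third_gt0 i : 0 < third i.
Proof.
have H := QFun1_third; move: i; apply: sigma1_induction; first by definable.
- by rewrite third0.
- by move=> i Hi; rewrite thirdS; lra.
Qed.

Lemma third_le i j : i%:q <= j%:q -> third j <= third i.
Proof.
have H := QFun1_third; move: j; suff: forall j : M, j%:q < i%:q \/ third j <= third i.
  by move=> Hj j ij; case: (Hj j) => //; rewrite ltNge ij.
apply: sigma1_induction; first by definable.
- have [->|[k ->]] := caseM i; first by right.
  by left; rewrite !iotaE; have := iota_ge0 k; lra.
- move=> j IH; have [ij|ij] := ltP (j + 1)%:q i%:q; [by left|right].
  case: IH => IH; last by rewrite thirdS; have := third_gt0 j; lra.
  have -> : i = j + 1.
    by apply: iota_inj; apply: le_anti; rewrite ij iotaD iota1 -iota_lt.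
  exact: lexx.
Qed.

Definition digit (n i : M) : Q := ite (R i n) 1 0.
Definition prefix (n i : M) : Q := psum (fun j => digit n j * (2 * third (j + 1))) i.
(* The point of the Cantor set with ternary digits [2 (R i n)], cut off after [n]. *)
Definition cantor (n : M) : Q := prefix n n.

Lemma QFun2_digit : QFun2 digit.
Proof. by have HR' := Delta1_op2 HR; apply: QFun2P; rewrite /digit; definable. Qed.

Lemma QFun2_prefix : QFun2 prefix.
Proof. by have H := QFun1_third; have H' := QFun2_digit; apply: QFun2P; rewrite /prefix;
  definable. Qed.

Lemma QFun1_cantor : QFun1 cantor.
Proof. by have H := QFun2_prefix; rewrite /cantor; definable. Qed.

Lemma prefixS n i : prefix n (i + 1) = prefix n i + digit n i * (2 * third (i + 1)).
Proof. by have H := QFun1_third; have H' := QFun2_digit; rewrite /prefix psumS //;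
  definable. Qed.

Lemma prefix0 n : prefix n 0 = 0.
Proof. by have H := QFun1_third; have H' := QFun2_digit; rewrite /prefix psum0 //;
  definable. Qed.

Lemma digit_bool n i : digit n i = 0 \/ digit n i = 1.
Proof. by rewrite /digit; have [r|r] := EM (R i n); [right; rewrite iteT|left;
  rewrite iteF]. Qed.

(** The tail is largest if all its digits are 2, and then it is a geometric sum equal to
    [third i - third k]. *)
Lemma prefix_tail n i k : i%:q <= k%:q ->
  prefix n i <= prefix n k /\ prefix n k <= prefix n i + third i - third k.
Proof.
have H1 := QFun1_third; have H2 := QFun2_prefix.
move=> ik; suff: k%:q < i%:q \/ (prefix n i <= prefix n k /\
    prefix n k <= prefix n i + third i - third k) by case=> //; rewrite ltNge ik.
move: k {ik}; apply: sigma1_induction; first by definable.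
- have [->|[j ->]] := caseM i; first by right; lra.
  by left; rewrite !iotaE; have := iota_ge0 j; lra.
- move=> k IH; have [ki|ik] := ltP (k + 1)%:q i%:q; [by left|right].
  have [E|ik'] : i = k + 1 \/ i%:q <= k%:q.
    move: ik; rewrite le_eqVlt => /orP [/eqP/iota_inj ->|]; first by left.
    by rewrite iotaD iota1 iota_le; right.
  + by rewrite E -[_ + _]/(k + 1); split; lra.
  + case: IH; first by rewrite ltNge ik'.
    rewrite prefixS thirdS; have := third_gt0 k.
    by case: (digit_bool n k) => -> *; lra.
Qed.

Lemma cantor_bounds n : 0 <= cantor n < 1.
Proof.
have := @prefix_tail n 0 n; rewrite iota0 iota_ge0 prefix0 third0 => /(_ isT) [h1 h2].
by have := third_gt0 n; rewrite /cantor => ?; apply/andP; split; lra.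
Qed.

(** At a first difference in position [j <= i] one point gains [2 * third (j + 1)], while the tail
    of the other makes up for less than [third (j + 1)]; so the points are more than [third (i + 1)]
    apart. *)
Lemma cantor_digit i n n' : i%:q < n%:q -> i%:q < n'%:q ->
  `|cantor n - cantor n'| < third (i + 1) -> digit n i = digit n' i.
Proof.
move=> i_n i_n' close.
have H1 := QFun1_third; have H2 := QFun2_prefix; have H3 := QFun2_digit.
have step m m' j : j%:q <= i%:q -> i%:q < m%:q -> i%:q < m'%:q ->
  prefix m j = prefix m' j ->
    digit m j = 1 -> digit m' j = 0 -> cantor m - cantor m' < third (i + 1) -> False.
  move=> ji im im' E d1 d0 C.
  have jm : (j + 1)%:q <= m%:q by rewrite iotaD iota1 -iota_lt; lra.
  have jm' : (j + 1)%:q <= m'%:q by rewrite iotaD iota1 -iota_lt; lra.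
  have [h1 _] := prefix_tail m jm; have [_ h2] := prefix_tail m' jm'.
  move: h1 h2; rewrite !prefixS d1 d0 E.
  have : third (i + 1) <= third (j + 1) by apply: third_le; rewrite !iotaE; lra.
  by have := third_gt0 m'; move: C; rewrite /cantor; lra.
have eqd j : j%:q <= i%:q -> prefix n j = prefix n' j -> digit n j = digit n' j.
  move=> ji E; move: close; rewrite ltr_norml => /andP [c1 c2].
  case: (digit_bool n j) => d; case: (digit_bool n' j) => d'; rewrite ?d ?d' //.
  - by case: (@step n' n j ji) => //; lra.
  - by case: (@step n n' j ji).
suff E : prefix n i = prefix n' i by apply: eqd.
apply: (bounded_induction (P := fun j => prefix n j = prefix n' j)); first by definable.
- by rewrite !prefix0.
- by move=> j ji E; rewrite !prefixS E (eqd j) // ltW.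
Qed.

(* Let [g k >= k] be the index of a point at distance at most 1 / (k + 1) from
   [f].  The range of [g] is computable because of [g k >= k], and along it the
   points converge, so that each of their digits settles. *)
Lemma cluster_cohesive (f : M -> Q) : realq f ->
  (forall N n0 : M, 0 < N%:q -> exists2 n : M, n0%:q <= n%:q &
     unbounded (fun k => `|cantor n - f k| < N%:q^-1)) ->
  exists2 C : M -> Prop, Delta1 (fun e : env => C (e 0%N)) & unbounded C /\
  forall i, eventually (fun n => C n -> R i n) \/ eventually (fun n => C n -> ~ R i n).
Proof.
move=> [Hf Cf] cluster; have Hx := QFun1_cantor.
pose T (z : M) (e : env) := (e 0%N)%:q <= (pfst z)%:q /\ (e 0%N)%:q <= (psnd z)%:q /\
  `|cantor (pfst z) - f (psnd z)| < (e 0%N + 1)%:q^-1.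
have HT : Delta1 (fun e => T (e 0%N) (fun i => e i.+1)) by rewrite /T; definable.
have ex e : exists z, T z e.
  have [|n n0 /(_ (e 0%N)) [k [k0 Hk]]] := cluster (e 0%N + 1) (e 0%N).
    by rewrite iotaD iota1; have := iota_ge0 (e 0%N); lra.
  by exists (pair n k); rewrite /T pfst_pair psnd_pair.
pose w k := least (T^~ (fun=> k)).
have Hw : forall h : env -> M, Comp h -> Comp (fun e => w (h e)) := Comp_op1 (op :=
  w) (Comp_least HT ex).
have wP k : T (w k) (fun=> k) by apply: (least_spec HT).
pose g k := pfst (w k).
have Hg : forall h : env -> M, Comp h -> Comp (fun e => g (h e)) by move=> h Hh;
  rewrite /g; definable.
have gk k : k%:q <= (g k)%:q by case: (wP k).
exists (fun n => exists k : M, k%:q < (n + 1)%:q /\ g k = n); first by definable.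
split=> [m|i].
  exists (g m); split=> //; exists m; split=> //.
  by rewrite iotaD iota1 iota_le.
pose d := third (i + 1); have d0 : 0 < d / 3 by rewrite divr_gt0 // third_gt0.
have [K HK] := Cf _ d0; have [K' K'0 HK'] := pos_inv d0.
have [K0 [KK K'K]] := bound2 K K'.
have close k : K0%:q <= k%:q -> exists2 k' : M,
  K%:q <= k'%:q & `|cantor (g k) - f k'| < d / 3.
  move=> Kk; have [_ [h1 h2]] := wP k; exists (psnd (w k)).
    by apply: le_trans h1; apply: le_trans Kk; apply: ltW.
  apply: lt_trans h2 _; apply: le_lt_trans HK'.
  have k0 := iota_ge0 k; rewrite lef_pV2 ?posrE // iotaD iota1; lra.
have close2 k k2 : K0%:q <= k%:q -> K0%:q <= k2%:q -> `|cantor (g k) - cantor (g k2)| < d.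
  move=> /close [a Ka Ha] /close [b Kb Hb]; have := HK a b Ka Kb; move: Ha Hb.
  rewrite !ltr_norml => /andP [? ?] /andP [? ?] /andP [? ?].
  by apply/andP; split; lra.
(* Beyond the values of [g] below [K0], elements of the range stem from [k >= K0]; beyond [i], digit
   [i] has not been cut off. *)
have [b Hb] := @Comp_bounded A g (Hg _ (Comp_var A 0%N)) K0.
have [N [bN iN]] := bound2 b i.
have Cg n : N%:q <= n%:q -> (exists k : M, k%:q < (n + 1)%:q /\ g k = n) ->
    exists2 k, K0%:q <= k%:q & g k = n.
  move=> Nn [k [_ E]]; exists k => //; rewrite leNgt; apply/negP => /Hb.
  by rewrite E ltNge ltW //; apply: lt_le_trans Nn.
have same n n' : N%:q <= n%:q -> N%:q <= n'%:q ->
    (exists k : M, k%:q < (n + 1)%:q /\ g k = n) ->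
    (exists k : M, k%:q < (n' + 1)%:q /\ g k = n') -> digit n i = digit n' i.
  move=> Nn Nn' /(Cg n Nn) [k Kk Ek] /(Cg n' Nn') [k' Kk' Ek'].
  apply: cantor_digit; [by apply: lt_le_trans Nn|by apply: lt_le_trans Nn'|].
  by rewrite -Ek -Ek'; apply: close2.
have R01 n : digit n i = 1 <-> R i n.
  rewrite /digit; have [r|r] := EM (R i n); first by rewrite iteT.
  by rewrite iteF //; split=> // /esym/eqP; rewrite oner_eq0.
have [[n [Nn [Cn Rn]]]|nR] := EM (exists n : M, N%:q <= n%:q /\
    (exists k : M, k%:q < (n + 1)%:q /\ g k = n) /\ R i n).
- left; exists N => n' Nn' Cn'; apply/R01; rewrite -(same n n') //; exact/R01.
- by right; exists N => n' Nn' Cn' Rn'; apply: nR; exists n'.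
Qed.

End Digits.

(** * Sums of bumps *)

Lemma max0_lipschitz (R : realDomainType) (a b : R) :
  `|Num.max 0 a - Num.max 0 b| <= `|a - b|.
Proof.
have [a0|a0] := lerP 0 a; have [b0|b0] := lerP 0 b => //.
- by rewrite subr0 (ger0_norm a0) ger0_norm; lra.
- by rewrite sub0r normrN (ger0_norm b0) ler0_norm; lra.
- by rewrite subrr normr0.
Qed.

Lemma bump_far (R : realFieldType) (x y q d n : R) : 0 < d -> 4 * d^-1 <= n ->
  d <= `|x - y| -> `|y - q| <= d / 2 -> 1 - n * `|q - x| <= 0.
Proof.
move=> d0 dn xy yq.
have qx : d / 2 <= `|q - x|.
  have := ler_distD q x y; rewrite (distrC q y) (distrC x q); lra.
have : n * (d / 2) <= n * `|q - x|.
  apply: ler_wpM2l => //; apply: le_trans dn.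
  by apply: mulr_ge0 => //; rewrite invr_ge0 ltW.
have : 4 * d^-1 * (d / 2) <= n * (d / 2) by apply: ler_wpM2r => //; lra.
have -> : 4 * d^-1 * (d / 2) = 2 by field; rewrite gt_eqF.
lra.
Qed.

Section Bumps.
Variable A : arith.
Local Notation M := (dom A).
Local Notation Q := (QM A).
Local Notation env := (nat -> M).
Variables (x : M -> Q) (Hx : QFun1 x).

(** A tent of height [n] and half-width [1 / (n + 1)]. The infinite sum of tents is represented by
    its partial sums, which is legitimate because no rate of convergence is demanded. *)
Definition bump (n : M) (q : Q) : Q := n%:q * Num.max 0 (1 - (n%:q + 1) * `|q - x n|).
Definition bumps (q : Q) (i : M) : Q := psum (fun n => bump n q) i.

Lemma QComp_bump (g : env -> Q) (h : env -> M) : QComp g -> Comp h -> QComp (fun e =>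
  bump (h e) (g e)).
Proof. by move=> Hg Hh; rewrite /bump; definable. Qed.

Lemma QQFun_bumps : QQFun bumps.
Proof.
apply: QQFunP; apply: (QComp_psum (F := fun n e => bump n (qval (e 0%N))));
  last by definable.
by apply: QComp_bump; definable.
Qed.

Lemma QFun1_bump q : QFun1 (fun n => bump n q).
Proof. by apply: QFun1P; apply: QComp_bump; definable. Qed.

Lemma bump_ge0 n q : 0 <= bump n q.
Proof. by apply: mulr_ge0; rewrite ?iota_ge0 // le_max lexx. Qed.

Lemma bumps_peak n i : n%:q < i%:q -> n%:q <= bumps (x n) i.
Proof.
move=> ni; rewrite -(psum_delta n%:q ni); apply: psum_le; [by definable|exact: QFun1_bump|].
move=> j _; have [E|nE] := EM (n = j); last by rewrite iteF // bump_ge0.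
by rewrite iteT // E /bump subrr normr0 mulr0 subr0 max_r // mulr1.
Qed.

Lemma bumps_tail q (n i : M) : n%:q <= i%:q ->
  (forall j : M, n%:q <= j%:q -> bump j q = 0) -> bumps q i = bumps q n.
Proof.
move=> ni H; have CF := QQFun_bumps; have HB := QFun1_bump q.
suff: i%:q < n%:q \/ bumps q i = bumps q n by case=> //; rewrite ltNge ni.
move: i {ni}; apply: sigma1_induction; first by definable.
- have [->|[j ->]] := caseM n; first by right.
  by left; rewrite !iotaE; have := iota_ge0 j; lra.
- move=> i IH; have [lt|] := ltP (i + 1)%:q n%:q; first by left.
  rewrite le_eqVlt => /orP [/eqP/iota_inj ->|]; first by right.
  rewrite iotaD iota1 iota_le => ni; right.
  case: IH => [|IH]; first by rewrite ltNge ni.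
  by rewrite /bumps psumS // H // addr0.
Qed.

Lemma bumps_lipschitz (n : M) : exists2 c : Q, 0 <= c & forall q r,
  `|bumps q n - bumps r n| <= c * `|q - r|.
Proof.
have Hf : QFun1 (fun j : M => j%:q * (j%:q + 1)) by definable.
have f0 (j : M) : 0 <= j%:q * (j%:q + 1).
  by have := iota_ge0 j => ?; apply: mulr_ge0 => //; lra.
(* The slopes of tent [j] are at most [j * (j + 1)] in absolute value. *)
exists (psum (fun j => j%:q * (j%:q + 1)) n); first exact: psum_ge0.
move=> q r; rewrite mulrC -psumZ // /bumps -psumB; [|exact: QFun1_bump|exact: QFun1_bump].
have Hq := QFun1_bump q; have Hr := QFun1_bump r.
apply: le_trans (psum_norm _ _) _; first by definable.
apply: psum_le; [by definable|by definable|move=> j _].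
rewrite /bump -mulrBr normrM ger0_norm ?iota_ge0 // mulrCA; apply: ler_wpM2l;
  first exact: iota_ge0.
apply: le_trans (max0_lipschitz _ _) _.
have -> : 1 - (j%:q + 1) * `|q - x j| - (1 - (j%:q + 1) * `|r - x j|) =
  (j%:q + 1) * (`|r - x j| - `|q - x j|) by ring.
have j1 : 0 <= j%:q + 1 by have := iota_ge0 j; lra.
rewrite normrM ger0_norm // (mulrC `|q - r|); apply: ler_wpM2l => //.
apply: le_trans (ler_dist_dist _ _) _.
have -> : r - x j - (q - x j) = r - q by ring.
by rewrite distrC.
Qed.

(* Where only finitely many of the [x n] are nearby, only finitely many of the
   bumps matter. *)
Lemma bumps_continuous :
  (forall f, realq f -> exists N n0 : M, 0 < N%:q /\ forall n : M, n0%:q <= n%:q ->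
     eventually (fun k => N%:q^-1 <= `|x n - f k|)) -> contq bumps.
Proof.
move=> H f Rf _ e e0; have [N [n0 [N0 HN]]] := H f Rf.
have Ni : 0 < N%:q^-1 by rewrite invr_gt0.
(* Tents from [n1] on have half-width below [1 / (4 * N)], while their centres are [1 / N] away from
   late entries of [f]. *)
have [n1 [n01 n1N]] : exists n1 : M, n0%:q <= n1%:q /\ 4 * N%:q <= n1%:q.
  have [n1 [h1 h2]] := bound2 n0 ((1 + 1 + 1 + 1) * N); exists n1.
  by move: h2; rewrite !iotaE => h2; split; lra.
have [c c0 Hc] := bumps_lipschitz n1.
(* Points of the ball of radius [1 / N'] are within [1 / (2 * N)] of late entries of [f], out of
   reach of the tents from [n1] on, and at most [3 / N'] apart, which the Lipschitz constant [c]
   turns into less than [e]. *)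
have [N' [N'0 [N'N [N'n1 N'c]]]] : exists N' : M, 0 < N'%:q /\ N'%:q^-1 <= N%:q^-1 / 4 /\
    n1%:q <= N'%:q /\ 3 * c * N'%:q^-1 < e.
  have [K HK] := archimedean (3 * c / e); have [N' [h1 h2]] := bound2 K n1.
  have N'0 : 0 < N'%:q by have := iota_ge0 n1; lra.
  have p1 : N'%:q^-1 <= N%:q^-1 / 4.
    have -> : N%:q^-1 / 4 = (4 * N%:q)^-1 by rewrite invfM mulrC.
    by rewrite lef_pV2 ?posrE; lra.
  have p2 : 3 * c * N'%:q^-1 < e.
    by rewrite ltr_pdivrMr // (mulrC e) -ltr_pdivrMr //; lra.
  by exists N'; do ![split=> //]; apply: ltW.
have near q : ballq N' f q -> forall d : Q, 0 < d ->
    eventually (fun k => `|f k - q| <= N'%:q^-1 + d).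
  by move=> [Hq _] d d0; have [K HK] := Hq d d0; exists K.
have zero q (n : M) : ballq N' f q -> n1%:q <= n%:q -> bump n q = 0.
  move=> Bq nn; have [|K HK] := near q Bq (N%:q^-1 / 4); first by lra.
  have [K' HK'] := HN n (le_trans n01 nn); have [k [k1 k2]] := bound2 K K'.
  have h1 := HK k (ltW k1); have h2 := HK' k (ltW k2).
  rewrite /bump max_l ?mulr0 //.
  apply: (bump_far Ni _ h2); first by rewrite invrK; lra.
  lra.
exists N'; split=> // q r Bq Br i j Ni' Nj'.
rewrite (bumps_tail (le_trans N'n1 Ni')) => [|m]; last exact: zero.
rewrite (bumps_tail (le_trans N'n1 Nj')) => [|m]; last exact: zero.
have N'i : 0 < N'%:q^-1 by rewrite invr_gt0.
have N'4 : 0 < N'%:q^-1 / 2 by lra.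
have [K1 H1] := near q Bq _ N'4; have [K2 H2] := near r Br _ N'4.
have [k [k1 k2]] := bound2 K1 K2; have h1 := H1 k (ltW k1); have h2 := H2 k (ltW k2).
apply: le_lt_trans (Hc q r) _; apply: le_lt_trans N'c.
have qr : `|q - r| <= 3 * N'%:q^-1.
  by have := ler_distD (f k) q r; rewrite (distrC q (f k)); lra.
have -> : 3 * c * N'%:q^-1 = c * (3 * N'%:q^-1) by ring.
exact: ler_wpM2l.
Qed.

End Bumps.

(** * Uniform partitions *)

Section UniformPartition.
Variable A : arith.
Local Notation M := (dom A).
Local Notation Q := (QM A).
Local Notation env := (nat -> M).
Variables (k : M) (k0 : 0 < k%:q).

Definition lower (j : M) (n : M) : Q := j%:q / k%:q.
Definition upper (j : M) (n : M) : Q := (j%:q + 1) / k%:q.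

Lemma real_le_csts (p q : Q) : p <= q -> real_le (fun _ : M => p) (fun=> q).
Proof. by move=> pq; apply: (real_le_of (N := 0)). Qed.

Lemma real_le_trans (f g h : M -> Q) : real_le f g -> real_le g h -> real_le f h.
Proof.
move=> H1 H2 e e0; have e2 : 0 < e / 2 by lra.
have [a Ha] := H1 _ e2; have [b Hb] := H2 _ e2; have [N [n1 n2]] := bound2 a b.
by exists N => n Nn; have := Ha n (le_trans (ltW n1) Nn); have :=
  Hb n (le_trans (ltW n2) Nn); lra.
Qed.

Lemma cauchy_le_frequent (f : M -> Q) (c : Q) : cauchyq f -> unbounded (fun n =>
  f n <= c) ->
  real_le f (fun=> c).
Proof.
move=> Cf H e e0; have [N HN] := Cf e e0; have [m [Nm Hm]] := H N; exists N => n Nn.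
by have := HN n m Nn Nm; rewrite ltr_norml => /andP [? ?]; lra.
Qed.

Lemma cauchy_ge_frequent (f : M -> Q) (c : Q) : cauchyq f -> unbounded (fun n =>
  c <= f n) ->
  real_le (fun=> c) f.
Proof.
move=> Cf H e e0; have [N HN] := Cf e e0; have [m [Nm Hm]] := H N; exists N => n Nn.
by have := HN n m Nn Nm; rewrite ltr_norml => /andP [? ?]; lra.
Qed.

Lemma unbounded_sub (P P' : M -> Prop) : (forall n, P n -> P' n) -> unbounded P ->
  unbounded P'.
Proof. by move=> H HP m; have [n [mn Pn]] := HP m; exists n; split=> //; apply: H. Qed.

Lemma last_cell j : j + 1 = k -> (j%:q + 1) / k%:q = 1.
Proof. by move=> E; rewrite -E iotaD iota1 mulfV // gt_eqF // -iota1 -iotaD E. Qed.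

Lemma cells_disjoint i j f : i%:q < j%:q -> j%:q < k%:q -> 
  inq (lower i) (upper i) True (i + 1 = k) f ->
    inq (lower j) (upper j) True (j + 1 = k) f -> False.
Proof.
move=> /iota_lt ij jk [_ [_ [_ H]]] [H' _].
have [|_] := H; first by move=> E; move: jk; rewrite -E iotaD iota1; lra.
apply; apply: real_le_trans (H' I); apply: real_le_csts.
by rewrite ler_pM2r ?invr_gt0.
Qed.

(** No single entry shows where a real lies. By the pigeonhole principle some cell contains
    arbitrarily late entries, and its closure contains the real because the entries form a Cauchy
    sequence. *)
Lemma cell_exists f : realq f -> unitq f ->
  exists2 j : M, j%:q < k%:q & inq (lower j) (upper j) True (j + 1 = k) f.
Proof.
move=> [Hf Cf] [u0 u1].
(* Entries of a real in the unit interval may lie outside it: negative ones count for cell 0, those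
   from 1 on get the extra color [k]. *)
pose col n := ite (f n * k%:q < k%:q) (ipart (Num.max 0 (f n * k%:q))) k.
have m0 n : 0 <= Num.max 0 (f n * k%:q) by rewrite le_max lexx.
have [||j [jk Hj]] := @pigeonhole A k col.
- apply: Comp_if; [by definable|apply: Comp_floor; by definable|by definable].
- move=> n; rewrite /col; have [lt|nlt] := EM (f n * k%:q < k%:q); last by rewrite iteF.
  rewrite iteT //; apply: le_trans (ipart_le (m0 n)) _.
  by rewrite ge_max ltW //= ltW.
have strict n : f n * k%:q < k%:q -> (ipart (Num.max 0 (f n * k%:q)))%:q < k%:q.
  by move=> lt; apply: le_lt_trans (ipart_le (m0 n)) _; rewrite gt_max k0.
have cell i : i%:q < k%:q -> real_le (lower i) f -> real_le f (upper i) ->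
    exists2 j : M, j%:q < k%:q & inq (lower j) (upper j) True (j + 1 = k) f.
  move=> ik l1 l2; have [E|nE] := EM (i + 1 = k).
    by exists i => //; split=> // ; split=> //; split.
  (* If [f] equals the right end of a half-open cell, it belongs to the next cell, which exists as
     [i + 1] is not [k]. *)
  have [g|ng] := EM (real_le (upper i) f); last first.
    by exists i => //; split=> //; split=> //; split.
  have i1k : (i + 1)%:q < k%:q.
    rewrite lt_neqAle; apply/andP; split; last by rewrite iotaD iota1 -iota_lt.
    by apply/eqP => /iota_inj.
  have up : real_le f (upper (i + 1)) /\ ~ real_le (upper (i + 1)) f.
    have lt : (i%:q + 1) / k%:q < ((i + 1)%:q + 1) / k%:q.
      by rewrite ltr_pM2r ?invr_gt0 // iotaD iota1; lra.
    split; first by apply: real_le_trans l2 _; apply: real_le_csts; apply: ltW.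
    by move=> H; have /real_le_cst_inv := real_le_trans H l2; rewrite leNgt lt.
  exists (i + 1) => //; split=> [_|]; first by rewrite /lower iotaD iota1.
  by split=> [nT|]; [case: nT|split=> _; [exact: (proj1 up)|exact: up]].
have [E|jk'] : j = k \/ j%:q < k%:q.
  by move: jk; rewrite le_eqVlt => /orP [/eqP/iota_inj|]; [left|right].
- have [k' Ek] := iota_pos k0; have k'k : k'%:q < k%:q by rewrite Ek; apply: lt_iotaS.
  apply: (cell k') => //; last first.
    by apply: real_le_trans u1 _; apply: real_le_csts; rewrite last_cell.
  apply: (real_le_trans (g := fun=> 1)).
    by apply: real_le_csts; rewrite ler_pdivrMr // mul1r ltW.
  apply: cauchy_ge_frequent => //; apply: unbounded_sub Hj => n; rewrite /col E.
  have [lt|nlt] := EM (f n * k%:q < k%:q).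
    by rewrite iteT // => Ec; have := strict n lt; rewrite Ec ltxx.
  by move: nlt => /negP; rewrite -leNgt -{1}[k%:q]mul1r ler_pM2r.
- have Hj' : unbounded (fun n => f n * k%:q < k%:q /\ ipart (Num.max 0 (f n * k%:q)) = j).
    apply: unbounded_sub Hj => n; rewrite /col; have [lt|nlt] := EM (f n * k%:q < k%:q).
      by rewrite iteT.
    by rewrite iteF // => Ec; move: jk'; rewrite -Ec ltxx.
  apply: (cell j) => //.
  + have [->|[j' Ej]] := caseM j.
      by apply: real_le_trans u0; apply: real_le_csts; rewrite iota0 mul0r.
    apply: cauchy_ge_frequent => //; apply: unbounded_sub Hj' => n [_ Ei].
    rewrite ler_pdivrMr //; have := ipart_le (m0 n); rewrite Ei le_max => /orP [|//].
    by rewrite Ej iotaD iota1; have := iota_ge0 j'; lra.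
  + apply: cauchy_le_frequent => //; apply: unbounded_sub Hj' => n [_ Ei].
    rewrite ler_pdivlMr //; apply: ltW; have := ipart_lt (Num.max 0 (f n * k%:q)).
    by rewrite Ei gt_max => /andP [].
Qed.

Lemma uniform_partq : partq k lower upper (fun=> True) (fun j => j + 1 = k).
Proof.
split.
- by move=> j _; apply: real_le_csts; rewrite ler_pM2r ?invr_gt0 //; lra.
- move=> i j ik jk ij f _ Hi Hj.
  have [//|[[z E]|[z E]]] := casesM i j.
  + by apply: (@cells_disjoint j i f) => //; rewrite E !iotaE; have := iota_ge0 z; lra.
  + by apply: (@cells_disjoint i j f) => //; rewrite E !iotaE; have := iota_ge0 z; lra.
- move=> f Rf; split=> [Uf|[j jk /inq_le [H1 H2]]]; first exact: cell_exists.
  split.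
  + by apply: real_le_trans H1; apply: real_le_csts; apply: divr_ge0; [apply:
      iota_ge0|apply: ltW].
  + apply: real_le_trans H2 _; apply: real_le_csts.
    by rewrite ler_pdivrMr // mul1r -iota_lt.
Qed.

End UniformPartition.

(** * Unbounded Riemann sums *)

Section Reversal.
Variable A : arith.
Local Notation M := (dom A).
Local Notation Q := (QM A).
Local Notation env := (nat -> M).

Lemma retag (G : Q -> M -> Q) (k j N : M) (q : Q) : QQFun G -> j%:q < k%:q ->
  riemannq G k (lower k) (upper k) (fun i _ => ite (j = i) q (i%:q / k%:q)) N -
  riemannq G k (lower k) (upper k) (lower k) N =
  (G q N - G (j%:q / k%:q) N) * k%:q^-1.
Proof.
move=> HG jk; rewrite /riemannq /lower /upper.
rewrite -psumB; [|by definable|by definable].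
rewrite -[RHS](psum_delta _ jk); apply: psum_eq; [by definable|by definable|move=> i _].
have -> : (i%:q + 1) / k%:q - i%:q / k%:q = k%:q^-1 by rewrite mulrDl mul1r addrAC subrr add0r.
rewrite -mulrBl; have [<-|n] := EM (j = i); first by rewrite !iteT.
by rewrite !iteF // subrr mul0r.
Qed.

Lemma unbounded_not_integrable (G : Q -> M -> Q) (x : M -> Q) (J : M -> Q) (k : M) :
  QFun1 x -> QQFun G -> contq G -> (forall n, 0 <= x n < 1) ->
  (forall n i : M, n%:q < i%:q -> n%:q <= G (x n) i) -> 0 < k%:q ->
  (forall t, familyq k t ->
    (forall j : M, j%:q < k%:q -> inq (lower k j) (upper k j) True (j + 1 = k) (t j)) ->
    real_le (fun n => `|J n - riemannq G k (lower k) (upper k) t n|) (fun=> 1)) -> False.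
Proof.
move=> Hx HG CG x01 peak k0 HJ.
have ki : 0 < k%:q^-1 by rewrite invr_gt0.
have xk n : 0 <= x n * k%:q by have /andP [? _] := x01 n; apply: mulr_ge0 => //; apply: ltW.
have xk1 n : x n * k%:q < k%:q by have /andP [_ ?] := x01 n; rewrite gtr_pMl.
have cellk n : (ipart (x n * k%:q))%:q < k%:q by apply: le_lt_trans (ipart_le (xk n)) _.
have [||j [_ Hj]] := @pigeonhole A k (fun n => ipart (x n * k%:q)).
- by apply: Comp_floor; definable.
- by move=> n; apply: ltW.
have jk : j%:q < k%:q by have [n [_ <-]] := Hj 0.
have j0 := iota_ge0 j.
have inlow (i : M) : i%:q < k%:q -> inq (lower k i) (upper k i) True (i + 1 = k) (fun=>
  i%:q / k%:q).
  move=> ik; have lt : real_lt (fun _ : M => i%:q / k%:q) (upper k i).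
    apply: (real_lt_gap (d := k%:q^-1) (N := 0)) => // n _.
    by rewrite /upper mulrDl mul1r.
  split=> [_|]; first exact: real_le_csts.
  by split=> [nT|]; [case: nT|split=> _ //; apply: real_ltW].
have inx n : ipart (x n * k%:q) = j ->
  inq (lower k j) (upper k j) True (j + 1 = k) (fun=> x n).
  move=> E; have f1 := ipart_le (xk n); have f2 := ipart_lt (x n * k%:q).
  rewrite E in f1 f2.
  have lt : real_lt (fun _ : M => x n) (upper k j).
    apply: (real_lt_gap (d := (j%:q + 1) / k%:q - x n) (N := 0)) => [|m _].
      by rewrite subr_gt0 ltr_pdivlMr.
    by rewrite addrC subrK.
  split=> [_|]; first by apply: real_le_csts; rewrite ler_pdivrMr.
  by split=> [nT|]; [case: nT|split=> _ //; apply: real_ltW].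
have base := HJ (lower k) _ inlow.
have {}base : real_le (fun n =>
  `|J n - riemannq G k (lower k) (upper k) (lower k) n|) (fun=> 1).
  apply: base; split; first by rewrite /lower; definable.
  by move=> i _; have [_] := cst_real (i%:q / k%:q).
have [N0 H0] := base 1 ltr01.
(* Continuity at the original tag [q] keeps [G q N] within 1 of the fixed value [G q N1] for all
   late [N]. *)
pose q := j%:q / k%:q.
have IG : indomq G (fun=> q).
  apply: CG; first exact: cst_real.
  split; apply: real_le_csts; first by apply: divr_ge0 => //; apply: ltW.
  by rewrite ler_pdivrMr // mul1r ltW.
have [N1 [N10 H1]] := IG 1 ltr01.
have ballq1 : ballq N1 (fun=> q) q.
  apply: (real_lt_gap (d := N1%:q^-1) (N := 0)) => [|n _]; first by rewrite invr_gt0.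
  by rewrite subrr normr0 add0r.
(* At a late entry either Riemann sum is within 2 of [J], so they differ by at most 4. As the
   difference is [1 / k] times the change of one value, that change is at most [4 * k], whereas the
   peak at [x n] is at least [n]. *)
have [m Hm] := archimedean (4 * k%:q + G q N1 + 1).
have [n [mn En]] := Hj m.
pose t (i n' : M) := ite (j = i) (x n) (i%:q / k%:q).
have Ft : familyq k t.
  split; first by rewrite /t; definable.
  by move=> i _; have [_] := cst_real (ite (j = i) (x n) (i%:q / k%:q)).
have [|N2 H2] := HJ t Ft _ 1 ltr01.
  move=> i ik; rewrite /t; have [E|nE] := EM (j = i); last first.
    by rewrite (_ : (fun _ : M => _) = fun=> i%:q / k%:q); [apply: inlow|apply: funext =>
      ?; rewrite iteF].
  rewrite -E (_ : (fun _ : M => _) = fun=> x n); first exact: inx.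
  by apply: funext => ?; rewrite iteT.
have [a [a1 a2]] := bound2 N0 N1; have [b [b1 b2]] := bound2 N2 n.
have [N [n1 n2]] := bound2 a b.
have h0 := H0 N (ltW (lt_trans a1 n1)); have h2 := H2 N (ltW (lt_trans b1 n2)).
have h1 := H1 q q ballq1 ballq1 N N1 (ltW (lt_trans a2 n1)) (lexx _).
have p := peak n N (lt_trans b2 n2).
have re := retag N (x n) HG jk.
have : (G (x n) N - G q N) * k%:q^-1 <= 4.
  move: h0 h2; rewrite -re !ler_norml => /andP [u1 u2] /andP [u3 u4].
  by clear - u1 u2 u3 u4; rewrite -/t; lra.
rewrite ler_pdivrMr // => bound; move: h1; rewrite ltr_norml => /andP [v1 v2].
by clear - bound v1 v2 p Hm mn; lra.
Qed.

Theorem integrable_cohesion :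
  (forall G : Q -> M -> Q, QQFun G -> contq G -> exists2 J, realq J &
   forall e : Q, 0 < e -> exists2 d : Q, 0 < d &
    forall (k : M) l r X Y (c : Q), 0 < k%:q -> c < d ->
    familyq k l -> familyq k r ->
    Delta1 (fun e : env => X (e 0%N)) -> Delta1 (fun e : env => Y (e 0%N)) ->
      partq k l r X Y ->
    (forall j n : M, j%:q < k%:q -> r j n - l j n = c) ->
    forall t, familyq k t -> (forall j : M, j%:q < k%:q ->
      inq (l j) (r j) (X j) (Y j) (t j)) ->
    real_le (fun n => `|J n - riemannq G k l r t n|) (fun=> e)) -> cohesion A.
Proof.
move=> H R HR; apply: contrapT => nC.
pose x := cantor R; have Hx : QFun1 x := QFun1_cantor HR.
(* Without a cohesive set no real is a cluster point in the sense of [cluster_cohesive]; negating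
   this condition gives the hypothesis of [bumps_continuous]. *)
have CG : contq (bumps x).
  apply: bumps_continuous => // f Rf; apply: contrapT => nN; apply: nC.
  apply: (cluster_cohesive HR Rf) => N n0 N0; apply: contrapT => nn; apply: nN.
  exists N, n0; split=> // n nn0; apply: contrapT => ne; apply: nn; exists n => // m.
  apply: contrapT => nk; apply: ne; exists m => k mk.
  by rewrite leNgt; apply/negP => lt; apply: nk; exists k.
have [J _ HJ] := H _ (QQFun_bumps Hx) CG.
have [d d0 Hd] := HJ 1 ltr01; have [k k0 kd] := pos_inv d0.
apply: (@unbounded_not_integrable (bumps x) x J k Hx (QQFun_bumps Hx) CG _ _ k0).
- exact: cantor_bounds.
- by move=> n i; apply: bumps_peak.
- move=> t Ft Ht; apply: (Hd k (lower k) (upper k) (fun=> True) (fun j =>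
    j + 1 = k) k%:q^-1) => //.
  + split; first by rewrite /lower; definable.
    by move=> i _; have [_] := cst_real (i%:q / k%:q).
  + split; first by rewrite /upper; definable.
    by move=> i _; have [_] := cst_real ((i%:q + 1) / k%:q).
  + exact: Delta1_true.
  + by definable.
  + exact: uniform_partq.
  + by move=> j n _; rewrite /upper /lower mulrDl mul1r addrAC subrr add0r.
Qed.

End Reversal.

Theorem theorem6p4 :
  equivalent_over RCA0_IPP
    (sentence COH) (sentence continuous_riemann_integrable).
Proof.
apply: completeness; first exact: RCA0_IPP_subst.
(* The set environment supplies the default set of the model. *)
move=> M HM e d; pose A := Arith HM (d 0).
have E : t_COH (std_connectives (dom A) (sets A)) <->
    t_CRI (std_connectives (dom A) (sets A)).
  rewrite (t_COH_iff A); split=> [Hcoh F /t_continuousE [HF CF]|H].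
  - by apply: t_integrable_of => //; apply: cohesion_integrable => //; apply: t_partialP.
  - apply: integrable_cohesion => G HG CG; have [F HF EF] := partial_exists HG.
    subst G; apply: (t_integrable_elim HF); apply: H.
    by apply/(t_continuousE (A := A)).
have EC := @sat_COH A e d; have EI := @sat_CRI A e d.
rewrite connectivesE in EC; rewrite connectivesE in EI.
rewrite -EC -EI in E; case: E => H1 H2.
by move=> H; apply: (H H1 H2).
Qed.
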